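(* Partial Connected Red-Blue Dominating Set admits a deterministic algorithm running in time $\mathcal{O}^\star((2e)^{t+o(t)})$ that decides every instance correctly, and a randomized algorithm running in time $\mathcal{O}^\star((2e)^{t})$ that outputs the correct answer with probability at least $1-1/e$.
   Context: An instance of Partial Connected Red-Blue Dominating Set is $(G_{\mathrm{conn}},G_{\mathrm{cov}},k,t)$ where $G_{\mathrm{conn}}=(R,E)$ is an arbitrary graph, $G_{\mathrm{cov}}=(R\uplus B,E')$ is a bipartite graph with sides $R$ and $B$, and $k,t$ are non-negative integers; the question is whether there is $S\subseteq R$ with $|S|\le k$, $G_{\mathrm{conn}}[S]$ connected and $|N_{G_{\mathrm{cov}}}(S)|\ge t$. $\mathcal{O}^\star(T)$ means $T\cdot|I|^{\mathcal{O}(1)}$ where $|I|$ is the input size. *)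

(* Defs.v *)
From Corelib Require Import BinNums.
From mathcomp Require Import all_boot all_order all_algebra.
From mathcomp Require Import all_classical all_reals all_analysis.

Set Implicit Arguments.
Unset Strict Implicit.
Unset Printing Implicit Defensive.
Import Order.TTheory GRing.Theory Num.Theory.

(** Machine model: Jones' language WHILE ("Computability and Complexity", MIT Press 1997) over
  binary trees, with fair coin tosses added.  Trees are immutable, so a cell of
  a pointer machine represents every constructed node and each operation below
  is O(1) pointer operations.  Conversely a RAM memory can be kept as a balanced
  tree.  A computation of length T thus translates from and to a logarithmic-cost
  RAM with an overhead polynomial in log T only, and not merely polynomial in T;
  therefore the base of an exponential bound keeps its meaning in this model. *)

Inductive tree := Leaf | Node of tree & tree.

(* Number of nodes, i.e. the length of the preorder encoding by bits. *)
Fixpoint tree_size (x : tree) : nat :=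
  if x is Node a b then (tree_size a + tree_size b).+1 else 1.

Inductive expr :=
  | EVar of nat
  | ELeaf
  | ENode of expr & expr
  | EHd of expr
  | ETl of expr.

Inductive cmd :=
  | CSkip
  | CAssign of nat & expr
  | CFlip of nat
  | CSeq of cmd & cmd
  | CIf of expr & cmd & cmd
  | CWhile of expr & cmd.

Definition store := nat -> tree.

Definition update (s : store) (i : nat) (v : tree) : store :=
  fun j => if j == i then v else s j.

Definition hd (x : tree) : tree := if x is Node a _ then a else Leaf.
Definition tl (x : tree) : tree := if x is Node _ b then b else Leaf.

Fixpoint eval (s : store) (e : expr) : tree :=
  match e with
  | EVar i => s i
  | ELeaf => Leaf
  | ENode e1 e2 => Node (eval s e1) (eval s e2)
  | EHd e1 => hd (eval s e1)
  | ETl e1 => tl (eval s e1)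
  end.

Fixpoint expr_cost (e : expr) : nat :=
  match e with
  | EVar _ | ELeaf => 1
  | ENode e1 e2 => (expr_cost e1 + expr_cost e2).+1
  | EHd e1 | ETl e1 => (expr_cost e1).+1
  end.

Definition tree_of_bool (b : bool) : tree := if b then Node Leaf Leaf else Leaf.

Definition truth (x : tree) : bool := if x is Node _ _ then true else false.

(* [exec c s w s' w' n]: started in store [s] with coin tape [w], the command
   [c] halts after [n] steps in store [s'], with [w'] the unread part of the
   tape.  A toss on an exhausted tape is stuck, so it does not halt. *)
Inductive exec : cmd -> store -> seq bool -> store -> seq bool -> nat -> Prop :=
  | ExecSkip s w : exec CSkip s w s w 1
  | ExecAssign i e s w :
      exec (CAssign i e) s w (update s i (eval s e)) w (expr_cost e).+1
  | ExecFlip i s b w :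
      exec (CFlip i) s (b :: w) (update s i (tree_of_bool b)) w 1
  | ExecSeq c1 c2 s0 w0 s1 w1 s2 w2 n1 n2 :
      exec c1 s0 w0 s1 w1 n1 -> exec c2 s1 w1 s2 w2 n2 ->
      exec (CSeq c1 c2) s0 w0 s2 w2 (n1 + n2).+1
  | ExecIf e c1 c2 s w s' w' n :
      exec (if truth (eval s e) then c1 else c2) s w s' w' n ->
      exec (CIf e c1 c2) s w s' w' (expr_cost e + n).+1
  | ExecWhileDone e c s w :
      ~~ truth (eval s e) -> exec (CWhile e c) s w s w (expr_cost e).+1
  | ExecWhileStep e c s0 w0 s1 w1 s2 w2 n1 n2 :
      truth (eval s0 e) ->
      exec c s0 w0 s1 w1 n1 -> exec (CWhile e c) s1 w1 s2 w2 n2 ->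
      exec (CWhile e c) s0 w0 s2 w2 (expr_cost e + n1 + n2).+1.

Fixpoint coin_free (c : cmd) : bool :=
  match c with
  | CSkip | CAssign _ _ => true
  | CFlip _ => false
  | CSeq c1 c2 | CIf _ c1 c2 => coin_free c1 && coin_free c2
  | CWhile _ c1 => coin_free c1
  end.

(* Variable 0 holds the input at the start and the output at the end; all other
   variables start as [Leaf]. *)
Definition runs (c : cmd) (x : tree) (w : seq bool) (y : tree) (n : nat) : Prop :=
  exists s' w',
    exec c (update (fun=> Leaf) 0 x) w s' w' n /\ s' 0 = y.

(** Instances [I] are written as [enc I], so that |I| is [tree_size (enc I)];
  [T] bounds the dependence on the parameter [par I]. *)

Local Open Scope ring_scope.

Section Algorithms.
Variables (R : realType) (inst : Type).
Variables (enc : inst -> tree) (par : inst -> nat) (yes : inst -> bool).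

Definition deterministic_Ostar (T : nat -> R) : Prop :=
  exists (c : cmd) (d : nat), coin_free c /\
    forall I : inst, exists n : nat,
      runs c (enc I) [::] (tree_of_bool (yes I)) n /\
      n%:R <= T (par I) * (tree_size (enc I))%:R ^+ d.

(* The probability of a correct answer is taken over [m] independent fair coins,
   where [m] is large enough for all runs to halt within [m] tosses; it does not
   depend on [m], since further coins are not read.  The time bound holds for
   all outcomes of the coins. *)
Definition randomized_Ostar (T : nat -> R) (q : R) : Prop :=
  exists (c : cmd) (d : nat),
    forall I : inst, exists m : nat,
      (forall w : m.-tuple bool, exists (y : tree) (n : nat),
         runs c (enc I) w y n /\
         n%:R <= T (par I) * (tree_size (enc I))%:R ^+ d) /\
      q <= #|[set w : m.-tuple bool |
               `[< exists n, runs c (enc I) w (tree_of_bool (yes I)) n >]]|%:R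
           / 2 ^+ m.

End Algorithms.

Local Close Scope ring_scope.

(* The edges of the bipartite graph on the disjoint union of the sides R and B
   are given as a relation from R to B. *)
Record pcrbds := Pcrbds {
  nR : nat;
  nB : nat;
  gconn : rel 'I_nR;
  gconn_sym : symmetric gconn;
  gconn_irr : irreflexive gconn;
  gcov : 'I_nR -> 'I_nB -> bool;
  budget : nat;
  target : nat }.

Definition induced (V : finType) (g : rel V) (S : {set V}) : rel V :=
  [rel u v | [&& u \in S, v \in S & g u v]].

(* The empty set induces a connected graph under this definition. *)
Definition connected_in (V : finType) (g : rel V) (S : {set V}) : bool :=
  [forall u in S, forall v in S, connect (induced g S) u v].

Definition cov_nbhd (I : pcrbds) (S : {set 'I_(nR I)}) : {set 'I_(nB I)} :=
  [set b | [exists r in S, gcov r b]].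

Definition pcrbds_yes (I : pcrbds) : bool :=
  [exists S : {set 'I_(nR I)},
    [&& #|S| <= budget I, connected_in (@gconn I) S
      & target I <= #|cov_nbhd S|]].

Definition tree_of_seq (T : Type) (f : T -> tree) (s : seq T) : tree :=
  foldr (fun a x => Node (f a) x) Leaf s.

Fixpoint pos_bits (p : positive) : seq bool :=
  match p with
  | xH => [:: true]
  | xO p' => false :: pos_bits p'
  | xI p' => true :: pos_bits p'
  end.

(* Binary, least significant bit first. *)
Definition nat_bits (n : nat) : seq bool :=
  if bin_of_nat n is Npos p then pos_bits p else [::].

Definition tree_of_nat (n : nat) : tree := tree_of_seq tree_of_bool (nat_bits n).

Definition tree_of_matrix (m n : nat) (a : 'I_m -> 'I_n -> bool) : tree :=
  tree_of_seq (fun i => tree_of_seq tree_of_bool [seq a i j | j <- enum 'I_n])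
    (enum 'I_m).

Definition pcrbds_enc (I : pcrbds) : tree :=
  tree_of_seq id
    [:: tree_of_seq (fun=> Leaf) (enum 'I_(nR I));
        tree_of_seq (fun=> Leaf) (enum 'I_(nB I));
        tree_of_matrix (@gconn I);
        tree_of_matrix (@gcov I);
        tree_of_nat (budget I);
        tree_of_nat (target I)].

(* Main.v *)
(** If a solution covers [t] elements of [B] with pairwise distinct colours, it
  suffices to find a connected set of at most [k] red vertices that sees [t] of
  the [s] colours.  The branching walks with [k] leaves (Nederlof), extended by
  [s - t] joker colours, that see all [s] colours are counted by
  inclusion-exclusion over the [2^s] sets of colours, in polynomial time for each
  set.  The count is tested modulo polynomially many small moduli, in unary:
  a positive number below [2^n] is not divisible by all [m <= 2 n].

  With [s = 3 t / 2] colours a random colouring is injective on a given [t]-set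
  with probability about [(sqrt 3 / e)^t], so a near-optimal family of colourings
  leads to [(8 e^2 / 3)^(t/2) < (4.44)^t] instead of [(2 e)^t].  The slack pays
  for an explicit family: reduce the elements modulo some [m], cut the range at
  some point, recurse with half of [t] on both sides, down to blocks of constant
  size, where a good family exists by averaging and is a constant of the
  program.  Replacing [t] by [t + log |B|] makes the first modulus polynomial in
  [t].  Hence a single deterministic algorithm in time [(2 e)^t |I|^O(1)] serves
  both claims, with [g = 0] and without any coin. *)

Require Import Defs.
From mathcomp Require Import all_boot zify ring.

Set Implicit Arguments.
Unset Strict Implicit.
Unset Printing Implicit Defensive.

(** * Programs with time bounds *)

(** The deterministic bound has no room for a factor exponential in o(t), so each block has to
    satisfy [Z * 2 ^ c <= (2 e) ^ l] by itself, where [Z] accounts for all that one block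
    contributes to the size of the family. With as many colours as elements, about [e ^ t]
    colourings and [2 ^ t] colour sets already use up [(2 e) ^ t], and nothing is left for moduli
    and cuts. Half as many colours again shrink the family by [sqrt 3 ^ t] and multiply the colour
    sets by [sqrt 2 ^ t] only. For a block of [2 u] elements this gains [(3 / 2) ^ u] against an
    overhead polynomial in [u], so a large constant [u] settles the matter. The base also dictates
    the two notions of running time. The family and the colour sets are exponentially long lists,
    and a function merely polynomial in the size of such a list would spoil the base. Code that
    handles them is analysed by [timed], exact up to a constant factor; [polytime] is reserved for
    the work done per element and for the parameters. *)

Class encodable (A : Type) := encode : A -> tree.

#[export] Instance encodable_unit : encodable unit := fun=> Leaf.
#[export] Instance encodable_bool : encodable bool := tree_of_bool.
(** Unary, so that a number is encoded like a list of leaves: successor and predecessor take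
    constant time, and every counted loop is a loop over a list. *)
#[export] Instance encodable_nat : encodable nat := fun n => iter n (Node Leaf) Leaf.
#[export] Instance encodable_prod A B (eA : encodable A) (eB : encodable B) :
  encodable (A * B) := fun x => Node (encode x.1) (encode x.2).
#[export] Instance encodable_seq A (eA : encodable A) : encodable (seq A) :=
  tree_of_seq encode.

Lemma encode_nseq n : encode (nseq n tt) = encode n.
Proof. by elim: n => // n IH; rewrite -[RHS]/(Node Leaf (encode n)) -IH. Qed.

Definition sz A {eA : encodable A} (a : A) : nat := tree_size (encode a).

(* The frame condition on the variables from [N] on is what lets programs be
   composed without renaming; the constant factor [K] makes [tau] an O-bound. *)
Definition timed A B {eA : encodable A} {eB : encodable B}
    (f : A -> B) (tau : A -> nat) : Prop :=
  exists c N K, coin_free c /\ forall a s w, s 0 = encode a ->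
    exists s' n, [/\ exec c s w s' w n, s' 0 = encode (f a),
      forall j, N <= j -> s' j = s j & n <= K * (tau a).+1].

Lemma update_eq s i v j : j = i -> update s i v j = v.
Proof. by move=> ->; rewrite /update eqxx. Qed.

Lemma update_neq s i v j : j <> i -> update s i v j = s j.
Proof. by move=> ne; rewrite /update; case: eqP. Qed.

Section Timed.

Context {A B C X S : Type} {eA : encodable A} {eB : encodable B}
  {eC : encodable C} {eX : encodable X} {eS : encodable S}.

Lemma timed_expr (f : A -> B) e :
  (forall s a, s 0 = encode a -> eval s e = encode (f a)) -> timed f (fun=> 0).
Proof.
move=> ev; exists (CAssign 0 e), 1, (expr_cost e).+1; split=> // a s w s0.
exists (update s 0 (eval s e)), (expr_cost e).+1; split=> //.
- exact: ExecAssign.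
- by rewrite update_eq // (ev s a).
- by move=> j j1; rewrite update_neq //; lia.
- by rewrite muln1.
Qed.

Lemma timed_le (f : A -> B) t1 t2 :
  timed f t1 -> (forall a, t1 a <= t2 a) -> timed f t2.
Proof.
move=> [c [N [K [cf H]]]] le; exists c, N, K; split=> // a s w s0.
have [s' [n [H1 H2 H3 H4]]] := H a s w s0; exists s', n; split=> //.
by apply: leq_trans H4 _; rewrite leq_mul2l ltnS le orbT.
Qed.

Lemma timed_ext (f : A -> B) (g : A -> C) t :
  (forall a, encode (f a) = encode (g a)) -> timed f t -> timed g t.
Proof.
move=> eq [c [N [K [cf H]]]]; exists c, N, K; split=> // a s w s0.
have [s' [n [H1 H2 H3 H4]]] := H a s w s0; exists s', n; split=> //.
by rewrite H2.
Qed.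

Lemma timed_comp (f : A -> B) (g : B -> C) tf tg :
  timed f tf -> timed g tg -> timed (fun x => g (f x)) (fun x => tf x + tg (f x)).
Proof.
move=> [c1 [N1 [K1 [cf1 H1]]]] [c2 [N2 [K2 [cf2 H2]]]].
exists (CSeq c1 c2), (maxn N1 N2), (K1 + K2).+1; split; first by rewrite /= cf1.
move=> a s w s0.
have [s1 [n1 [E1 R1 F1 T1]]] := H1 a s w s0.
have [s2 [n2 [E2 R2 F2 T2]]] := H2 (f a) s1 w R1.
exists s2, (n1 + n2).+1; split=> //; first exact: ExecSeq E1 E2.
- by move=> j jN; rewrite F2 ?F1 //; lia.
- by nia.
Qed.

Lemma timed_pair (f : X -> A) (g : X -> B) tf tg :
  timed f tf -> timed g tg -> timed (fun x => (f x, g x)) (fun x => tf x + tg x).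
Proof.
move=> [c1 [N1 [K1 [cf1 H1]]]] [c2 [N2 [K2 [cf2 H2]]]].
(* The variables from [M] on lie beyond the frames of both programs, so they can keep the argument
   and the first result while these run. *)
set M := (maxn N1 N2).+1.
exists (CSeq (CAssign M (EVar 0)) (CSeq c1 (CSeq (CAssign M.+1 (EVar 0))
  (CSeq (CAssign 0 (EVar M)) (CSeq c2 (CAssign 0 (ENode (EVar M.+1) (EVar 0)))))))).
exists M.+2, (K1 + K2 + 20); split; first by rewrite /= cf1 cf2.
move=> a s w s0.
set s1 := update s M (s 0).
have s1M : s1 M = encode a by rewrite /s1 update_eq.
have [s2 [n2 [E2 R2 F2 T2]]] := H1 a s1 w ltac:(by rewrite /s1 update_neq).
set s3 := update s2 M.+1 (s2 0); set s4 := update s3 0 (s3 M).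
have s40 : s4 0 = encode a.
  by rewrite /s4 update_eq // /s3 update_neq ?F2 //; lia.
have [s5 [n5 [E5 R5 F5 T5]]] := H2 a s4 w s40.
do 2 eexists; split.
- apply: ExecSeq (ExecAssign _ _ _ _) _; apply: ExecSeq E2 _.
  apply: ExecSeq (ExecAssign _ _ _ _) _; apply: ExecSeq (ExecAssign _ _ _ _) _.
  by apply: ExecSeq E5 (ExecAssign _ _ _ _).
- rewrite update_eq //= R5 F5; last lia.
  by rewrite /s4 update_neq // /s3 update_eq // R2.
- move=> j jM; rewrite update_neq ?F5 /s4 ?update_neq /s3 ?update_neq ?F2
    /s1 ?update_neq //; lia.
- rewrite /=; nia.
Qed.

Lemma timed_if (b : X -> bool) (f g : X -> A) tb tf tg :
  timed b tb -> timed f tf -> timed g tg ->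
  timed (fun x => if b x then f x else g x)
        (fun x => tb x + if b x then tf x else tg x).
Proof.
move=> [c0 [N0 [K0 [cf0 H0]]]] [c1 [N1 [K1 [cf1 H1]]]] [c2 [N2 [K2 [cf2 H2]]]].
set M := (maxn N0 (maxn N1 N2)).+1.
exists (CSeq (CAssign M (EVar 0)) (CSeq c0 (CSeq (CAssign M.+1 (EVar 0))
  (CSeq (CAssign 0 (EVar M)) (CIf (EVar M.+1) c1 c2))))).
exists M.+2, (K0 + K1 + K2 + 20); split; first by rewrite /= cf0 cf1 cf2.
move=> a s w s0.
set s1 := update s M (s 0).
have [s2 [n2 [E2 R2 F2 T2]]] := H0 a s1 w ltac:(by rewrite /s1 update_neq).
have s2M : s2 M = encode a by rewrite F2 /s1 ?update_eq //; lia.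
set s3 := update s2 M.+1 (s2 0); set s4 := update s3 0 (s3 M).
have s40 : s4 0 = encode a.
  by rewrite /s4 update_eq // /s3 update_neq //; lia.
have s4M : s4 M.+1 = tree_of_bool (b a).
  by rewrite /s4 update_neq // /s3 update_eq // R2.
have fr j : M.+2 <= j -> s4 j = s j.
  move=> jM; rewrite /s4 ?update_neq /s3 ?update_neq ?F2 /s1 ?update_neq //; lia.
case bE: (b a).
- have [s5 [n5 [E5 R5 F5 T5]]] := H1 a s4 w s40.
  do 2 eexists; split.
  + apply: ExecSeq (ExecAssign _ _ _ _) _; apply: ExecSeq E2 _.
    apply: ExecSeq (ExecAssign _ _ _ _) _; apply: ExecSeq (ExecAssign _ _ _ _) _.
    by apply: (@ExecIf _ _ _ s4 w s5 w n5); rewrite /= s4M bE.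
  + by rewrite R5.
  + by move=> j jM; rewrite F5 ?fr //; lia.
  + by rewrite /=; nia.
- have [s5 [n5 [E5 R5 F5 T5]]] := H2 a s4 w s40.
  do 2 eexists; split.
  + apply: ExecSeq (ExecAssign _ _ _ _) _; apply: ExecSeq E2 _.
    apply: ExecSeq (ExecAssign _ _ _ _) _; apply: ExecSeq (ExecAssign _ _ _ _) _.
    by apply: (@ExecIf _ _ _ s4 w s5 w n5); rewrite /= s4M bE.
  + by rewrite R5.
  + by move=> j jM; rewrite F5 ?fr //; lia.
  + by rewrite /=; nia.
Qed.

(** A nonempty list has the same encoding as the pair of its head and its tail, so the branch
    receives the list as it is. *)
Lemma timed_case (l : X -> seq A) (f : X * (A * seq A) -> B) (g : X -> B) tl tf tg :
  timed l tl -> timed f tf -> timed g tg ->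
  timed (fun x => if l x is a :: l' then f (x, (a, l')) else g x)
        (fun x => tl x + if l x is a :: l' then tf (x, (a, l')) else tg x).
Proof.
move=> [c0 [N0 [K0 [cf0 H0]]]] [c1 [N1 [K1 [cf1 H1]]]] [c2 [N2 [K2 [cf2 H2]]]].
set M := (maxn N0 (maxn N1 N2)).+1.
exists (CSeq (CAssign M (EVar 0)) (CSeq c0 (CSeq (CAssign M.+1 (EVar 0))
  (CIf (EVar M.+1) (CSeq (CAssign 0 (ENode (EVar M) (EVar M.+1))) c1)
                   (CSeq (CAssign 0 (EVar M)) c2))))).
exists M.+2, (K0 + K1 + K2 + 20); split; first by rewrite /= cf0 cf1 cf2.
move=> a s w s0.
set s1 := update s M (s 0).
have [s2 [n2 [E2 R2 F2 T2]]] := H0 a s1 w ltac:(by rewrite /s1 update_neq).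
have s2M : s2 M = encode a by rewrite F2 /s1 ?update_eq //; lia.
set s3 := update s2 M.+1 (s2 0).
have s3M : s3 M = encode a by rewrite /s3 update_neq //; lia.
have s3M1 : s3 M.+1 = encode (l a) by rewrite /s3 update_eq.
have fr j : M.+2 <= j -> s3 j = s j.
  move=> jM; rewrite /s3 ?update_neq ?F2 /s1 ?update_neq //; lia.
case lE: (l a) => [|h l'].
- have [s5 [n5 [E5 R5 F5 T5]]] := H2 a (update s3 0 (s3 M)) w ltac:(by rewrite update_eq).
  do 2 eexists; split.
  + apply: ExecSeq (ExecAssign _ _ _ _) _; apply: ExecSeq E2 _.
    apply: ExecSeq (ExecAssign _ _ _ _) _.
    apply: (@ExecIf _ _ _ s3 w); rewrite /= s3M1 lE /=.
    by apply: ExecSeq (ExecAssign _ _ _ _) _; exact: E5.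
  + by rewrite R5.
  + by move=> j jM; rewrite F5 ?update_neq ?fr //; lia.
  + by rewrite /=; nia.
- set s4 := update s3 0 (Node (s3 M) (s3 M.+1)).
  have s40 : s4 0 = encode (a, (h, l')) by rewrite /s4 update_eq // s3M s3M1 lE.
  have [s5 [n5 [E5 R5 F5 T5]]] := H1 (a, (h, l')) s4 w s40.
  do 2 eexists; split.
  + apply: ExecSeq (ExecAssign _ _ _ _) _; apply: ExecSeq E2 _.
    apply: ExecSeq (ExecAssign _ _ _ _) _.
    apply: (@ExecIf _ _ _ s3 w); rewrite /= s3M1 lE /=.
    by apply: ExecSeq (ExecAssign _ _ _ _) _; exact: E5.
  + by rewrite R5.
  + by move=> j jM; rewrite F5 /s4 ?update_neq ?fr //; lia.
  + by rewrite /=; nia.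
Qed.

(** The cost of a step depends on the accumulator. The invariant [P] relates accumulator and
    remaining list, and is what a uniform bound [b x] for the steps is derived from. *)
Lemma timed_foldl (l : X -> seq A) (i : X -> S) (f : X -> S -> A -> S)
    (P : X -> S -> seq A -> Prop) (b tl ti : X -> nat) tf :
  timed l tl -> timed i ti ->
  timed (fun z : X * (S * A) => f z.1 z.2.1 z.2.2) tf ->
  (forall x, P x (i x) (l x)) ->
  (forall x s a l', P x s (a :: l') ->
     P x (f x s a) l' /\ tf (x, (s, a)) <= b x) ->
  timed (fun x => foldl (f x) (i x) (l x))
        (fun x => tl x + ti x + size (l x) * (b x).+1).
Proof.
move=> [c0 [N0 [K0 [cf0 H0]]]] [c1 [N1 [K1 [cf1 H1]]]] [c2 [N2 [K2 [cf2 H2]]]] Pi Pf.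
set M := (maxn N0 (maxn N1 N2)).+1.
set loop := CWhile (EVar M.+2)
  (CSeq (CAssign 0 (ENode (EVar M) (ENode (EVar M.+1) (EHd (EVar M.+2)))))
  (CSeq c2 (CSeq (CAssign M.+1 (EVar 0)) (CAssign M.+2 (ETl (EVar M.+2)))))).
have loopP x : forall l0 acc s w, 
    P x acc l0 -> s M = encode x -> s M.+1 = encode acc -> s M.+2 = encode l0 ->
    exists s' n, [/\ exec loop s w s' w n, s' M.+1 = encode (foldl (f x) acc l0),
      forall j, M.+3 <= j -> s' j = s j & n <= (K2 + 20) * (size l0 * (b x).+1).+1].
  elim=> [|a l0 IH] acc s w Pacc sM sM1 sM2.
    exists s, 2; split=> //.
    + by apply: ExecWhileDone; rewrite /= sM2.
    + by rewrite muln1; lia.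
  have [Pacc' le] := Pf x acc a l0 Pacc.
  set s1 := update s 0 (Node (s M) (Node (s M.+1) (hd (s M.+2)))).
  have s10 : s1 0 = encode (x, (acc, a)) by rewrite /s1 update_eq // sM sM1 sM2.
  have [s2 [n2 [E2 R2 F2 T2]]] := H2 _ s1 w s10.
  set s3 := update s2 M.+1 (s2 0).
  set s4 := update s3 M.+2 (Defs.tl (s3 M.+2)).
  have fr j : N2 <= j -> j <> 0 -> s2 j = s j.
    by move=> jN j0; rewrite F2 /s1 ?update_neq.
  have [s5 [n5 [E5 R5 F5 T5]]] := IH (f x acc a) s4 w Pacc'
    ltac:(by rewrite /s4 /s3 !update_neq ?fr //; lia)
    ltac:(by rewrite /s4 update_neq /s3 ?update_eq //; lia)
    ltac:(by rewrite /s4 update_eq // /s3 update_neq ?fr ?sM2 //; lia).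
  do 2 eexists; split.
  + apply: ExecWhileStep E5; first by rewrite /= sM2.
    apply: ExecSeq (ExecAssign _ _ _ _) _; apply: ExecSeq E2 _.
    by apply: ExecSeq (ExecAssign _ _ _ _) (ExecAssign _ _ _ _).
  + by rewrite R5.
  + by move=> j jM; rewrite F5 // /s4 /s3 !update_neq ?fr //; lia.
  + rewrite /=; nia.
exists (CSeq (CAssign M (EVar 0)) (CSeq c1 (CSeq (CAssign M.+1 (EVar 0))
  (CSeq (CAssign 0 (EVar M)) (CSeq c0 (CSeq (CAssign M.+2 (EVar 0))
  (CSeq loop (CAssign 0 (EVar M.+1))))))))).
exists M.+3, (K0 + K1 + K2 + 40); split; first by rewrite /= cf0 cf1 cf2.
move=> a s w s0.
set s1 := update s M (s 0).
have [s2 [n2 [E2 R2 F2 T2]]] := H1 a s1 w ltac:(by rewrite /s1 update_neq).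
have s2M : s2 M = encode a by rewrite F2 /s1 ?update_eq //; lia.
set s3 := update s2 M.+1 (s2 0); set s4 := update s3 0 (s3 M).
have s40 : s4 0 = encode a.
  by rewrite /s4 update_eq // /s3 update_neq //; lia.
have [s5 [n5 [E5 R5 F5 T5]]] := H0 a s4 w s40.
set s6 := update s5 M.+2 (s5 0).
have fr j : N0 <= j -> N1 <= j -> j <> 0 -> j <> M -> j <> M.+1 -> s5 j = s j.
  move=> ? ? ? ? ?; rewrite F5 // /s4 update_neq // /s3 update_neq // F2 // /s1.
  by rewrite update_neq.
have [s7 [n7 [E7 R7 F7 T7]]] := loopP a (l a) (i a) s6 w (Pi a)
  ltac:(rewrite /s6 update_neq ?F5 /s4 ?update_neq /s3 ?update_neq //; lia)
  ltac:(rewrite /s6 update_neq ?F5 /s4 ?update_neq /s3 ?update_eq //; lia)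
  ltac:(by rewrite /s6 update_eq).
do 2 eexists; split.
- apply: ExecSeq (ExecAssign _ _ _ _) _; apply: ExecSeq E2 _.
  apply: ExecSeq (ExecAssign _ _ _ _) _; apply: ExecSeq (ExecAssign _ _ _ _) _.
  apply: ExecSeq E5 _; apply: ExecSeq (ExecAssign _ _ _ _) _.
  by apply: ExecSeq E7 (ExecAssign _ _ _ _).
- by rewrite update_eq //= R7.
- by move=> j jM; rewrite update_neq ?F7 /s6 ?update_neq ?fr //; lia.
- by rewrite /=; nia.
Qed.

End Timed.

Lemma sz_gt0 A {eA : encodable A} (a : A) : 0 < sz a.
Proof. by rewrite /sz; case: (encode a). Qed.

Lemma sz_pair A B {eA : encodable A} {eB : encodable B} (a : A) (b : B) :
  sz (a, b) = (sz a + sz b).+1.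
Proof. by []. Qed.

Lemma sz_cons A {eA : encodable A} (a : A) l : sz (a :: l) = (sz a + sz l).+1.
Proof. by []. Qed.

Lemma sz_nil A {eA : encodable A} : sz ([::] : seq A) = 1.
Proof. by []. Qed.

Lemma sz_bool (b : bool) : sz b <= 3.
Proof. by case: b. Qed.

Lemma sz_nat (n : nat) : sz n = n.*2.+1.
Proof.
elim: n => // n IH; rewrite -[sz n.+1]/(1 + sz n).+1 IH; lia.
Qed.

Lemma size_lt_sz A {eA : encodable A} (l : seq A) : size l < sz l.
Proof. by elim: l => //= a l IH; rewrite sz_cons; lia. Qed.

Lemma leq_exp2rw m n e : m <= n -> m ^ e <= n ^ e.
Proof. by case: e => // e le; rewrite leq_exp2r. Qed.

(** The base is at least 2, so that constant factors and summands are absorbed by the exponent. *)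
Definition polyb A {eA : encodable A} (f : A -> nat) : Prop :=
  exists d, forall a, f a <= (sz a).+1 ^ d.

Section Polyb.

Context {A B : Type} {eA : encodable A} {eB : encodable B}.
Implicit Types f g : A -> nat.

Lemma polyb_le f g : polyb g -> (forall a, f a <= g a) -> polyb f.
Proof. by move=> [d H] le; exists d => a; apply: leq_trans (le a) (H a). Qed.

Lemma polyb_const n : polyb (fun _ : A => n).
Proof.
exists n => a; apply: leq_trans (ltnW (ltn_expl n (isT : 1 < 2))) _.
by apply: leq_exp2rw; rewrite ltnS sz_gt0.
Qed.

Lemma polyb_add f g : polyb f -> polyb g -> polyb (fun a => f a + g a).
Proof.
move=> [d H] [e K]; exists (d + e).+1 => a; rewrite expnS expnD.
have := H a; have := K a; set x := _ ^ d; set y := _ ^ e => h1 h2.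
apply: (@leq_trans (2 * (x * y))); last by rewrite leq_mul2r ltnS sz_gt0 orbT.
rewrite mul2n -addnn; apply: leq_add.
  by apply: leq_trans h2 _; rewrite leq_pmulr ?expn_gt0.
by apply: leq_trans h1 _; rewrite leq_pmull ?expn_gt0.
Qed.

Lemma polyb_mul f g : polyb f -> polyb g -> polyb (fun a => f a * g a).
Proof. by move=> [d H] [e K]; exists (d + e) => a; rewrite expnD leq_mul. Qed.

Lemma polyb_exp f n : polyb f -> polyb (fun a => f a ^ n).
Proof.
move=> pf; elim: n => [|n IH]; first exact: (polyb_const 1).
by apply: polyb_le (polyb_mul pf IH) _ => a; rewrite expnS.
Qed.

Lemma polyb_sz : polyb (fun a : A => sz a).
Proof. by exists 1 => a; rewrite expn1. Qed.

Lemma polyb_comp (f : A -> B) (g : B -> nat) :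
  polyb (fun a => sz (f a)) -> polyb g -> polyb (fun a => g (f a)).
Proof.
move=> pf [e K].
apply: polyb_le (polyb_exp e (polyb_add pf (polyb_const 1))) _ => a.
by rewrite addn1.
Qed.

End Polyb.

(** The size of the result is bounded separately: trees are shared, so repeated assignments of
    [Node x x] produce a tree exponential in the number of steps. *)
Definition polytime A B {eA : encodable A} {eB : encodable B} (f : A -> B) : Prop :=
  exists2 t, timed f t & polyb t /\ polyb (fun a => sz (f a)).

Section Polytime.

Context {A B C X : Type} {eA : encodable A} {eB : encodable B}
  {eC : encodable C} {eX : encodable X}.

Lemma polytime_ext (f : A -> B) (g : A -> C) :
  (forall a, encode (f a) = encode (g a)) -> polytime f -> polytime g.
Proof.
move=> eq [t tf [pt pf]]; exists t; first exact: timed_ext eq tf.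
by split=> //; apply: polyb_le pf _ => a; rewrite /sz eq.
Qed.

Lemma polytime_polyb (f : A -> nat) : polytime f -> polyb f.
Proof. by move=> [t _ [_ pf]]; apply: polyb_le pf _ => a; rewrite sz_nat; lia. Qed.

Lemma polytime_polyb_sz (f : A -> B) : polytime f -> polyb (fun a => sz (f a)).
Proof. by move=> [t _ []]. Qed.

Lemma polytime_id : polytime (fun a : A => a).
Proof.
exists (fun=> 0); first exact: (@timed_expr _ _ _ _ _ (EVar 0)).
by split; [exact: polyb_const | exact: polyb_sz].
Qed.

(** The tree is spelled out in the program text. This is how the hash family for one block becomes
    part of the program. *)
Lemma timed_const (b : B) : timed (fun _ : A => b) (fun=> 0).
Proof.
pose fix quote (x : tree) := if x is Node l r then ENode (quote l) (quote r) else ELeaf.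
apply: (@timed_expr _ _ _ _ _ (quote (encode b))) => s _ _.
by elim: (encode b) => //= l -> r ->.
Qed.

Lemma polytime_const (b : B) : polytime (fun _ : A => b).
Proof. by exists (fun=> 0); [exact: timed_const | split; exact: polyb_const]. Qed.

Lemma polytime_comp (f : A -> B) (g : B -> C) :
  polytime f -> polytime g -> polytime (fun x => g (f x)).
Proof.
move=> [t tf [pt pf]] [u ug [pu pg]]; exists (fun x => t x + u (f x)).
  exact: timed_comp.
split; last exact: polyb_comp pf pg.
by apply: polyb_add pt _; apply: polyb_comp pf pu.
Qed.

Lemma polytime_pair (f : X -> A) (g : X -> B) :
  polytime f -> polytime g -> polytime (fun x => (f x, g x)).
Proof.
move=> [t tf [pt pf]] [u ug [pu pg]]; exists (fun x => t x + u x).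
  exact: timed_pair.
split; first exact: polyb_add.
apply: polyb_le (polyb_add (polyb_add pf pg) (polyb_const 1)) _ => a.
by rewrite sz_pair addn1.
Qed.

End Polytime.

Section PolytimeClosure.

Context {A B X S : Type} {eA : encodable A} {eB : encodable B}
  {eX : encodable X} {eS : encodable S}.

Lemma polytime_fst (f : X -> A * B) : polytime f -> polytime (fun x => (f x).1).
Proof.
move=> pf; apply: (polytime_comp (g := fst) pf); exists (fun=> 0).
  by apply: (@timed_expr _ _ _ _ _ (EHd (EVar 0))) => s a /= ->.
split; first exact: polyb_const.
by apply: polyb_le polyb_sz _ => -[a b]; rewrite sz_pair /=; lia.
Qed.

Lemma polytime_snd (f : X -> A * B) : polytime f -> polytime (fun x => (f x).2).
Proof.
move=> pf; apply: (polytime_comp (g := snd) pf); exists (fun=> 0).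
  by apply: (@timed_expr _ _ _ _ _ (ETl (EVar 0))) => s a /= ->.
split; first exact: polyb_const.
by apply: polyb_le polyb_sz _ => -[a b]; rewrite sz_pair /=; lia.
Qed.

Lemma polytime_cons (f : X -> A) (g : X -> seq A) :
  polytime f -> polytime g -> polytime (fun x => f x :: g x).
Proof. by move=> pf pg; apply: polytime_ext (polytime_pair pf pg). Qed.

Lemma polytime_succ (f : X -> nat) : polytime f -> polytime (fun x => (f x).+1).
Proof.
by move=> pf; apply: polytime_ext (polytime_pair (polytime_const tt) pf).
Qed.

Lemma polytime_nseq (f : X -> nat) : polytime f -> polytime (fun x => nseq (f x) tt).
Proof. by apply: polytime_ext => x; rewrite encode_nseq. Qed.

Lemma polytime_if (b : X -> bool) (f g : X -> A) :
  polytime b -> polytime f -> polytime g ->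
  polytime (fun x => if b x then f x else g x).
Proof.
move=> [t0 tb [pt0 _]] [t1 tf [pt1 pf]] [t2 tg [pt2 pg]].
exists (fun x => t0 x + if b x then t1 x else t2 x); first exact: timed_if.
split.
  apply: polyb_le (polyb_add pt0 (polyb_add pt1 pt2)) _ => x.
  by case: (b x); lia.
apply: polyb_le (polyb_add pf pg) _ => x.
by case: (b x); lia.
Qed.

Lemma polytime_case (l : X -> seq A) (f : X -> A -> seq A -> B) (g : X -> B) :
  polytime l -> polytime (fun z : X * (A * seq A) => f z.1 z.2.1 z.2.2) ->
  polytime g ->
  polytime (fun x => if l x is a :: l' then f x a l' else g x).
Proof.
move=> [t0 tl [pt0 pl]] [t1 tf [pt1 pf]] [t2 tg [pt2 pg]].
have pz (h : X * (A * seq A) -> nat) : polyb h -> exists2 h', polyb h' &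
    forall x a l', l x = a :: l' -> h (x, (a, l')) <= h' x.
  move=> [d H].
  exists (fun x => (sz x + sz (l x) + 2) ^ d).
    apply: polyb_exp; apply: polyb_add (polyb_const _).
    exact: polyb_add polyb_sz pl.
  move=> x a l' E; apply: leq_trans (H _) _.
  apply: leq_exp2rw.
  by rewrite E sz_pair [sz (a, _)]sz_pair sz_cons; lia.
have [h1 ph1 H1] := pz _ pt1; have [h2 ph2 H2] := pz _ pf.
exists (fun x => t0 x + if l x is a :: l' then t1 (x, (a, l')) else t2 x).
  exact: (timed_case tl tf tg).
split.
  apply: polyb_le (polyb_add pt0 (polyb_add ph1 pt2)) _ => x.
  by case E: (l x) => [|a l']; [lia | have := H1 _ _ _ E; lia].
apply: polyb_le (polyb_add ph2 pg) _ => x.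
by case E: (l x) => [|a l']; [lia | have := H2 _ _ _ E; rewrite /=; lia].
Qed.

(** Polynomially many polynomial steps can still blow up an accumulator, so the invariant [P] has to
    keep its size below a polynomial [b] throughout. *)
Lemma polytime_foldl (P : X -> S -> seq A -> Prop) (b : X -> nat)
    (l : X -> seq A) (i : X -> S) (f : X -> S -> A -> S) :
  polytime l -> polytime i ->
  polytime (fun z : X * (S * A) => f z.1 z.2.1 z.2.2) ->
  polyb b ->
  (forall x, P x (i x) (l x)) ->
  (forall x s a l', P x s (a :: l') -> sz a <= sz (l x) -> P x (f x s a) l') ->
  (forall x s l', P x s l' -> sz s <= b x) ->
  polytime (fun x => foldl (f x) (i x) (l x)).
Proof.
move=> [t0 tl [pt0 pl]] [t1 ti [pt1 pi]] [t2 tf [[d pt2] pf]] pb Pi Pf Pb.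
pose (Q := fun (x : X) (s : S) (l' : seq A) => P x s l' /\ sz l' <= sz (l x)).
have Qi x : Q x (i x) (l x) by split.
have Qf x s a l' : Q x s (a :: l') -> Q x (f x s a) l'.
  move=> [Ps le]; rewrite sz_cons in le; split; last lia.
  by apply: Pf => //; lia.
have Q_foldl x l' : forall s, Q x s l' -> Q x (foldl (f x) s l') [::].
  by elim: l' => //= a l' IH s /Qf /IH.
pose (c := fun x : X => (sz x + b x + sz (l x) + 3) ^ d).
have poly_c : polyb c.
  apply: polyb_exp; apply: polyb_add (polyb_const _).
  by apply: polyb_add pl; apply: polyb_add polyb_sz pb.
exists (fun x => t0 x + t1 x + size (l x) * (c x).+1).
  apply: (timed_foldl (P := Q) tl ti tf) => // x s a l' H; split; first exact: Qf.
  case: H => Ps le; apply: leq_trans (pt2 _) _; apply: leq_exp2rw.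
  have := Pb _ _ _ Ps; rewrite sz_cons in le.
  by rewrite !sz_pair; lia.
split.
  apply: polyb_add; first exact: polyb_add.
  apply: polyb_mul.
    by apply: polyb_le pl _ => x; exact/ltnW/size_lt_sz.
  by apply: polyb_le (polyb_add poly_c (polyb_const 1)) _ => x; rewrite addn1.
apply: polyb_le pb _ => x.
by have [/Pb] := Q_foldl _ _ _ (Qi x).
Qed.

End PolytimeClosure.

(** * Polynomial-time functions *)

Lemma polytime_proj1 A B (eA : encodable A) (eB : encodable B) : polytime (@fst A B).
Proof. exact: (polytime_fst polytime_id). Qed.

Lemma polytime_proj2 A B (eA : encodable A) (eB : encodable B) : polytime (@snd A B).
Proof. exact: (polytime_snd polytime_id). Qed.

Ltac pt_user := fail.
Ltac solve_polytime :=
  cbv beta;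
  lazymatch goal with
  | |- polytime (fun x => x) => exact polytime_id
  | |- polytime fst => exact: polytime_proj1
  | |- polytime snd => exact: polytime_proj2
  | |- polytime (fun _ => ?b) => exact: polytime_const
  | |- polytime (fun x => (@?f x, @?g x)) => apply (polytime_pair (f := f) (g := g)); solve_polytime
  | |- polytime (fun x => (@?f x).1) => apply (polytime_fst (f := f)); solve_polytime
  | |- polytime (fun x => (@?f x).2) => apply (polytime_snd (f := f)); solve_polytime
  | |- polytime (fun x => (@?f x).+1) => apply (polytime_succ (f := f)); solve_polytime
  | |- polytime (fun x => @?f x :: @?g x) => apply (polytime_cons (f := f) (g := g)); solve_polytime
  | |- polytime (fun x => nseq (@?f x) tt) => apply (polytime_nseq (f := f)); solve_polytime
  | |- _ => first
      [ assumption
      | match goal with H : polytime ?g |- polytime (fun z => ?g (@?h z)) =>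
          apply (polytime_comp (f := h) (g := g)); [solve_polytime | assumption]
        end
      | pt_user; solve_polytime
      | simple apply @polytime_if; solve_polytime ]
  end.

Ltac solve_polyb :=
  cbv beta;
  lazymatch goal with
  | |- polyb (fun _ => ?n) => exact: polyb_const
  | |- polyb (fun x => (@?f x).+1) =>
      apply (polyb_le (f := fun x => (f x).+1) (g := fun x => f x + 1));
      [solve_polyb | by move=> ?; rewrite addn1]
  | |- polyb (fun x => @?f x + @?g x) => apply (polyb_add (f := f) (g := g)); solve_polyb
  | |- polyb (fun x => @?f x * @?g x) => apply (polyb_mul (f := f) (g := g)); solve_polyb
  | |- polyb (fun x => expn (@?f x) ?n) => apply (polyb_exp (f := f)); solve_polyb
  | |- polyb (fun x => sz x) => exact: polyb_sz
  | |- polyb (fun x => sz (@?f x)) => apply (polytime_polyb_sz (f := f)); solve_polytime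
  | |- _ => first [assumption | apply: polytime_polyb; solve_polytime]
  end.

Lemma polytime_app2 A B C X (eA : encodable A) (eB : encodable B)
    (eC : encodable C) (eX : encodable X) (f : A -> B -> C) (g : X -> A) (h : X -> B) :
  polytime (fun z : A * B => f z.1 z.2) -> polytime g -> polytime h ->
  polytime (fun x => f (g x) (h x)).
Proof. by move=> pf pg ph; apply: (polytime_comp (polytime_pair pg ph) pf). Qed.

Section Library.

Context {A B X S : Type} {eA : encodable A} {eB : encodable B}
  {eX : encodable X} {eS : encodable S}.

Lemma polytime_iter (P : X -> S -> nat -> Prop) (b : X -> nat)
    (n : X -> nat) (i : X -> S) (f : X -> S -> S) :
  polytime n -> polytime i -> polytime (fun z : X * S => f z.1 z.2) -> polyb b ->
  (forall x, P x (i x) (n x)) ->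
  (forall x s k, P x s k.+1 -> P x (f x s) k) ->
  (forall x s k, P x s k -> sz s <= b x) ->
  polytime (fun x => iter (n x) (f x) (i x)).
Proof.
move=> pn pi pf polyb_b Pi Pf Pb.
apply: (polytime_ext (f := fun x => foldl (fun s _ => f x s) (i x) (nseq (n x) tt))).
  move=> x; congr encode; elim: (n x) (i x) => // m IH s.
  by rewrite iterSr -IH.
apply: (polytime_foldl (P := fun x s l' => P x s (size l')) (b := b)) => //.
- solve_polytime.
- rewrite /=; apply: (polytime_app2 pf); solve_polytime.
- by move=> x; rewrite size_nseq.
- by move=> x s a l' /= /Pf.
- by move=> x s l' /Pb.
Qed.

Lemma polytime_predn (f : X -> nat) : polytime f -> polytime (fun x => (f x).-1).
Proof.
move=> pf; apply: (polytime_comp (g := predn) pf); exists (fun=> 0).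
  apply: (@timed_expr _ _ _ _ _ (ETl (EVar 0))) => s a /= ->.
  by case: a.
by split; [solve_polyb | apply: polyb_le (polyb_sz (A := nat)) _ => n; rewrite !sz_nat; lia].
Qed.

Lemma polytime_behead (f : X -> seq A) :
  polytime f -> polytime (fun x => behead (f x)).
Proof.
move=> pf; apply: (polytime_comp (g := behead) pf); exists (fun=> 0).
  apply: (@timed_expr _ _ _ _ _ (ETl (EVar 0))) => s a /= ->.
  by case: a.
split; first solve_polyb.
by apply: polyb_le (polyb_sz (A := seq A)) _ => -[|a l] //=; rewrite sz_cons; lia.
Qed.

Lemma polytime_negb (f : X -> bool) : polytime f -> polytime (fun x => ~~ f x).
Proof. by move=> pf; apply: (polytime_if pf (f := fun=> false) (g := fun=> true)); solve_polytime. Qed.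

Lemma polytime_andb (f g : X -> bool) :
  polytime f -> polytime g -> polytime (fun x => f x && g x).
Proof. by move=> pf pg; apply: (polytime_if pf (f := g) (g := fun=> false)); solve_polytime. Qed.

Lemma polytime_orb (f g : X -> bool) :
  polytime f -> polytime g -> polytime (fun x => f x || g x).
Proof. by move=> pf pg; apply: (polytime_if pf (f := fun=> true) (g := g)); solve_polytime. Qed.

Lemma polytime_implb (f g : X -> bool) :
  polytime f -> polytime g -> polytime (fun x => f x ==> g x).
Proof. by move=> pf pg; apply: (polytime_if pf (f := g) (g := fun=> true)); solve_polytime. Qed.

Lemma polytime_eq0 (f : X -> nat) : polytime f -> polytime (fun x => f x == 0).
Proof.
move=> pf; apply: (polytime_ext (f := fun x => if nseq (f x) tt is _ :: _ then false else true)).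
  by move=> x; case: (f x).
by apply: (polytime_case (f := fun _ _ _ => false)); solve_polytime.
Qed.

End Library.
Ltac pt_basic :=
  lazymatch goal with
  | |- polytime (fun x => (@?f x).-1) => apply (polytime_predn (f := f))
  | |- polytime (fun x => behead (@?f x)) => apply (polytime_behead (f := f))
  | |- polytime (fun x => ~~ @?f x) => apply (polytime_negb (f := f))
  | |- polytime (fun x => @?f x && @?g x) => apply (polytime_andb (f := f) (g := g))
  | |- polytime (fun x => @?f x || @?g x) => apply (polytime_orb (f := f) (g := g))
  | |- polytime (fun x => @?f x ==> @?g x) => apply (polytime_implb (f := f) (g := g))
  | |- polytime (fun x => @?f x == 0) => apply (polytime_eq0 (f := f))
  end.
Ltac pt_user ::= pt_basic.

Section Arithmetic.

Context {X : Type} {eX : encodable X}.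
Implicit Types f g : X -> nat.

Lemma polytime_addn f g : polytime f -> polytime g -> polytime (fun x => f x + g x).
Proof.
move=> pf pg; apply: (polytime_ext (f := fun x => iter (g x) S (f x))).
  by move=> x; rewrite iter_succn.
apply: (polytime_iter (P := fun x s k => s + k = f x + g x)
  (b := fun x => 2 * (f x + g x) + 1)) => //; [solve_polytime | solve_polyb | |].
- by move=> x s k <-; lia.
- by move=> x s k; rewrite sz_nat; lia.
Qed.

Lemma polytime_subn f g : polytime f -> polytime g -> polytime (fun x => f x - g x).
Proof.
move=> pf pg; apply: (polytime_ext (f := fun x => iter (g x) predn (f x))).
  by move=> x; rewrite iter_predn.
apply: (polytime_iter (P := fun x s k => s <= f x) (b := fun x => 2 * f x + 1)) => //.
- solve_polytime.
- solve_polyb.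
- by move=> x s k; lia.
- by move=> x s k; rewrite sz_nat; lia.
Qed.

Lemma polytime_leq f g : polytime f -> polytime g -> polytime (fun x => f x <= g x).
Proof. by move=> pf pg; apply/polytime_eq0/polytime_subn. Qed.

End Arithmetic.
Ltac pt_sum :=
  lazymatch goal with
  | |- polytime (fun x => @?f x + @?g x) => apply (polytime_addn (f := f) (g := g))
  | |- polytime (fun x => @?f x - @?g x) => apply (polytime_subn (f := f) (g := g))
  | |- polytime (fun x => @?f x <= @?g x) => apply (polytime_leq (f := f) (g := g))
  end.
Ltac pt_user ::= first [pt_sum | pt_basic].

Section Arithmetic2.

Context {X : Type} {eX : encodable X}.
Implicit Types f g : X -> nat.

Lemma polytime_eqn f g : polytime f -> polytime g -> polytime (fun x => f x == g x).
Proof.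
move=> pf pg; apply: (polytime_ext (f := fun x => (f x <= g x) && (g x <= f x))); last solve_polytime.
by move=> x; rewrite eqn_leq.
Qed.

Lemma polytime_minn f g : polytime f -> polytime g -> polytime (fun x => minn (f x) (g x)).
Proof. by move=> pf pg; rewrite /minn; solve_polytime. Qed.

Lemma polytime_muln f g : polytime f -> polytime g -> polytime (fun x => f x * g x).
Proof.
move=> pf pg.
apply: (polytime_ext (f := fun x => iter (f x) (fun s => s + g x) 0)).
  move=> x; congr encode; elim: (f x) => //= n ->; lia.
apply: (polytime_iter (P := fun x s k => s + k * g x = f x * g x)
  (b := fun x => 2 * (f x * g x) + 1) (f := fun x s => s + g x)) => //.
- solve_polytime.
- by apply: polytime_addn; solve_polytime.
- solve_polyb.
- by move=> x s k <-; lia.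
- by move=> x s k; rewrite sz_nat; lia.
Qed.

End Arithmetic2.
Ltac pt_product :=
  lazymatch goal with
  | |- polytime (fun x => @?f x == 0) => apply (polytime_eq0 (f := f))
  | |- polytime (fun x => @?f x == @?g x) => apply (polytime_eqn (f := f) (g := g))
  | |- polytime (fun x => minn (@?f x) (@?g x)) => apply (polytime_minn (f := f) (g := g))
  | |- polytime (fun x => @?f x * @?g x) => apply (polytime_muln (f := f) (g := g))
  end.
Ltac pt_user ::= first [pt_product | pt_sum | pt_basic].

(** Adds 1 to a number given by its quotient and remainder modulo [d.+1]; division in unary is
    counting with carry. *)
Definition divmod_step (d : nat) (s : nat * nat) : nat * nat :=
  if s.2 == d then (s.1.+1, 0) else (s.1, s.2.+1).

Lemma divmod_stepP d m : iter m (divmod_step d) (0, 0) = (m %/ d.+1, m %% d.+1).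
Proof.
elim: m => [|m IH]; first by rewrite div0n mod0n.
rewrite iterS IH /divmod_step /= modnS divnS //.
have lt : m %% d.+1 < d.+1 by rewrite ltn_mod.
have E := divn_eq m d.+1; set q := m %/ _ in E *; set r := m %% _ in E lt *.
have -> : (d.+1 %| m.+1) = (r == d).
  rewrite E -addnS dvdn_addr ?dvdn_mull //.
  apply/idP/eqP => [/dvdn_leq|->] //; lia.
by case: eqP.
Qed.

Section Division.

Context {X : Type} {eX : encodable X}.
Implicit Types f g : X -> nat.

Lemma polytime_divmod f g : polytime f -> polytime g ->
  polytime (fun x => (f x %/ (g x).+1, f x %% (g x).+1)).
Proof.
move=> pf pg.
apply: (polytime_ext (f := fun x => iter (f x) (divmod_step (g x)) (0, 0))).
  by move=> x; rewrite divmod_stepP.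
apply: (polytime_iter (P := fun x s k => s.1 + k <= f x /\ s.2 + k <= f x)
  (b := fun x => 2 * f x + 2 * f x + 3)) => //.
- solve_polytime.
- by rewrite /divmod_step; solve_polytime.
- solve_polyb.
- by move=> x [a c] k [/= h1 h2]; rewrite /divmod_step; case: eqP => /= _; lia.
- by move=> x [a c] k [/= h1 h2]; rewrite sz_pair !sz_nat; lia.
Qed.

Lemma polytime_divn f g :
  polytime f -> polytime g -> polytime (fun x => f x %/ (g x).+1).
Proof. by move=> pf pg; exact: (polytime_fst (polytime_divmod pf pg)). Qed.

Lemma polytime_modn f g :
  polytime f -> polytime g -> polytime (fun x => f x %% (g x).+1).
Proof. by move=> pf pg; exact: (polytime_snd (polytime_divmod pf pg)). Qed.

End Division.
Ltac pt_division :=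
  lazymatch goal with
  | |- polytime (fun x => @?f x %/ (@?g x).+1) => apply (polytime_divn (f := f) (g := g))
  | |- polytime (fun x => @?f x %% (@?g x).+1) => apply (polytime_modn (f := f) (g := g))
  end.
Ltac pt_user ::= first [pt_division | pt_product | pt_sum | pt_basic].

Lemma polytime_rev A X (eA : encodable A) (eX : encodable X) (l : X -> seq A) :
  polytime l -> polytime (fun x => rev (l x)).
Proof.
move=> pl; apply: (polytime_ext (f := fun x => foldl (fun s a => a :: s) [::] (l x))).
  by move=> x; congr encode; rewrite /rev; elim: (l x) [::] => //= a l' IH s.
apply: (polytime_foldl (P := fun x s l' => sz s + sz l' <= (sz (l x)).+1)
  (b := fun x => (sz (l x)).+1)); [solve_polytime | solve_polytime | solve_polytime | solve_polyb | | | ].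
- by move=> x; rewrite sz_nil; lia.
- by move=> x s a l'; rewrite !sz_cons; lia.
- by move=> x s l'; have := sz_gt0 l'; lia.
Qed.

Lemma polytime_map A B X (eA : encodable A) (eB : encodable B) (eX : encodable X)
    (l : X -> seq A) (f : X -> A -> B) :
  polytime l -> polytime (fun z : X * A => f z.1 z.2) ->
  polytime (fun x => [seq f x a | a <- l x]).
Proof.
move=> pl pf.
apply: (polytime_ext (f := fun x => rev (foldl (fun s a => f x a :: s) [::] (l x)))).
  move=> x; congr encode; rewrite -[RHS]revK; congr rev.
  rewrite -[X in foldl _ X _]/(rev [::]) -[in RHS](cat0s (map _ _)).
  elim: (l x) [::] => /= [|a l' IH] s; first by rewrite cats0.
  by rewrite -rev_rcons IH cat_rcons.
have [d H] := polytime_polyb_sz pf.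
pose (c := fun x => ((sz x + sz (l x) + 2) ^ d).+1).
have leB x a : sz a <= sz (l x) -> sz (f x a) < c x.
  move=> le; rewrite ltnS; apply: leq_trans (H (x, a)) _.
  by apply: leq_exp2rw; rewrite sz_pair; lia.
have pc : polyb c by rewrite /c; solve_polyb.
clearbody c.
apply: polytime_rev.
apply: (polytime_foldl
  (P := fun x s l' => sz s + size l' * c x <= (size (l x) * c x).+1)
  (b := fun x => (sz (l x) * c x).+1)); [solve_polytime | solve_polytime | | solve_polyb | | | ].
- by apply: polytime_cons; [apply: (polytime_app2 pf); solve_polytime | solve_polytime].
- by move=> x; rewrite sz_nil; lia.
- by move=> x s a l'; rewrite /= mulSn sz_cons => h1 /leB; lia.
- move=> x s l' h; apply: leq_trans (leq_trans (leq_addr _ _) h) _.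
  by rewrite ltnS leq_mul // ltnW // size_lt_sz.
Qed.

Lemma polytime_nth A X (eA : encodable A) (eX : encodable X) (a0 : A)
    (l : X -> seq A) (n : X -> nat) :
  polytime l -> polytime n -> polytime (fun x => nth a0 (l x) (n x)).
Proof.
move=> pl pn.
pose hd x := if iter (n x) behead (l x) is a :: _ then a else a0.
apply: (polytime_ext (f := hd)).
  move=> x; congr encode; rewrite /hd.
  elim: (n x) (l x) => [|i IH] [|a s] //=; last by rewrite -iterS iterSr IH.
  by rewrite -iterS iterSr IH nth_nil.
rewrite /hd.
apply: (polytime_case (f := fun _ a _ => a)); [ | solve_polytime | solve_polytime].
apply: (polytime_iter (P := fun x s k => sz s <= sz (l x)) (b := fun x => sz (l x))) => //.
- solve_polytime.
- solve_polyb.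
- by move=> x [|a s] k //; rewrite sz_cons /=; lia.
Qed.

Section BoolLists.

Context {A X : Type} {eA : encodable A} {eX : encodable X}.
Variables (l : X -> seq A) (f : X -> A -> bool).
Hypotheses (pl : polytime l) (pf : polytime (fun z : X * A => f z.1 z.2)).

Lemma polytime_has : polytime (fun x => has (f x) (l x)).
Proof.
apply: (polytime_ext (f := fun x => foldl (fun b a => b || f x a) false (l x))).
  move=> x; congr encode; rewrite -[RHS]orFb.
  by elim: (l x) false => /= [|a s IH] b; rewrite ?orbF // IH orbA.
apply: (polytime_foldl (P := fun _ _ _ => True) (b := fun=> 3));
  [solve_polytime | solve_polytime | | solve_polyb | by [] | by [] | ].
- by apply: polytime_orb; [solve_polytime | apply: (polytime_app2 pf); solve_polytime].
- by move=> x s _ _; exact: sz_bool.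
Qed.

Lemma polytime_all : polytime (fun x => all (f x) (l x)).
Proof.
apply: (polytime_ext (f := fun x => foldl (fun b a => b && f x a) true (l x))).
  move=> x; congr encode; rewrite -[RHS]andTb.
  by elim: (l x) true => /= [|a s IH] b; rewrite ?andbT // IH andbA.
apply: (polytime_foldl (P := fun _ _ _ => True) (b := fun=> 3));
  [solve_polytime | solve_polytime | | solve_polyb | by [] | by [] | ].
- by apply: polytime_andb; [solve_polytime | apply: (polytime_app2 pf); solve_polytime].
- by move=> x s _ _; exact: sz_bool.
Qed.

Lemma polytime_count : polytime (fun x => count (f x) (l x)).
Proof.
apply: (polytime_ext
  (f := fun x => foldl (fun n a => if f x a then n.+1 else n) 0 (l x))).
  move=> x; congr encode; rewrite -[RHS]add0n.
  elim: (l x) 0 => /= [|a s IH] n; first by rewrite addn0.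
  by rewrite IH; case: (f x a); lia.
apply: (polytime_foldl (P := fun x s l' => s + size l' <= size (l x))
  (b := fun x => 2 * sz (l x) + 1)); [solve_polytime | solve_polytime | | solve_polyb | by [] | | ].
- by apply: polytime_if; [apply: (polytime_app2 pf); solve_polytime | solve_polytime | solve_polytime].
- by move=> x s a l' /=; case: (f x a); lia.
- move=> x s l'; rewrite sz_nat; have: size (l x) < sz (l x) by exact: size_lt_sz.
  by lia.
Qed.

End BoolLists.

Lemma polytime_size A X (eA : encodable A) (eX : encodable X) (l : X -> seq A) :
  polytime l -> polytime (fun x => size (l x)).
Proof.
move=> pl; apply: (polytime_ext (f := fun x => count (fun=> true) (l x))).
  by move=> x; rewrite count_predT.
by apply: polytime_count; solve_polytime.
Qed.

Lemma foldl_modn A (f : A -> nat) p (l : seq A) :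
  foldl (fun n a => (n + f a) %% p.+1) 0 l = (\sum_(a <- l) f a) %% p.+1.
Proof.
rewrite -[X in _ = X %% _]add0n.
suff gen s n : n < p.+1 ->
    foldl (fun n a => (n + f a) %% p.+1) n s = (n + \sum_(a <- s) f a) %% p.+1.
  exact: gen.
elim: s n => /= [|a s IH] n n_lt; first by rewrite big_nil addn0 modn_small.
by rewrite IH ?ltn_mod // big_cons modnDml addnA.
Qed.

Lemma polytime_sum_modn A X (eA : encodable A) (eX : encodable X)
    (l : X -> seq A) (f : X -> A -> nat) (p : X -> nat) :
  polytime l -> polytime (fun z : X * A => f z.1 z.2) -> polytime p ->
  polytime (fun x => (\sum_(a <- l x) f x a) %% (p x).+1).
Proof.
move=> pl pf pp.
apply: (polytime_ext
  (f := fun x => foldl (fun n a => (n + f x a) %% (p x).+1) 0 (l x))).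
  by move=> x; rewrite foldl_modn.
apply: (polytime_foldl (P := fun x s _ => s <= p x) (b := fun x => 2 * p x + 1)) => //.
- solve_polytime.
- apply: polytime_modn; last solve_polytime.
  by apply: polytime_addn; [solve_polytime | apply: (polytime_app2 pf); solve_polytime].
- solve_polyb.
- by move=> x s a l' _ _; rewrite -ltnS ltn_mod.
- by move=> x s l'; rewrite sz_nat; lia.
Qed.

(** The power itself would be exponentially large in unary, hence the reduction after each
    multiplication. *)
Lemma polytime_expn_modn X (eX : encodable X) (w z e p : X -> nat) :
  polytime w -> polytime z -> polytime e -> polytime p ->
  polytime (fun x => (w x * z x ^ e x) %% (p x).+1).
Proof.
move=> pw pz pe pp.
apply: (polytime_ext (f := fun x =>
    iter (e x) (fun n => (n * z x) %% (p x).+1) (w x %% (p x).+1))).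
  move=> x; congr encode; elim: (e x) => [|n IH]; first by rewrite muln1.
  by rewrite iterS IH modnMml expnSr mulnA.
apply: (polytime_iter (P := fun x s _ => s <= p x) (b := fun x => 2 * p x + 1)
   (f := fun x n => (n * z x) %% (p x).+1)) => //.
- solve_polytime.
- solve_polytime.
- solve_polyb.
- by move=> x; rewrite -ltnS ltn_mod.
- by move=> x s k _; rewrite -ltnS ltn_mod.
- by move=> x s l'; rewrite sz_nat; lia.
Qed.

Lemma polytime_iota X (eX : encodable X) (n : X -> nat) :
  polytime n -> polytime (fun x => iota 0 (n x)).
Proof.
move=> pn.
apply: (polytime_ext (f := fun x => rev (iter (n x) (fun l => size l :: l) [::]))).
  move=> x; congr encode; elim: (n x) => // m IH.
  rewrite iterS rev_cons IH -cats1 -addn1 iotaD; congr (_ ++ [:: _]).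
  by rewrite -size_rev IH size_iota.
apply: polytime_rev.
apply: (polytime_iter (P := fun x s k => size s + k = n x /\
    sz s + k * (2 * n x + 2) <= n x * (2 * n x + 2) + 1)
  (b := fun x => n x * (2 * n x + 2) + 1)); [solve_polytime | solve_polytime | | solve_polyb | | | ].
- by apply: polytime_cons; [apply: polytime_size; solve_polytime | solve_polytime].
- by move=> x; rewrite sz_nil /=; lia.
- by move=> x s k [h1 h2]; rewrite sz_cons sz_nat /=; lia.
- by move=> x s k [_]; lia.
Qed.

Ltac pt_lists :=
  lazymatch goal with
  | |- polytime (fun x => (\sum_(a <- @?l x) @?f x a) %% (@?g x).+1) =>
      apply (polytime_sum_modn (l := l) (f := f) (p := g))
  | |- polytime (fun x => (@?w x * @?z x ^ @?e x) %% (@?g x).+1) =>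
      apply (polytime_expn_modn (w := w) (z := z) (e := e) (p := g))
  | |- polytime (fun x => rev (@?l x)) => apply (polytime_rev (l := l))
  | |- polytime (fun x => iota 0 (@?n x)) => apply (polytime_iota (n := n))
  | |- polytime (fun x => size (@?l x)) => apply (polytime_size (l := l))
  | |- polytime (fun x => nth ?a0 (@?l x) (@?n x)) =>
      apply (polytime_nth a0 (l := l) (n := n))
  | |- polytime (fun x => map (@?f x) (@?l x)) => apply (polytime_map (l := l) (f := f))
  | |- polytime (fun x => has (@?f x) (@?l x)) => apply (polytime_has (l := l) (f := f))
  | |- polytime (fun x => all (@?f x) (@?l x)) => apply (polytime_all (l := l) (f := f))
  | |- polytime (fun x => count (@?f x) (@?l x)) => apply (polytime_count (l := l) (f := f))
  end.
Ltac pt_user ::= first [pt_lists | pt_division | pt_product | pt_sum | pt_basic].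

Definition bits_value (s : seq bool) : nat := foldr (fun (b : bool) v => b + v.*2) 0 s.

(** Horner's rule from the most significant bit. Capping at [n] commutes with [v -> b + 2 v]
    followed by another capping, so it may be done after every bit, and the unary values stay
    small. *)
Lemma polytime_minn_bits X (eX : encodable X) (s : X -> seq bool) (n : X -> nat) :
  polytime s -> polytime n -> polytime (fun x => minn (n x) (bits_value (s x))).
Proof.
move=> ps pn.
apply: (polytime_ext (f := fun x =>
  foldl (fun v b => minn (n x) ((if b : bool then 1 else 0) + (v + v))) 0 (rev (s x)))).
  move=> x; congr encode.
  rewrite foldl_rev; elim: (s x) => [|b l /= ->] /=; first by rewrite minn0.
  by rewrite /bits_value /= -/(bits_value l); case: b; lia.
apply: (polytime_foldl (P := fun x v _ => v <= n x) (b := fun x => 2 * n x + 1)) => //.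
- solve_polytime.
- solve_polytime.
- solve_polytime.
- solve_polyb.
- by move=> x v b l' _ _; exact: geq_minl.
- by move=> x v l'; rewrite sz_nat; lia.
Qed.

(** The list of all pairs in reverse, built by consing onto one accumulator so that the cost is
    linear in the number of pairs. *)
Definition prodmap A B C (f : A -> B -> C) (l1 : seq A) (l2 : seq B) : seq C :=
  foldl (fun s a => foldl (fun s b => f a b :: s) s l2) [::] l1.

Lemma foldl_consE A B (f : A -> B) l s :
  foldl (fun s a => f a :: s) s l = rev (map f l) ++ s.
Proof. by elim: l s => //= a l IH s; rewrite IH rev_cons cat_rcons. Qed.

Lemma prodmapE A B C (f : A -> B -> C) l1 l2 :
  prodmap f l1 l2 = rev [seq f a b | a <- l1, b <- l2].
Proof.
rewrite /prodmap -[RHS]cats0; elim: l1 [::] => //= a l1 IH s.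
by rewrite IH foldl_consE catA -rev_cat.
Qed.

Lemma size_prodmap A B C (f : A -> B -> C) l1 l2 :
  size (prodmap f l1 l2) = size l1 * size l2.
Proof. by rewrite prodmapE size_rev size_allpairs. Qed.

Lemma mem_prodmap A B (C : eqType) (f : A -> B -> C) l1 l2 z :
  (z \in prodmap f l1 l2) = (z \in [seq f a b | a <- l1, b <- l2]).
Proof. by rewrite prodmapE mem_rev. Qed.

Lemma polytime_timed A B (eA : encodable A) (eB : encodable B) (f : A -> B) :
  polytime f -> exists d, timed f (fun a => (sz a).+1 ^ d).
Proof. by move=> [t tf [[d le] _]]; exists d; apply: timed_le tf le. Qed.

Lemma In_bigmax A (F : A -> nat) l a : List.In a l -> F a <= \max_(c <- l) F c.
Proof.
elim: l => //= c l IH [->|/IH le]; rewrite big_cons leq_max ?leqnn //.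
by rewrite le orbT.
Qed.

Lemma bigmax_In_le A (F : A -> nat) l n :
  (forall a, List.In a l -> F a <= n) -> \max_(c <- l) F c <= n.
Proof.
elim: l => [|c l IH] le; first by rewrite big_nil.
rewrite big_cons geq_max le ?IH //=; first by move=> a h; apply: le; right.
by left.
Qed.

(** Meant for exponentially long lists: the bound is linear in the number of pairs, and [b] has to
    dominate the cost on pairs that do occur. *)
Lemma timed_prodmap A B C X (eA : encodable A) (eB : encodable B)
    (eC : encodable C) (eX : encodable X) (l1 : X -> seq A) (l2 : X -> seq B)
    (f : X -> A -> B -> C) t1 t2 t b :
  timed l1 t1 -> timed l2 t2 ->
  timed (fun z : X * (A * B) => f z.1 z.2.1 z.2.2) t ->
  (forall x a c, List.In a (l1 x) -> List.In c (l2 x) -> t (x, (a, c)) <= b x) ->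
  timed (fun x => prodmap (f x) (l1 x) (l2 x))
    (fun x => t1 x + t2 x + size (l1 x) * (size (l2 x) * (b x).+1).+1).
Proof.
move=> T1 T2 T le.
have inner : timed (fun z : (X * (seq A * seq B)) * (seq C * A) =>
    foldl (fun s c => f z.1.1 z.2.2 c :: s) z.2.1 z.1.2.2)
    (fun z => 0 + 0 + size z.1.2.2 *
       (\max_(c <- z.1.2.2) t (z.1.1, (z.2.2, c))).+1).
  apply: (timed_foldl
    (P := fun z _ l => forall c, List.In c l -> List.In c z.1.2.2)
    (tf := fun z => t (z.1.1.1, (z.1.2.2, z.2.2)))).
  - by apply: (timed_expr (e := ETl (ETl (EHd (EVar 0))))) => s z /= ->.
  - by apply: (timed_expr (e := EHd (ETl (EVar 0)))) => s z /= ->.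
  - apply: (timed_ext (f := fun z : (X * (seq A * seq B)) * (seq C * A) * (seq C * B) =>
      (f z.1.1.1 z.1.2.2 z.2.2, z.2.1))) => //.
    apply: timed_le (timed_pair (timed_comp (f := fun z : (X * (seq A * seq B)) *
       (seq C * A) * (seq C * B) => (z.1.1.1, (z.1.2.2, z.2.2))) _ T) _) _.
    + apply: (timed_expr (e := ENode (EHd (EHd (EHd (EVar 0))))
        (ENode (ETl (ETl (EHd (EVar 0)))) (ETl (ETl (EVar 0)))))).
      by move=> s z /= ->.
    + by apply: (timed_expr (e := EHd (ETl (EVar 0)))) => s z /= ->.
    + by move=> z; rewrite /= addn0.
  - by [].
  - move=> z s c l sub; split; first by move=> c' h; apply: sub; right.
    apply: (In_bigmax (fun c => t (z.1.1, (z.2.2, c)))); apply: sub; by left.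
(* Both lists are computed once, before the loops, and carried along in the context. *)
pose g (x : X) := (x, (l1 x, l2 x)).
apply: timed_le (timed_comp (f := g) (g := fun y : X * (seq A * seq B) =>
  prodmap (f y.1) y.2.1 y.2.2) (tf := fun x => 0 + (t1 x + t2 x))
  (tg := fun y => 0 + 0 + size y.2.1 * (size y.2.2 *
     (\max_(a <- y.2.1) \max_(c <- y.2.2) t (y.1, (a, c))).+1).+1) _ _) _.
- apply: timed_pair; last exact: timed_pair.
  by apply: (timed_expr (e := EVar 0)) => s x /= ->.
- apply: (timed_foldl
    (P := fun y _ l => forall a, List.In a l -> List.In a y.2.1) _ _ inner).
  + by apply: (timed_expr (e := EHd (ETl (EVar 0)))) => s z /= ->.
  + exact: timed_const.
  + by [].
  + move=> y s a l sub; split; first by move=> a' h; apply: sub; right.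
    rewrite /= !add0n leq_mul2l ltnS; apply/orP; right.
    apply: (In_bigmax (fun a => \max_(c <- y.2.2) t (y.1, (a, c)))).
    by apply: sub; left.
- move=> x; rewrite /= !add0n leq_add2l leq_mul2l ltnS leq_mul2l ltnS.
  apply/orP; right; apply/orP; right.
  by apply: bigmax_In_le => a ha; apply: bigmax_In_le => c hc; exact: le.
Qed.

Lemma timed_has A X (eA : encodable A) (eX : encodable X)
    (l : X -> seq A) (f : X -> A -> bool) tl t b :
  timed l tl -> timed (fun z : X * A => f z.1 z.2) t ->
  (forall x a, List.In a (l x) -> t (x, a) <= b x) ->
  timed (fun x => has (f x) (l x)) (fun x => tl x + size (l x) * (b x).+1).
Proof.
move=> Tl T le.
apply: (timed_ext (f := fun x => foldl (fun b a => if f x a then true else b) false (l x))).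
  move=> x; congr encode; rewrite -[RHS]orFb.
  elim: (l x) false => /= [|a s IH] c; rewrite ?orbF // IH.
  by case: (f x a); rewrite ?orbT.
have step : timed (fun z : X * (bool * A) => if f z.1 z.2.2 then true else z.2.1)
    (fun z => t (z.1, z.2.2)).
  apply: timed_le (timed_if (b := fun z : X * (bool * A) => f z.1 z.2.2)
    (timed_comp (f := fun z : X * (bool * A) => (z.1, z.2.2)) _ T)
    (timed_const true) _) _.
  - by apply: (timed_expr (e := ENode (EHd (EVar 0)) (ETl (ETl (EVar 0))))) => s z /= ->.
  - by apply: (timed_expr (e := EHd (ETl (EVar 0)))) => s z /= ->.
  - by move=> z; rewrite add0n; case: ifP => _; rewrite addn0.
apply: timed_le (timed_foldl (i := fun=> false)
  (f := fun x b a => if f x a then true else b) (b := b)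
  (P := fun x _ s => forall a, List.In a s -> List.In a (l x)) Tl _ step _ _) _.
- exact: timed_const.
- by [].
- move=> x s a l' sub; split; first by move=> c h; apply: sub; right.
  by apply: le; apply: sub; left.
- by move=> x; rewrite addn0.
Qed.

(* [l x] may be exponentially long: the bound is linear in its length and
   polynomial only in its elements and in the part [g x] of the context. *)
Lemma timed_foldl_polytime A X Y S (eA : encodable A) (eX : encodable X)
    (eY : encodable Y) (eS : encodable S)
    (P : Y -> S -> Prop) (b : Y -> nat) (l : X -> seq A) (g : X -> Y)
    (i : Y -> S) (f : Y -> S -> A -> S) tl tg :
  timed l tl -> timed g tg -> polytime i ->
  polytime (fun z : Y * (S * A) => f z.1 z.2.1 z.2.2) -> polyb b ->
  (forall y, P y (i y)) -> (forall y s a, P y s -> P y (f y s a)) ->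
  (forall y s, P y s -> sz s <= b y) ->
  exists d, forall c : X -> nat, (forall x a, List.In a (l x) -> sz a <= c x) ->
  timed (fun x => foldl (f (g x)) (i (g x)) (l x))
    (fun x => tl x + tg x + (sz (g x)).+1 ^ d
              + size (l x) * ((sz (g x) + c x + 3) ^ d).+1).
Proof.
move=> Tl Tg /polytime_timed[d1 Ti] /polytime_timed[d2 Tf] [d3 bP] Pi Pf Pb.
exists (d1 + (d3 + 2) * d2) => c le.
pose G (x : X) := (g x, l x).
apply: timed_le (timed_comp (f := G) (g := fun y : Y * seq A => foldl (f y.1) (i y.1) y.2)
  (tf := fun x => tg x + tl x)
  (tg := fun y => 0 + (sz y.1).+1 ^ d1 +
     size y.2 * (((sz y.1).+1 ^ d3 + sz y.1 + (\max_(a <- y.2) sz a) + 3) ^ d2).+1) _ _) _.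
- exact: timed_pair.
- apply: (timed_foldl (l := fun y : Y * seq A => y.2) (i := fun y => i y.1)
    (f := fun y s a => f y.1 s a) (tf := fun z => (sz (z.1.1, (z.2.1, z.2.2))).+1 ^ d2)
    (P := fun y s s' => P y.1 s /\ forall a, List.In a s' -> List.In a y.2)).
  + by apply: (timed_expr (e := ETl (EVar 0))) => s z /= ->.
  + apply: timed_le (timed_comp (f := fun z : Y * seq A => z.1) (tf := fun=> 0) _ Ti) _.
      by apply: (timed_expr (e := EHd (EVar 0))) => s z /= ->.
    by move=> y; rewrite add0n.
  + apply: timed_le (timed_comp (f := fun z : (Y * seq A) * (S * A) => (z.1.1, z.2))
      (tf := fun=> 0) (g := fun z => f z.1 z.2.1 z.2.2) _ Tf) _.
      apply: (timed_expr (e := ENode (EHd (EHd (EVar 0))) (ETl (EVar 0)))).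
      by move=> s z /= ->.
    by move=> [[y l'] [s a]]; rewrite add0n.
  + by move=> y; split.
  + move=> y s a l' [Ps sub]; split.
      by split; [exact: Pf | move=> a' h; apply: sub; right].
    apply: leq_exp2rw; rewrite /= !sz_pair.
    have h1 := Pb _ _ Ps; have h2 := bP y.1.
    have h3 : sz a <= \max_(a <- y.2) sz a.
      by apply: (@In_bigmax _ (fun a => sz a)); apply: sub; left.
    by lia.
- move=> x; rewrite /G /= add0n [tg x + _]addnC -!addnA leq_add2l leq_add2l.
  have s0 := @sz_gt0 _ eY (g x).
  set w := sz (g x) in s0 *; apply: leq_add; first by rewrite leq_pexp2l // leq_addr.
  rewrite leq_mul2l ltnS; apply/orP; right.
  set W := w + (c x + 3).
  apply: (@leq_trans (W ^ ((d3 + 2) * d2))); last first.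
    by rewrite leq_pexp2l ?leq_addl // /W; lia.
  rewrite expnM; apply: leq_exp2rw.
  have h : \max_(a <- l x) sz a <= c x by apply: bigmax_In_le => a; exact: le.
  have W3 : 3 <= W by rewrite /W; lia.
  have h1 : w.+1 ^ d3 <= W ^ d3 by apply: leq_exp2rw; rewrite /W; lia.
  have W0 : 0 < W ^ d3 by rewrite expn_gt0; lia.
  apply: (@leq_trans (W ^ d3 + W)).
    by apply: leq_add => //; rewrite /W; lia.
  rewrite expnD; nia.
Qed.

(** * Hash families *)

(* Induction along the harmonic triangle: with [a_(n, k) = 1 / (k 'C(n, k))]
   one has [a_(n, k.+1) = a_(n.-1, k) - a_(n, k)]. *)
Lemma mul_bin_dvd_common_multiple L n k :
  0 < k <= n -> (forall m, 0 < m <= n -> m %| L) -> k * 'C(n, k) %| L.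
Proof.
case: k => // k; elim: k n => [|k IH] n /andP[_ kn] dvL.
  by rewrite bin1 mul1n dvL // kn /=.
case: n => // n in kn dvL *.
have /dvdnP[a La] : k.+1 * 'C(n, k.+1) %| L.
  by apply: IH => [|m /andP[m0 mn]]; [lia | apply: dvL; lia].
have /dvdnP[b Lb] : k.+1 * 'C(n.+1, k.+1) %| L by apply: IH => //; lia.
have e1 : k.+2 * 'C(n.+1, k.+2) = n.+1 * 'C(n, k.+1) by rewrite mul_bin_diag.
have e2 : (n.+1 - k.+1) * 'C(n.+1, k.+1) = n.+1 * 'C(n, k.+1).
  by rewrite -mul_bin_left -mul_bin_diag.
rewrite e1; apply/dvdnP; exists (a - b).
have ck0 : 0 < k.+1 by [].
have: k.+1 * ((a - b) * (n.+1 * 'C(n, k.+1))) = k.+1 * L; last first.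
  by move/eqP; rewrite eqn_pmul2l // => /eqP ->.
have eA : k.+1 * (a * (n.+1 * 'C(n, k.+1))) = n.+1 * L by rewrite La; ring.
have eB : k.+1 * (b * (n.+1 * 'C(n, k.+1))) = (n.+1 - k.+1) * L.
  by rewrite -e2 [in RHS]Lb; ring.
rewrite mulnBl mulnBr eA eB -mulnBl; congr (_ * _); lia.
Qed.

Lemma exp2_le_central_bin k : 2 ^ k <= 'C(k.*2, k).
Proof.
elim: k => // k IH; rewrite expnS mul2n -addnn doubleS binS.
apply: leq_add.
  by apply: leq_trans IH _; rewrite binS leq_addl.
apply: leq_trans IH _; case: k => // k.
by rewrite binS leq_addr.
Qed.

(** The number [k * 'C(2 * k, k)] divides [L], and the central binomial coefficient is at least
    [2 ^ k]. This serves twice: for a modulus without collisions, and for one that exposes a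
    positive count. *)
Lemma exp2_le_common_multiple k L :
  0 < L -> (forall m, 0 < m <= 2 * k -> m %| L) -> 2 ^ k <= L.
Proof.
case: k => // k L0 dvL; apply: leq_trans (exp2_le_central_bin _) _.
apply: dvdn_leq => //; rewrite -mul2n.
apply: dvdn_trans (_ : k.+1 * 'C(2 * k.+1, k.+1) %| _); first exact: dvdn_mull.
by apply: mul_bin_dvd_common_multiple dvL; lia.
Qed.

Definition moduli (j : nat) : nat := 2 * (j ^ 3).+1.
Arguments moduli : simpl never.

(** A modulus with a collision in [T] divides a difference, hence the product [L] of all
    differences. [L] has at most [j ^ 2] factors below [2 ^ j], so it is below [2 ^ (j ^ 3).+1] and
    cannot be a multiple of all moduli up to [moduli j]. *)
Lemma exists_injective_modn j (T : seq nat) :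
  uniq T -> size T <= j -> all (fun x => x < 2 ^ j) T ->
  exists2 m, m < moduli j & {in T &, injective (fun x => x %% m.+1)}.
Proof.
move=> uT sT /allP T_lt.
pose L := \prod_(x <- T) \prod_(y <- T | x < y) (y - x).
have L0 : 0 < L by rewrite prodn_cond_gt0 // => x _; rewrite prodn_cond_gt0 // => y; rewrite subn_gt0.
have L_le : L <= 2 ^ (j ^ 3).
  have in_le (x : nat) : \prod_(y <- T | x < y) (y - x) <= (2 ^ j) ^ j.
    have: \prod_(y <- T | x < y) (y - x) <= (2 ^ j) ^ size T.
      elim: T T_lt {uT sT L L0} => [|y s IH] h; first by rewrite big_nil.
      have lt := h y (mem_head _ _).
      have := IH (fun z zs => h z (mem_behead (s := y :: s) zs)).
      rewrite big_cons /= expnS; case: ifP => _ le.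
        by apply: leq_mul => //; lia.
      by apply: leq_trans le _; rewrite leq_pmull ?expn_gt0.
    move/leq_trans; apply; rewrite leq_pexp2l ?expn_gt0 //.
  have: L <= ((2 ^ j) ^ j) ^ size T.
    rewrite /L; elim: {1 3}T => [|x s IH]; first by rewrite big_nil.
    by rewrite big_cons expnS leq_mul.
  move/leq_trans; apply.
  rewrite -!expnM leq_exp2l // !expnS expn0 muln1 //.
  by rewrite !leq_mul2l sT !orbT.
case: (pickP (fun m : 'I_(moduli j) => all (fun x => all (fun y =>
    (x %% m.+1 == y %% m.+1) ==> (x == y)) T) T)) => [m /allP inj|none].
  exists m => // x y xT yT /= e.
  by have /allP/(_ y yT) := inj x xT; rewrite e eqxx /= => /eqP.
exfalso; suff: 2 ^ (j ^ 3).+1 <= L by rewrite leqNgt => /negP; apply;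
  apply: leq_ltn_trans L_le _; rewrite ltn_exp2l.
apply: exp2_le_common_multiple => // m /andP[m0 mle].
have mlt : m.-1 < moduli j by rewrite /moduli; lia.
have := none (Ordinal mlt); rewrite /= prednK //.
move=> /negbT /allPn[x xT /allPn[y yT]]; rewrite negb_imply => /andP[/eqP e ne].
wlog lt : x y xT yT e ne / x < y.
  move=> H; case: (ltngtP x y) => lt; [exact: (H x y)|apply: (H y x) => //|].
    by rewrite eq_sym.
  by rewrite lt eqxx in ne.
have d : m %| y - x by rewrite -eqn_mod_dvd ?(ltnW lt) // e.
apply: dvdn_trans d _.
by rewrite /L (big_rem x xT) /= (big_rem y yT) /= lt -mulnA dvdn_mulr.
Qed.

(** * Counting the functions that are injective on a set *)

Fixpoint sequences (c n : nat) : seq (seq nat) :=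
  if n is n'.+1 then [seq a :: s | a <- iota 0 c, s <- sequences c n'] else [:: [::]].

Lemma size_sequences c n : size (sequences c n) = c ^ n.
Proof. by elim: n => //= n IH; rewrite size_allpairs size_iota IH expnS. Qed.

Lemma sequences_lt c n s x : s \in sequences c n -> 0 < c -> nth 0 s x < c.
Proof.
elim: n s x => [|n IH] s x /=.
  by rewrite inE => /eqP ->; rewrite nth_nil.
move=> /allpairsP[[a t] /= [ha ht ->]] c0; case: x => [|x] /=.
  by move: ha; rewrite mem_iota.
exact: IH.
Qed.

(** The mask marks the set on which the function with table [s] has to be injective; [A] collects
    the values already taken, which turns counting into a direct recursion. *)
Fixpoint distinct_on (mask : bitseq) (A s : seq nat) : bool :=
  match mask, s with
  | b :: mask', a :: s' =>
    if b then (a \notin A) && distinct_on mask' (a :: A) s'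
    else distinct_on mask' A s'
  | _, _ => true
  end.

Lemma distinct_onP mask A s : size s = size mask -> distinct_on mask A s ->
  (forall x, nth false mask x -> nth 0 s x \notin A) /\
  (forall x y, nth false mask x -> nth false mask y -> nth 0 s x = nth 0 s y -> x = y).
Proof.
elim: mask A s => [|b mask IH] A [|a s] //=.
  by move=> _ _; split=> [x|x y]; rewrite nth_nil.
case=> sz; case: b => [/andP[aA]|] /(IH _ _ sz) [d1 d2]; split.
- by move=> [|x] //= /d1; rewrite inE negb_or => /andP[].
- move=> [|x] [|y] //=.
  + by move=> _ /d1; rewrite inE negb_or => /andP[/eqP ne _] /esym.
  + by move=> /d1; rewrite inE negb_or => /andP[/eqP ne _] _.
  + by move=> mx my /(d2 _ _ mx my) ->.
- by move=> [|x] //= /d1.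
- by move=> [|x] [|y] //= mx my /(d2 _ _ mx my) ->.
Qed.

Lemma count_allpairs_cons (P : pred (seq nat)) (l : seq nat) (L : seq (seq nat)) :
  count P [seq a :: s | a <- l, s <- L] = \sum_(a <- l) count (fun s => P (a :: s)) L.
Proof.
elim: l => [|a l IH] /=; first by rewrite big_nil.
by rewrite count_cat IH big_cons count_map.
Qed.

(** Each marked position has one value fewer to choose from than the marked one before it; an
    unmarked position has all [c]. *)
Lemma count_distinct_on c mask A : uniq A -> all (fun a => a < c) A ->
  count (distinct_on mask A) (sequences c (size mask)) =
  (c - size A) ^_ (count id mask) * c ^ (count negb mask).
Proof.
elim: mask A => [|b mask IH] A uA A_lt //=.
rewrite count_allpairs_cons; case: b => /=; last first.
  rewrite (eq_bigr (fun=> (c - size A) ^_ (count id mask) * c ^ (count negb mask))).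
    by rewrite big_const_seq count_predT size_iota iter_addn_0 add0n expnS; ring.
  by move=> a _; rewrite -IH //.
set V := (c - size A).-1 ^_ (count id mask) * c ^ (count negb mask).
rewrite (eq_big_seq (fun a => (a \notin A) * V)); last first.
  move=> a; rewrite mem_iota /= => a_lt; case: (boolP (a \in A)) => aA /=.
    by rewrite count_pred0.
  by rewrite IH /= ?aA ?uA ?a_lt //= mul1n /V subnS.
rewrite -big_distrl /= add0n ffactnS -mulnA; congr (_ * _).
have -> : \sum_(a <- iota 0 c) (a \notin A : nat) = count (fun a => a \notin A) (iota 0 c).
  by rewrite -sum1_count [RHS]big_mkcond; apply: eq_bigr => a _; case: (a \in A).
have : count (mem A) (iota 0 c) = size A.
  rewrite -size_filter; apply/perm_size/uniq_perm => //; first by rewrite filter_uniq ?iota_uniq.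
  move=> a; rewrite mem_filter mem_iota /= andb_idr //.
  by move/(allP A_lt).
have := count_predC (mem A) (iota 0 c); rewrite size_iota.
by move=> e1 e2; rewrite -[X in X - _]e1 e2 addKn.
Qed.


(** * Greedy covering *)

Lemma two_expn_subn_le W g n : 0 < g <= W -> W <= n * g -> 2 * (W - g) ^ n <= W ^ n.
Proof.
move=> /andP[g0 gW] le; set a := W - g.
(* Bernoulli's inequality without division. As [a <= n * g], the second summand is at least the
   first one, which yields the factor 2. *)
have bern k : a ^ k.+1 + k.+1 * g * a ^ k <= (a + g) ^ k.+1.
  elim: k => [|k IH]; first by rewrite !expn1 expn0; lia.
  rewrite [X in _ <= X]expnS; apply: leq_trans (leq_mul (leqnn _) IH).
  by rewrite !expnS; nia.
case: n le => [|n] le; first by lia.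
have -> : W = a + g by rewrite /a subnK.
apply: leq_trans (bern n); rewrite mul2n -addnn leq_add2l expnS leq_mul2r.
by apply/orP; right; apply: leq_trans (leq_subr _ _) le.
Qed.

Section Greedy.

Context {T U : eqType}.
Variables (hit : T -> U -> bool) (Om : seq T) (g : nat).
Let W := size Om.

Lemma greedy_step (L : seq U) : 0 < W ->
  (forall m, m \in L -> g <= count (hit^~ m) Om) ->
  exists2 f, f \in Om & W * count (fun m => ~~ hit f m) L <= (W - g) * size L.
Proof.
move=> W0 hitL.
case: (boolP (has (fun f => W * count (fun m => ~~ hit f m) L <= (W - g) * size L) Om)).
  by case/hasP => f ? ?; exists f.
rewrite -all_predC => /allP none; exfalso.
have sum_le : \sum_(f <- Om) count (fun m => ~~ hit f m) L <= (W - g) * size L.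
  elim: L hitL {none} => [|m L IH] hitL.
    by rewrite big1 // => f _.
  rewrite /= big_split /= mulnS; apply: leq_add; last first.
    by apply: IH => m' m'L; apply: hitL; rewrite inE m'L orbT.
  have -> : \sum_(f <- Om) (~~ hit f m : nat) = count (predC (hit^~ m)) Om.
    by rewrite -sum1_count [RHS]big_mkcond; apply: eq_bigr => a _ /=; case: (hit a m).
  have := count_predC (hit^~ m) Om; have := hitL m (mem_head _ _).
  by rewrite -/W; lia.
have : \sum_(f <- Om) ((W - g) * size L).+1 <=
       \sum_(f <- Om) W * count (fun m => ~~ hit f m) L.
  rewrite !big_seq; apply: leq_sum => f fO.
  by have := none f fO; rewrite /= -ltnNge.
rewrite big_const_seq count_predT iter_addn_0 -/W -big_distrr /= mulnC leq_pmul2l //.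
by move/(leq_trans)/(_ sum_le); rewrite ltnn.
Qed.

Lemma greedy_iter (r : nat) (L : seq U) : 0 < W ->
  (forall m, m \in L -> g <= count (hit^~ m) Om) ->
  exists F, [/\ {subset F <= Om}, size F = r &
    W ^ r * count (fun m => ~~ has (hit^~ m) F) L <= (W - g) ^ r * size L].
Proof.
move=> W0; elim: r L => [|r IH] L hitL.
  by exists [::]; split=> //; rewrite !expn0 !mul1n count_size.
have [f fO f_le] := greedy_step W0 hitL.
have [F [sub sF F_le]] := IH [seq m <- L | ~~ hit f m]
  (fun m h => hitL m (mem_subseq (filter_subseq _ _) h)).
exists (f :: F); split=> /=; [ | by rewrite sF | ].
  by move=> h; rewrite inE => /orP[/eqP ->|/sub].
have -> : count (fun m => ~~ (hit f m || has (hit^~ m) F)) L =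
          count (fun m => ~~ has (hit^~ m) F) [seq m <- L | ~~ hit f m].
  by rewrite count_filter; apply: eq_count => m /=; rewrite negb_or andbC.
rewrite expnS -mulnA; apply: leq_trans (leq_mul (leqnn W) F_le) _.
by rewrite size_filter mulnCA expnSr -mulnA leq_mul2l f_le orbT.
Qed.

(** By [two_expn_subn_le] each [n] rounds halve what is still missed; after [e.+1] halvings fewer
    than one of at most [2 ^ e] members is left. *)
Lemma greedy_cover (n : nat) (L : seq U) (e : nat) : 0 < g <= W -> W <= n * g ->
  size L <= 2 ^ e ->
  (forall m, m \in L -> g <= count (hit^~ m) Om) ->
  exists F, [/\ {subset F <= Om}, size F = n * e.+1 &
    forall m, m \in L -> has (hit^~ m) F].
Proof.
move=> gW Wn sL hitL; have W0 : 0 < W by lia.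
have [F [sub sF F_le]] := greedy_iter (n * e.+1) W0 hitL.
exists F; split=> // m mL; apply: contraT => nh.
have c0 : 0 < count (fun m => ~~ has (hit^~ m) F) L.
  by rewrite -has_count; apply/hasP; exists m.
have two := two_expn_subn_le gW Wn.
have : (2 * (W - g) ^ n) ^ e.+1 <= W ^ (n * e.+1) by rewrite expnM leq_exp2rw.
rewrite expnMn -expnM => two'.
have P0 : 0 < W ^ (n * e.+1) by rewrite expn_gt0 W0.
exfalso; move: F_le two' P0; rewrite [2 ^ _]expnS.
move: (W ^ _) ((W - g) ^ _) (count _ _) c0 => P Q k k0 h1 h2 P0.
have : P <= Q * 2 ^ e by apply: leq_trans (leq_trans h1 _); [rewrite leq_pmulr|rewrite leq_mul2l sL orbT].
by nia.
Qed.

End Greedy.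

Fixpoint bitseqs (n : nat) : seq bitseq :=
  if n is n'.+1 then prodmap cons [:: false; true] (bitseqs n') else [:: [::]].

Lemma size_bitseqs n : size (bitseqs n) = 2 ^ n.
Proof. by elim: n => //= n IH; rewrite size_prodmap IH expnS. Qed.

Lemma mem_bitseqs n s : (s \in bitseqs n) = (size s == n).
Proof.
elim: n s => [|n IH] [|b s] //=.
  by rewrite mem_prodmap; apply/allpairsP => -[[? ?] []].
rewrite eqSS -IH mem_prodmap; apply/allpairsP/idP => [[[b' t] /= [_ ? [_ ->]]] //|sn].
by exists (b, s); split=> //=; case: b.
Qed.

(** At least one in [n] of all functions to [c] colours is injective on a given set of at most [l]
    elements. Such sets, as bit masks, number at most [2 ^ D], so the greedy cover takes [n]
    functions for each of [D.+1] halvings. *)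
Lemma exists_hash_family c l D n : 0 < l <= c -> l <= D -> c ^ l <= n * c ^_ l ->
  exists F : seq (seq nat), [/\ size F = n * D.+1,
    forall f x, f \in F -> nth 0 f x < c &
    forall T, uniq T -> size T <= l -> all (fun x => x < D) T ->
      exists2 f, f \in F & {in T &, injective (nth 0 f)}].
Proof.
move=> /andP[l0 lc] lD cn; have c0 : 0 < c by lia.
pose g := c ^_ l * c ^ (D - l).
have W_g : c ^ D <= n * g.
  by rewrite /g mulnA -{1}(subnKC lD) expnD leq_mul2r cn orbT.
have cl : c ^_ l <= c ^ l.
  rewrite ffact_prod -[X in _ <= _ ^ X]card_ord -prod_nat_const.
  by apply: leq_prod => i _; rewrite leq_subr.
have g0 : 0 < g <= c ^ D.
  rewrite muln_gt0 ffact_gt0 lc expn_gt0 c0 /= /g.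
  by rewrite -[X in _ <= _ ^ X](subnKC lD) expnD leq_mul2r cl orbT.
pose L := [seq m <- bitseqs D | count id m <= l].
(* Sets smaller than [l] are no harder: the missing factors of the falling factorial are replaced by
   [c]. *)
have ff a : a <= l -> c ^_ l <= c ^_ a * c ^ (l - a).
  elim: l {l0 cn lD g W_g cl g0 L} lc => [|k IH] kc; first by rewrite leqn0 => /eqP ->.
  rewrite leq_eqVlt => /orP[/eqP ->|]; first by rewrite subnn muln1.
  rewrite ltnS => ak; rewrite ffactnSr subSn // expnSr mulnA.
  by apply: leq_mul; [apply: IH => //; lia | rewrite leq_subr].
have aux a b s : a <= l -> s = D -> a + b = s -> b = (l - a) + (s - l).
  by move=> *; lia.
have hitL m : m \in L -> g <= count ((fun f m => distinct_on m [::] f)^~ m) (sequences c D).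
  rewrite mem_filter mem_bitseqs => /andP[ml /eqP mD].
  rewrite -mD count_distinct_on //= subn0 /g -mD.
  have e : count id m + count negb m = size m by rewrite -(count_predC id m).
  rewrite (aux _ _ _ ml mD e).
  by rewrite expnD mulnA leq_mul2r ff ?orbT.
rewrite -(size_sequences c D) in W_g g0.
have sL : size L <= 2 ^ D.
  by rewrite size_filter -size_bitseqs count_size.
have [F [sub sF cov]] := greedy_cover g0 W_g sL hitL.
exists F; split=> // [f x /sub fO|T uT sT /allP T_lt]; first exact: sequences_lt fO c0.
pose m := [seq x \in T | x <- iota 0 D].
have mD : size m = D by rewrite size_map size_iota.
have nth_m x : x < D -> nth false m x = (x \in T).
  by move=> xD; rewrite (nth_map 0) ?size_iota // nth_iota.
have mL : m \in L.
  rewrite mem_filter mem_bitseqs mD eqxx andbT count_map.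
  apply: leq_trans sT; rewrite -size_filter; apply: uniq_leq_size.
    by rewrite filter_uniq // iota_uniq.
  by move=> x; rewrite mem_filter => /andP[].
have /hasP[f fF fm] := cov m mL.
have sf : size f = size m.
  rewrite mD; move/sub: fF; elim: (D) f {fm} => [|k IH] f /=; first by rewrite inE => /eqP ->.
  by case/allpairsP => -[a s] [_ /= /IH <- ->].
exists f => // x y xT yT e; have [_] := distinct_onP sf fm.
by apply=> //; rewrite nth_m ?xT ?yT // T_lt.
Qed.

(** * Hash families composed of blocks *)

Notation table := (seq nat).

(* The index [i] encodes a modulus and a cut. *)
Definition combine (l c n q i : nat) (fg : table * table) : table :=
  [seq (if x %% (i %/ (moduli (q * l)).+1).+1 < i %% (moduli (q * l)).+1
        then nth 0 fg.1 (x %% (i %/ (moduli (q * l)).+1).+1)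
        else c * (q.+1 %/ 2)
             + nth 0 fg.2 (x %% (i %/ (moduli (q * l)).+1).+1 - i %% (moduli (q * l)).+1))
  | x <- iota 0 n].

Definition family1 (l n : nat) (F : seq table) : seq table :=
  prodmap (fun m f => [seq nth 0 f (x %% m.+1) | x <- iota 0 n]) (iota 0 (moduli l)) F.

(** The family for [(size st).+1] blocks, where [st] lists those for [size st], ..., 1 blocks. Entry
    [size st - j] thus belongs to [j] blocks, and the two entries used are the halves rounded up and
    down. *)
Definition family_step (l c n : nat) (st : seq (seq table)) : seq table :=
  prodmap (combine l c n (size st).+1)
    (iota 0 (moduli ((size st).+1 * l) * (moduli ((size st).+1 * l)).+1))
    (prodmap pair (nth [::] st (size st - (size st).+2 %/ 2))
                  (nth [::] st (size st - (size st).+1 %/ 2))).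

(* Lists the families for [k.+1, ..., 1] blocks, in this order. *)
Definition families (l c n : nat) (F : seq table) (k : nat) : seq (seq table) :=
  iter k (fun st => family_step l c n st :: st) [:: family1 l n F].

Definition hash_family (l c n : nat) (F : seq table) (q : nat) : seq table :=
  nth [::] (families l c n F q.-1) 0.

Section Family.

Variables (l c n : nat) (F : seq table).
Notation hash_family := (hash_family l c n F).
Notation families := (families l c n F).

Lemma size_families k : size (families k) = k.+1.
Proof. by elim: k => //= k ->. Qed.

Lemma nth_families k q : 0 < q <= k.+1 -> nth [::] (families k) (k.+1 - q) = hash_family q.
Proof.
elim: k => [|k IH] /andP[q0 qk]; first by have -> : q = 1 by lia.
move: qk; rewrite leq_eqVlt => /orP[/eqP ->|qk]; first by rewrite subnn.
by rewrite subSn //= IH ?q0 //; lia.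
Qed.

Lemma familyS q : 0 < q ->
  hash_family q.+1 = prodmap (combine l c n q.+1)
    (iota 0 (moduli (q.+1 * l) * (moduli (q.+1 * l)).+1))
    (prodmap pair (hash_family (q.+2 %/ 2)) (hash_family (q.+1 %/ 2))).
Proof.
case: q => // k _; rewrite /hash_family /= /family_step size_families.
by rewrite !nth_families //; lia.
Qed.

Lemma size_family1 : size (hash_family 1) = moduli l * size F.
Proof. by rewrite /hash_family /= size_prodmap size_iota. Qed.

Lemma size_familyS q : 0 < q ->
  size (hash_family q.+1) = moduli (q.+1 * l) * (moduli (q.+1 * l)).+1 *
    (size (hash_family (q.+2 %/ 2)) * size (hash_family (q.+1 %/ 2))).
Proof. by move=> q0; rewrite familyS // !size_prodmap size_iota. Qed.

(* The factor [q ^ 6] absorbs the choice of a modulus and a cut in each step. *)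
Lemma size_family_le q K : 0 < q -> 0 < l -> K = 32 * (9 * l) ^ 6 ->
  size (hash_family q) * (K * q ^ 6) <= (moduli l * size F * K) ^ q.
Proof.
move=> q0 l0 KE; elim/ltn_ind: q q0 => -[|[|q]] // IH _.
  by rewrite size_family1 exp1n expn1 !muln1.
rewrite size_familyS //; set q1 := q.+3 %/ 2; set q2 := q.+2 %/ 2.
have q12 : q1 + q2 = q.+2 by rewrite /q1 /q2; lia.
(* Each half has at least a third of the blocks, so [q.+2 ^ 2 <= 9 * q1 * q2]. This is where the 9
   in [K] comes from: the sixth powers of both halves pay for the choices made here and for the
   sixth power of the whole. *)
have le1 : q.+2 <= 3 * q1 by rewrite /q1; lia.
have le2 : q.+2 <= 3 * q2 by rewrite /q2; lia.
have h1 := IH q1 ltac:(lia) ltac:(lia); have h2 := IH q2 ltac:(lia) ltac:(lia).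
rewrite -[X in _ <= _ ^ X]q12 expnD; apply: leq_trans (leq_mul h1 h2).
set a := size (hash_family q1); set b := size (hash_family q2).
suff core : moduli (q.+2 * l) * (moduli (q.+2 * l)).+1 * q.+2 ^ 6 <= K * (q1 ^ 6 * q2 ^ 6).
  move: core; move: (_ * (moduli _).+1) (q.+2 ^ 6) (q1 ^ 6) (q2 ^ 6) => Mo Q Q1 Q2 core.
  have -> : Mo * (a * b) * (K * Q) = (a * b * K) * (Mo * Q) by ring.
  have -> : a * (K * Q1) * (b * (K * Q2)) = (a * b * K) * (K * (Q1 * Q2)) by ring.
  by rewrite leq_mul2l core orbT.
have M_le : moduli (q.+2 * l) * (moduli (q.+2 * l)).+1 <= 32 * (q.+2 * l) ^ 6.
  rewrite /moduli (expnM _ 3 2); set z := (q.+2 * l) ^ 3.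
  have z1 : 0 < z by rewrite expn_gt0 muln_gt0 l0.
  by clearbody z; nia.
apply: (@leq_trans (32 * (q.+2 * l) ^ 6 * q.+2 ^ 6)); first by rewrite leq_mul2r M_le orbT.
have -> : 32 * (q.+2 * l) ^ 6 * q.+2 ^ 6 = 32 * (q.+2 * l * q.+2) ^ 6.
  by rewrite -mulnA -expnMn.
have -> : K * (q1 ^ 6 * q2 ^ 6) = 32 * (9 * l * (q1 * q2)) ^ 6.
  by rewrite KE -mulnA -!expnMn.
rewrite leq_mul2l; apply/orP; right; apply: leq_exp2rw.
apply: (@leq_trans ((3 * q1) * l * (3 * q2))); first by rewrite !leq_mul.
by apply/eq_leq; ring.
Qed.

Hypothesis c0 : 0 < c.
Hypothesis F_lt : forall f x, f \in F -> nth 0 f x < c.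

Lemma family_lt q h x : 0 < q -> h \in hash_family q -> nth 0 h x < c * q.
Proof.
elim/ltn_ind: q h x => -[|[|q]] // IH h x _.
  rewrite /hash_family /= mem_prodmap muln1 => /allpairsP[[m f] /= [_ fF ->]].
  case: (ltnP x n) => xn; last by rewrite nth_default ?size_map ?size_iota.
  by rewrite (nth_map 0) ?size_iota //; exact: F_lt.
rewrite familyS // mem_prodmap => /allpairsP[[i fg] /= [_ fgP ->]].
move: fgP; rewrite mem_prodmap => /allpairsP[[f g] /= [fP gP ->]].
case: (ltnP x n) => xn; last by rewrite nth_default ?size_map ?size_iota // muln_gt0 c0.
rewrite (nth_map 0) ?size_iota //=; case: ifP => _.
  apply: leq_trans (IH _ _ _ _ _ fP) _; [lia | lia |].
  by rewrite leq_mul2l; lia.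
have E : q.+2 = q.+3 %/ 2 + q.+2 %/ 2 by lia.
rewrite [X in _ < c * X]E mulnDr ltn_add2l.
by apply: (IH (q.+2 %/ 2)) gP; lia.
Qed.

Hypothesis l_big : forall z, l <= z -> 108 * z ^ 3 <= 2 ^ z.
Hypothesis l0 : 0 < l.
Hypothesis F_inj : forall T, uniq T -> size T <= l -> all (fun x => x < moduli l) T ->
  exists2 f, f \in F & {in T &, injective (nth 0 f)}.

(** After the reduction the elements are below the modulus; by this bound they satisfy the size
    condition of the recursive calls, which have only half of the blocks. *)
Lemma moduli_lt_exp q : 0 < q -> moduli (q.+1 * l) <= 2 ^ (q.+1 %/ 2 * l).
Proof.
move=> q0; set a := q.+1 %/ 2.
have a0 : 0 < a by rewrite /a; lia.
have le := l_big (leq_pmull l a0).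
apply: leq_trans le; rewrite /moduli.
apply: (@leq_trans (4 * (q.+1 * l) ^ 3)).
  have : 0 < (q.+1 * l) ^ 3 by rewrite expn_gt0 muln_gt0 l0.
  by lia.
have -> : 108 = 4 * 3 ^ 3 by [].
rewrite -mulnA -expnMn leq_mul2l; apply/orP; right; apply: leq_exp2rw.
by rewrite mulnA leq_mul2r; apply/orP; right; rewrite /a; lia.
Qed.

(** Take the largest cut with at most [a] elements below. As [T] has no repetitions, moving the cut
    by one adds at most one element; hence exactly [a] lie below it, or the cut is [N] and nothing
    lies above. *)
Lemma exists_cut (T : seq nat) a b N : uniq T -> size T <= a + b ->
  all (fun x => x < N) T ->
  exists cut, [/\ cut <= N, count (fun x => x < cut) T <= a &
    count (fun x => cut <= x) T <= b].
Proof.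
move=> uT sT /allP T_lt.
have ex0 : exists k, (k <= N) && (count (fun x => x < k) T <= a).
  by exists 0; rewrite (eq_count (a2 := pred0)) // count_pred0.
have bd k : (k <= N) && (count (fun x => x < k) T <= a) -> k <= N by case/andP.
case: (ex_maxnP ex0 bd) => k /andP[kN ck] kmax; exists k; split=> //.
have tot : count (fun x => x < k) T + count (fun x => k <= x) T = size T.
  rewrite -(count_predC (fun x => x < k)); congr (_ + _).
  by apply: eq_count => x /=; rewrite leqNgt.
case: (ltnP k N) => kN'; last first.
  have -> : count (fun x => k <= x) T = 0; last by [].
  apply/eqP; rewrite -leqn0 leqNgt -has_count; apply/hasPn => x /T_lt.
  by rewrite -ltnNge => /leq_trans; apply.
have big : a < count (fun x => x < k.+1) T.
  by rewrite ltnNge; apply/negP => h; have := kmax k.+1; rewrite kN' h ltnn => /(_ isT).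
have : count (fun x => x < k.+1) T <= (count (fun x => x < k) T).+1.
  have -> : count (fun x => x < k.+1) T = count (fun x => x < k) T + count_mem k T.
    rewrite -count_predUI [X in _ + X](eq_count (a2 := pred0)) ?count_pred0 ?addn0.
      by apply: eq_count => x /=; rewrite ltnS leq_eqVlt orbC.
    by move=> x /=; case: eqP => [->|]; rewrite ?ltnn ?andbF.
  by rewrite count_uniq_mem // -addn1 leq_add2l leq_b1.
by lia.
Qed.

(** The two sides of the cut use disjoint ranges of colours, below [c * q1] and from there on, so
    only elements on the same side can collide, and there the recursive table is injective. The
    condition on [n] keeps all residues within the tables. *)
Lemma family_inj q T : 0 < q -> moduli (q * l) <= n ->
  uniq T -> size T <= q * l -> all (fun x => x < 2 ^ (q * l)) T ->
  all (fun x => x < n) T ->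
  exists2 h, h \in hash_family q & {in T &, injective (nth 0 h)}.
Proof.
elim/ltn_ind: q T => -[|[|q]] // IH T _ Mn uT sT T_lt /allP T_n.
  rewrite mul1n in Mn sT T_lt.
  have [m m_lt m_inj] := exists_injective_modn uT sT T_lt.
  pose T' := [seq x %% m.+1 | x <- T].
  have [|||f fF f_inj] := F_inj (T := T').
  - by rewrite map_inj_in_uniq.
  - by rewrite size_map.
  - by apply/allP => _ /mapP[x xT ->]; apply: leq_trans m_lt; rewrite ltn_mod.
  exists [seq nth 0 f (x %% m.+1) | x <- iota 0 n].
    rewrite /hash_family /= mem_prodmap; apply/allpairsP; exists (m, f); split=> //.
    by rewrite mem_iota add0n.
  move=> x y xT yT; rewrite !(nth_map 0) ?size_iota ?T_n // !nth_iota ?T_n // !add0n => e.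
  by apply: m_inj => //; apply: f_inj => //; apply: map_f.
have [m m_lt m_inj] := exists_injective_modn uT sT T_lt.
set M := moduli (q.+2 * l) in m_lt Mn.
set q1 := q.+3 %/ 2; set q2 := q.+2 %/ 2.
have q12 : q1 + q2 = q.+2 by rewrite /q1 /q2; lia.
pose T' := [seq x %% m.+1 | x <- T].
have uT' : uniq T' by rewrite map_inj_in_uniq.
have T'_lt : all (fun x => x < m.+1) T'.
  by apply/allP => _ /mapP[x xT ->]; rewrite ltn_mod.
have sT' : size T' <= q1 * l + q2 * l by rewrite size_map -mulnDl q12.
have [cut [cut_le le1 le2]] := exists_cut uT' sT' T'_lt.
have M_q2 : M <= 2 ^ (q2 * l) by exact: moduli_lt_exp.
have M_q1 : M <= 2 ^ (q1 * l).
  by apply: leq_trans M_q2 _; rewrite leq_exp2l // leq_mul2r; lia.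
have mono k : k <= q.+2 -> moduli (k * l) <= n.
  move=> kq; apply: leq_trans Mn; rewrite /M /moduli leq_mul2l ltnS; apply/orP; right.
  by apply: leq_exp2rw; rewrite leq_mul2r kq orbT.
have T'M x : x \in T' -> x < M by move/(allP T'_lt) => h; apply: leq_trans h m_lt.
have Mn' : M <= n by [].
have [||||||f fF f_inj] := IH q1 ltac:(lia) [seq x <- T' | x < cut];
  rewrite ?filter_uniq ?size_filter ?mono //.
- by lia.
- by lia.
- by apply/allP => x; rewrite mem_filter => /andP[_ /T'M] h; apply: leq_trans h M_q1.
- by apply/allP => x; rewrite mem_filter => /andP[_ /T'M] h; apply: leq_trans h Mn'.
have [||||||g gF g_inj] := IH q2 ltac:(lia) [seq x - cut | x <- [seq x <- T' | cut <= x]];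
  rewrite ?size_map ?size_filter ?mono //.
- by lia.
- by lia.
- rewrite map_inj_in_uniq ?filter_uniq // => x y; rewrite !mem_filter => /andP[? _] /andP[? _].
  by lia.
- apply/allP => y /mapP[x]; rewrite mem_filter => /andP[_ /T'M] h ->.
  by apply: leq_trans _ M_q2; lia.
- apply/allP => y /mapP[x]; rewrite mem_filter => /andP[_ /T'M] h ->.
  by apply: leq_trans _ Mn'; lia.
have cutM : cut < M.+1 by lia.
(* The cut may be as large as [m.+1 <= M], so the base of the encoding is [M.+1] and not [M]. *)
pose i := m * M.+1 + cut.
have i1 : i %/ M.+1 = m by rewrite /i divnMDl // divn_small ?addn0.
have i2 : i %% M.+1 = cut by rewrite /i modnMDl modn_small.
exists (combine l c n q.+2 i (f, g)).
  rewrite familyS // mem_prodmap; apply/allpairsP; exists (i, (f, g)); split=> //.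
    rewrite mem_iota add0n [leqRHS]/= -/M /i.
    apply: (@leq_trans (m.+1 * M.+1)); first by rewrite mulSn addnC ltn_add2r.
    by rewrite leq_mul2r m_lt orbT.
  by rewrite mem_prodmap; apply/allpairsP; exists (f, g).
have f_lt x : nth 0 f x < c * q1 by apply: family_lt fF; lia.
move=> x y xT yT; rewrite /combine !(nth_map 0) ?size_iota ?T_n // !nth_iota ?T_n // !add0n /=.
rewrite -/M i1 i2 -/q1.
have xT' : x %% m.+1 \in T' by apply: map_f.
have yT' : y %% m.+1 \in T' by apply: map_f.
case: ifP => xc; case: ifP => yc e; apply: m_inj => //.
- by apply: f_inj => //; rewrite mem_filter ?xc ?yc.
- by have := f_lt (x %% m.+1); rewrite e ltnNge leq_addr.
- by have := f_lt (y %% m.+1); rewrite -e ltnNge leq_addr.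
- move/negbT: xc; move/negbT: yc; rewrite -!leqNgt => yc xc.
  have gx : x %% m.+1 - cut \in [seq x - cut | x <- [seq x <- T' | cut <= x]].
    by apply: map_f; rewrite mem_filter xT' xc.
  have gy : y %% m.+1 - cut \in [seq x - cut | x <- [seq x <- T' | cut <= x]].
    by apply: map_f; rewrite mem_filter yT' yc.
  by rewrite -(subnK xc) -(subnK yc) (g_inj _ _ gx gy (addnI e)).
Qed.

End Family.

(** * Branching walks and inclusion-exclusion *)

Lemma count_flatten_map A B (P : pred B) (F : A -> seq B) l :
  count P (flatten [seq F a | a <- l]) = \sum_(a <- l) count P (F a).
Proof. by rewrite count_flatten -map_comp sumnE big_map. Qed.

Lemma count_allpairs A B C (P : pred A) (Q : pred B) (R : pred C) f l1 l2 :
  (forall a b, R (f a b) = P a && Q b) ->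
  count R [seq f a b | a <- l1, b <- l2] = count P l1 * count Q l2.
Proof.
move=> RE; elim: l1 => //= a l1 IH; rewrite count_cat IH count_map mulnDl.
congr (_ + _); case Pa: (P a); rewrite ?mul1n ?mul0n.
  by apply: eq_count => b /=; rewrite RE Pa.
by rewrite (eq_count (a2 := pred0)) ?count_pred0 // => b /=; rewrite RE Pa.
Qed.

Section BranchingWalks.

Variables (V : finType) (g : rel V).
Hypothesis g_sym : symmetric g.

Definition closed_nbhd (v u : V) : bool := (u == v) || g v u.

(* A branching walk with [j] leaves is a leaf [v], or a pair of branching walks
   with [j] leaves in total and equal or adjacent roots, rooted as the first one.
   Only the sets of leaves are recorded, each as often as it arises. *)
Definition walk_step (st : seq (V -> seq {set V})) : V -> seq {set V} := fun v =>
  if size st == 0 then [:: [set v]] else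
  flatten [seq [seq A :|: B | A <- nth (fun=> [::]) st i v,
      B <- flatten [seq if closed_nbhd v u then nth (fun=> [::]) st (size st - i.+1) u else [::]
                   | u <- enum V]]
    | i <- iota 0 (size st)].

Definition walk_sets (k : nat) : seq (V -> seq {set V}) :=
  iter k (fun st => walk_step st :: st) [::].

Definition walks (j : nat) : V -> seq {set V} := nth (fun=> [::]) (walk_sets j) 0.

Lemma size_walk_sets k : size (walk_sets k) = k.
Proof. by elim: k => //= k ->. Qed.

Lemma nth_walk_sets k i : i < k -> nth (fun=> [::]) (walk_sets k) i = walks (k - i).
Proof.
elim: k i => // k IH [|i] //= ik; rewrite ?subn0 //.
by rewrite IH // subSS.
Qed.

Lemma walksE j v : 0 < j -> walks j.+1 v =
  flatten [seq [seq A :|: B | A <- walks (j - i) v,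
      B <- flatten [seq if closed_nbhd v u then walks i.+1 u else [::] | u <- enum V]]
    | i <- iota 0 j].
Proof.
move=> j0; rewrite {1}/walks /= /walk_step size_walk_sets.
case: eqP => [j00|_]; first by rewrite j00 in j0.
congr flatten; apply/eq_in_map => i; rewrite mem_iota add0n => ij.
rewrite !nth_walk_sets //; last lia.
by have -> : j - (j - i.+1) = i.+1 by lia.
Qed.

Lemma mem_walks_join j i u v A B : i < j -> closed_nbhd v u ->
  A \in walks (j - i) v -> B \in walks i.+1 u -> A :|: B \in walks j.+1 v.
Proof.
move=> ij vu hA hB; rewrite walksE; last lia.
apply/flatten_mapP; exists i; first by rewrite mem_iota.
apply/allpairsP; exists (A, B); split=> //=.
by apply/flatten_mapP; exists u; rewrite ?mem_enum // vu.
Qed.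

Lemma mem_walksP j v S : 0 < j -> S \in walks j.+1 v ->
  exists i u A B, [/\ i < j, closed_nbhd v u, A \in walks (j - i) v,
    B \in walks i.+1 u & S = A :|: B].
Proof.
move=> j0; rewrite walksE // => /flatten_mapP[i]; rewrite mem_iota add0n => ij.
case/allpairsP => -[A B] /= [hA /flatten_mapP[u _ hB] ->].
by exists i, u, A, B; split=> //; move: hB; case: (closed_nbhd v u).
Qed.

Lemma induced_connect_sym (S : {set V}) : connect_sym (induced g S).
Proof. by apply: sym_connect_sym => a b; rewrite /induced /= g_sym andbCA. Qed.

Lemma connected_inP (S : {set V}) v : v \in S ->
  connected_in g S <-> (forall x, x \in S -> connect (induced g S) v x).
Proof.
move=> vS; split=> [/forall_inP/(_ v vS)/forall_inP h x xS|h]; first exact: h.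
apply/forall_inP => x xS; apply/forall_inP => y yS.
apply: connect_trans (h y yS); rewrite induced_connect_sym; exact: h.
Qed.

Lemma walks_sound j v S : S \in walks j v ->
  [/\ v \in S, #|S| <= j & connected_in g S].
Proof.
elim/ltn_ind: j v S => -[|[|j]] IH v S //.
  rewrite inE => /eqP ->; rewrite set11 cards1; split=> //.
  by apply/(connected_inP (set11 v)) => x /set1P ->; exact: connect0.
case/mem_walksP => // i [u [A [B [ij vu hA hB ->]]]].
have [vA cA nA] := IH (j.+1 - i) ltac:(lia) _ _ hA.
have [uB cB nB] := IH i.+1 ltac:(lia) _ _ hB.
split; first by rewrite inE vA.
  by apply: leq_trans (leq_card_setU _ _) _; lia.
have vAB : v \in A :|: B by rewrite inE vA.
have mono (T : {set V}) : T \subset A :|: B ->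
    subrel (connect (induced g T)) (connect (induced g (A :|: B))).
  move=> /subsetP sub; apply: connect_sub => x y /and3P[xT yT xy].
  by apply: connect1; rewrite /induced /= !sub.
apply/(connected_inP vAB) => x; rewrite inE => /orP[xA|xB].
  by apply: (mono A); [exact: subsetUl | exact: (proj1 (connected_inP vA) nA)].
apply: (@connect_trans _ _ u); last first.
  by apply: (mono B); [exact: subsetUr | exact: (proj1 (connected_inP uB) nB)].
case/orP: vu => [/eqP ->|vu]; first exact: connect0.
by apply: connect1; rewrite /induced /= vAB vu inE uB orbT.
Qed.

(** The new leaf is attached where [w] is a leaf: that leaf becomes a pair of the leaves [w] and
    [u], and the root is unchanged. *)
Lemma walks_insert j v S w u : S \in walks j v -> w \in S -> closed_nbhd w u ->
  u |: S \in walks j.+1 v.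
Proof.
elim/ltn_ind: j v S => -[|[|j]] IH v S //.
  rewrite inE => /eqP -> /set1P -> wu; rewrite setUC.
  by apply: (@mem_walks_join 1 0 u) => //; rewrite inE.
case/mem_walksP => // i [u' [A [B [ij vu hA hB ->]]]]; rewrite inE => /orP[wA|wB] wu.
  rewrite setUA; apply: (@mem_walks_join _ i u') => //; first lia.
  by rewrite subSn ?(ltnW ij) //; apply: (IH (j.+1 - i)) => //; lia.
rewrite setUCA; apply: (@mem_walks_join _ i.+1 u') => //.
by apply: (IH i.+1).
Qed.

(** [S] is grown from [v] by one adjacent vertex at a time. Inserting [v] again and again then
    raises the number of leaves to [j]; this is why equal roots are allowed, and why one value of
    [j] covers all smaller sets. *)
Lemma walks_complete j v (S : {set V}) : v \in S -> connected_in g S -> #|S| <= j -> S \in walks j v.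
Proof.
move=> vS /(connected_inP vS) cS.
have grow m : m < #|S| -> exists S' : {set V},
    [/\ S' \subset S, #|S'| = m.+1 & S' \in walks m.+1 v].
  elim: m => [|m IH] mS.
    by exists [set v]; rewrite sub1set vS cards1 inE.
  have [S' [sub cS' hS']] := IH (ltnW mS).
  have [vS' _ _] := walks_sound hS'.
  have [w [u [wS' uS uS' wu]]] : exists w u, [/\ w \in S', u \in S, u \notin S' & g w u].
    case: (pickP (fun p : V * V => [&& p.1 \in S', p.2 \in S, p.2 \notin S' & g p.1 p.2])).
      by move=> [w u] /and4P[*]; exists w, u.
    move=> none; exfalso.
    have cl : closed (induced g S) (mem S').
      apply: intro_closed; first exact: induced_connect_sym.
      move=> x y /and3P[xS yS xy] xS'; apply: contraT => yS'.
      by have := none (x, y); rewrite /= xS' yS yS' xy.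
    have sub' : S \subset S'.
      by apply/subsetP => x /cS /(closed_connect cl) <-.
    by move: (subset_leq_card sub'); rewrite cS' leqNgt mS.
  exists (u |: S'); split; first by rewrite subUset sub1set uS.
    by rewrite cardsU1 uS' cS'.
  by apply: walks_insert hS' wS' _; rewrite /closed_nbhd wu orbT.
move=> Sj; have S0 : 0 < #|S| by apply/card_gt0P; exists v.
have [S' [sub cS' hS']] := grow #|S|.-1 ltac:(lia).
have SE : S' = S by apply/eqP; rewrite eqEcard sub cS' (prednK S0) leqnn.
move: hS'; rewrite SE prednK // -(subnKC Sj); elim: (j - #|S|) => [|d IH] hS.
  by rewrite addn0.
rewrite addnS; have := @walks_insert _ v S v v (IH hS) vS.
by rewrite /closed_nbhd eqxx => /(_ isT); rewrite (setUidPr _) ?sub1set ?vS.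
Qed.

(** A crude bound with one factor for each of the [2 * j - 1] nodes of a binary tree with [j]
    leaves. Only its logarithm matters, as this governs the number of moduli. *)
Lemma size_walks_le j k v : 0 < j <= k ->
  size (walks j v) <= (#|V| * k).+1 ^ (2 * j).-1.
Proof.
set N := (_ * _).+1; elim/ltn_ind: j v => -[|[|j]] // IH v /andP[_ jk].
rewrite walksE // -count_predT count_flatten_map.
apply: (@leq_trans (\sum_(i <- iota 0 j.+1) #|V| * N ^ (2 * j.+1))).
  rewrite !big_seq; apply: leq_sum => i; rewrite mem_iota add0n => ij.
  rewrite count_predT size_allpairs mulnC -(@count_predT _ (flatten _)) count_flatten_map.
  rewrite big_enum /=.
  have -> : 2 * j.+1 = (2 * i.+1).-1 + (2 * (j.+1 - i)).-1 by lia.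
  rewrite expnD mulnA; apply: leq_mul; last by apply: IH; lia.
  rewrite -sum_nat_const; apply: leq_sum => u _; rewrite count_predT.
  by case: (closed_nbhd v u) => //; apply: IH; lia.
rewrite big_const_seq count_predT size_iota iter_addn_0.
have -> : (2 * j.+2).-1 = (2 * j.+1).+1 by lia.
rewrite expnSr mulnAC [X in X <= _]mulnC leq_mul2l; apply/orP; right.
by apply: leqW; rewrite leq_mul2l (ltnW jk) orbT.
Qed.

End BranchingWalks.

(** * Counting branching walks modulo small numbers *)

Lemma eqmod_sum (I : eqType) (l : seq I) (F G : I -> nat) d :
  (forall i, i \in l -> F i = G i %[mod d]) ->
  \sum_(i <- l) F i = \sum_(i <- l) G i %[mod d].
Proof.
elim: l => [|a l IH] FG; first by rewrite !big_nil.
rewrite !big_cons -modnDm FG ?mem_head // IH ?modnDm // => i il.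
by rewrite FG // inE il orbT.
Qed.

Definition closed_nbhd_sum (nr : nat) (gc : seq bitseq) (p : nat) (row : seq nat) (v : nat) : nat :=
  (\sum_(u <- iota 0 nr)
     (if (u == v) || nth false (nth [::] gc v) u then nth 0 row u else 0)) %% p.+1.

(** The recurrence of [walk_step] for the number of walks all of whose leaves are allowed by [al].
    It is multiplicative because a union is allowed exactly if both parts are. *)
Definition residue_row (nr : nat) (gc : seq bitseq) (al : seq bool) (p : nat)
    (st : seq (seq nat)) : seq nat :=
  [seq (if size st == 0 then (if nth false al v then 1 else 0) %% p.+1 else
     (\sum_(i <- iota 0 (size st)) nth 0 (nth [::] st i) v *
         closed_nbhd_sum nr gc p (nth [::] st (size st - i.+1)) v) %% p.+1)
  | v <- iota 0 nr].

Definition residue_rows nr gc al p k : seq (seq nat) :=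
  iter k (fun st => residue_row nr gc al p st :: st) [::].

Definition walk_count nr gc al p k : nat :=
  (\sum_(v <- iota 0 nr) nth 0 (nth [::] (residue_rows nr gc al p k) 0) v) %% p.+1.

Section WalkCount.

Variables (nr : nat) (gc : seq bitseq) (al : seq bool) (p : nat).
Notation V := 'I_nr.

Definition matrix_rel : rel V := fun u v => nth false (nth [::] gc u) v.

Definition allowed_set (S : {set V}) : bool := [forall r in S, nth false al r].

Lemma allowed_setU A B : allowed_set (A :|: B) = allowed_set A && allowed_set B.
Proof.
apply/forall_inP/andP => [h|[/forall_inP hA /forall_inP hB] x].
  by split; apply/forall_inP => x xS; apply: h; rewrite inE xS ?orbT.
by rewrite inE => /orP[/hA|/hB].
Qed.

Lemma sum_iota_ord (F : nat -> nat) :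
  \sum_(i <- iota 0 nr) F i = \sum_(v <- enum V) F v.
Proof. by rewrite -val_enum_ord big_map. Qed.

Lemma residue_rowsP k i (v : V) : i < k ->
  nth 0 (nth [::] (residue_rows nr gc al p k) i) v =
  count allowed_set (nth (fun=> [::]) (walk_sets matrix_rel k) i v) %% p.+1.
Proof.
elim: k i v => // k IH [|i] v ik; last exact: IH.
have sz : size (residue_rows nr gc al p k) = k by elim: (k) => //= n ->.
rewrite /= /residue_row (nth_map 0) ?size_iota // nth_iota // add0n sz.
rewrite /walk_step size_walk_sets; case: eqP => [k0|_].
  rewrite /= addn0; congr (_ %% _); rewrite /allowed_set.
  case: ifP => h; last first.
    case: forall_inP => // /(_ v (set11 v)); by rewrite h.
  by case: forall_inP => // -[] u /set1P ->.
rewrite count_flatten_map; apply: eqmod_sum => j; rewrite mem_iota add0n => jk.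
rewrite (count_allpairs (P := allowed_set) (Q := allowed_set)); last exact: allowed_setU.
rewrite count_flatten_map IH // modnMml -[in RHS]modnMmr; congr (_ %% _); congr (_ * _).
rewrite /closed_nbhd_sum sum_iota_ord; apply: eqmod_sum => u _.
rewrite /closed_nbhd /matrix_rel -val_eqE /=; case: ifP => _ //.
by rewrite IH ?modn_mod //; lia.
Qed.

Lemma walk_countE k : 0 < k ->
  walk_count nr gc al p k =
  count allowed_set (flatten [seq walks matrix_rel k v | v <- enum V]) %% p.+1.
Proof.
move=> k0; rewrite /walk_count sum_iota_ord count_flatten_map.
by apply: eqmod_sum => v _; rewrite residue_rowsP // modn_mod.
Qed.

End WalkCount.

(** * Inclusion-exclusion over the sets of colours *)

Definition avoids (s : nat) (Y : bitseq) (o : pred nat) : bool :=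
  all (fun i => nth false Y i ==> ~~ o i) (iota 0 s).

Lemma iotaS0 s : iota 0 s.+1 = 0 :: [seq i.+1 | i <- iota 0 s].
Proof. by rewrite /= -[1]addn0 iotaDl; congr (_ :: _); apply: eq_map. Qed.

Lemma count_bitseqsS (P : pred bitseq) s : count P (bitseqs s.+1) =
  count (fun Y => P (false :: Y)) (bitseqs s) + count (fun Y => P (true :: Y)) (bitseqs s).
Proof.
rewrite [bitseqs _]/= prodmapE count_rev /= cats0 count_cat !count_map.
by [].
Qed.

(** The alternating sum over the sets [Y] that [o] avoids, split by parity to stay within [nat]. A
    colour missed by [o] pairs off the sets with and without it; if no colour is missed, the empty
    set alone is left. *)
Lemma inclusion_exclusion s (o : pred nat) :
  count (fun Y => (count id Y %% 2 == 0) && avoids s Y o) (bitseqs s) =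
  count (fun Y => (count id Y %% 2 == 1) && avoids s Y o) (bitseqs s) + all o (iota 0 s).
Proof.
elim: s o => [|s IH] o; first by [].
have av b Y : avoids s.+1 (b :: Y) o = (b ==> ~~ o 0) && avoids s Y (fun i => o i.+1).
  by rewrite /avoids iotaS0 /= all_map; congr andb; apply: eq_all.
have E r : count (fun Y => (count id Y %% 2 == r) && avoids s.+1 Y o) (bitseqs s.+1) =
    count (fun Y => (count id Y %% 2 == r) && avoids s Y (fun i => o i.+1)) (bitseqs s)
    + count (fun Y => ((count id Y).+1 %% 2 == r) && (~~ o 0 && avoids s Y (fun i => o i.+1))) (bitseqs s).
  rewrite count_bitseqsS; congr (_ + _); apply: eq_count => Y; by rewrite av.
rewrite !E iotaS0 /= all_map (eq_all (a2 := fun i => o i.+1)) //.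
have := IH (fun i => o i.+1).
set a := count _ _ => ->.
have sw r r' : (forall n, (n.+1 %% 2 == r) = (n %% 2 == r')) ->
    count (fun Y => ((count id Y).+1 %% 2 == r) && (~~ o 0 && avoids s Y (fun i => o i.+1))) (bitseqs s)
    = if o 0 then 0 else count (fun Y => (count id Y %% 2 == r') && avoids s Y (fun i => o i.+1)) (bitseqs s).
  move=> e; case: (o 0); first by rewrite (eq_count (a2 := pred0)) ?count_pred0 // => Y /=; rewrite andbF.
  by apply: eq_count => Y; rewrite e.
rewrite (sw 0 1) ?(sw 1 0); [ | by move=> n; rewrite !modn2 /=; case: (odd n) ..].
rewrite -/a; case: (o 0); first by rewrite !addn0.
have -> : a = count (fun Y => (count id Y %% 2 == 1) && avoids s Y (fun i => o i.+1)) (bitseqs s)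
  + all (fun i => o i.+1) (iota 0 s) by exact: IH.
by rewrite /= addn0; lia.
Qed.

Lemma inclusion_exclusion_seq (T : Type) s (o : T -> pred nat) (O : seq T) (w : bitseq -> nat) :
  (forall Y, Y \in bitseqs s -> w Y = count (fun x => avoids s Y (o x)) O) ->
  \sum_(Y <- bitseqs s) (if count id Y %% 2 == 0 then w Y else 0) =
  \sum_(Y <- bitseqs s) (if count id Y %% 2 == 1 then w Y else 0)
  + count (fun x => all (o x) (iota 0 s)) O.
Proof.
move=> wE.
have E r : \sum_(Y <- bitseqs s) (if count id Y %% 2 == r then w Y else 0) =
    \sum_(x <- O) count (fun Y => (count id Y %% 2 == r) && avoids s Y (o x)) (bitseqs s).
  transitivity (\sum_(Y <- bitseqs s) \sum_(x <- O)
      ((count id Y %% 2 == r) && avoids s Y (o x) : nat)).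
    apply: eq_big_seq => Y /wE ->; case: eqP => _ /=; last by rewrite big1_eq.
    by rewrite -sum1_count big_mkcond.
  rewrite exchange_big; apply: eq_bigr => x _.
  by rewrite -sum1_count [RHS]big_mkcond.
rewrite !E (eq_bigr _ (fun x _ => inclusion_exclusion s (o x))) big_split /=.
by congr (_ + _); rewrite -sum1_count [RHS]big_mkcond.
Qed.

Lemma mem_sequences c n s : (s \in sequences c n) = (size s == n) && all (fun a => a < c) s.
Proof.
elim: n s => [|n IH] [|a s] //=.
  by apply/allpairsP => -[[? ?] []].
rewrite eqSS andbCA -IH; apply/allpairsP/andP => [[[b t] /= [+ ? [-> ->]]] //|[ac sn]].
  by rewrite mem_iota.
by exists (a, s); rewrite mem_iota.
Qed.

Lemma count_avoiding_sequences Y e :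
  count (all (fun a => ~~ nth false Y a)) (sequences (size Y) e) = count negb Y ^ e.
Proof.
elim: e => //= e IH; rewrite count_allpairs_cons.
rewrite (eq_bigr (fun a => (~~ nth false Y a : nat) * count negb Y ^ e)); last first.
  move=> a _; rewrite -IH; case Ya: (nth false Y a) => /=; last first.
    by rewrite mul1n; apply: eq_count => t /=; rewrite Ya.
  by rewrite mul0n (eq_count (a2 := pred0)) ?count_pred0 // => t /=; rewrite Ya.
rewrite -big_distrl expnS /=; congr (_ * _).
rewrite -[in RHS](mkseq_nth false Y) /mkseq count_map -sum1_count [RHS]big_mkcond.
by apply: eq_bigr => a _ /=; case: (nth false Y a).
Qed.

(* Counts modulo [p.+1] the walks with [e] jokers that avoid the colours of some
   [Y] of parity [r]; jokers reduce seeing [s - e] colours to seeing all [s]. *)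
Definition parity_sum nr nb gc gv k s e (h : seq nat) (p r : nat) : nat :=
  (\sum_(Y <- bitseqs s) (if count id Y %% 2 == r then
     (walk_count nr gc
        [seq all (fun b => nth false (nth [::] gv v) b ==> ~~ nth false Y (nth 0 h b)) (iota 0 nb)
        | v <- iota 0 nr] p k * count negb Y ^ e) %% p.+1
   else 0)) %% p.+1.

Section Coverage.

Variables (nr nb : nat) (gc gv : seq bitseq) (k s e : nat) (h : seq nat).
Notation V := 'I_nr.
Hypothesis k0 : 0 < k.

Definition hits (S : {set V}) (x : nat) : bool :=
  [exists r in S, has (fun b => nth false (nth [::] gv r) b && (nth 0 h b == x)) (iota 0 nb)].

(** The jokers form a sequence rather than a set, so that those avoiding [Y] number a plain power,
    which factors out of the count. *)
Definition walk_jokers : seq ({set V} * seq nat) :=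
  [seq (A, J) | A <- flatten [seq walks (matrix_rel gc) k v | v <- enum V],
                J <- sequences s e].

Definition seen (x : {set V} * seq nat) (i : nat) : bool := hits x.1 i || (i \in x.2).

Definition covered (x : {set V} * seq nat) : bool := all (seen x) (iota 0 s).

(** By inclusion-exclusion the two sums, before reduction, differ by exactly the number of covered
    pairs of a walk and jokers. *)
Lemma parity_sumP p : (parity_sum nr nb gc gv k s e h p 0 ==
   parity_sum nr nb gc gv k s e h p 1) = (p.+1 %| count covered walk_jokers).
Proof.
pose al Y := [seq all (fun b => nth false (nth [::] gv v) b ==> ~~ nth false Y (nth 0 h b)) (iota 0 nb)
        | v <- iota 0 nr].
pose w (Y : bitseq) := count (allowed_set (al Y)) (flatten [seq walks (matrix_rel gc) k v | v <- enum V])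
   * count negb Y ^ e.
have E r : parity_sum nr nb gc gv k s e h p r =
    (\sum_(Y <- bitseqs s) (if count id Y %% 2 == r then w Y else 0)) %% p.+1.
  rewrite /parity_sum; apply: eqmod_sum => Y _; case: ifP => // _.
  by rewrite modn_mod walk_countE // modnMml.
have wE Y : Y \in bitseqs s ->
    w Y = count (fun x => avoids s Y (seen x)) walk_jokers.
  rewrite mem_bitseqs => /eqP sY.
  rewrite (@count_allpairs _ _ _ (allowed_set (al Y)) (all (fun a => ~~ nth false Y a))).
    by rewrite /w -sY count_avoiding_sequences.
  move=> S J /=.
  (* Colours from [s] on belong to no [Y], by the default value [false]. *)
  have Ylt i : nth false Y i -> i < s.
    by rewrite -sY ltnNge; apply: contraL => /(nth_default false) ->.
  have alE (r : V) : nth false (al Y) r =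
     all (fun b => nth false (nth [::] gv r) b ==> ~~ nth false Y (nth 0 h b)) (iota 0 nb).
    by rewrite (nth_map 0) ?size_iota // nth_iota.
  apply/allP/andP => [hh|[/forall_inP hS /allP hJ] i _].
    split.
      apply/forall_inP => r rS; rewrite alE; apply/allP => b bn.
      apply/implyP => cov; apply/negP => Yb.
      have := hh (nth 0 h b); rewrite mem_iota Ylt // Yb => /(_ isT); rewrite negb_or /=.
      case/andP => /negP nh _; apply: nh; apply/existsP; exists r; rewrite rS.
      by apply/hasP; exists b; rewrite ?cov ?eqxx.
    apply/allP => a aJ; apply/negP => Ya.
    by have := hh a; rewrite mem_iota Ylt // Ya /seen aJ orbT => /(_ isT).
  apply/implyP => Yi; rewrite /seen negb_or; apply/andP; split; last first.
    by apply/negP => /hJ; rewrite Yi.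
  apply/negP => /existsP[r /andP[rS /hasP[b bn /andP[cov /eqP hb]]]].
  have := hS r rS; rewrite alE => /allP/(_ b bn); by rewrite cov hb Yi.
rewrite !E (inclusion_exclusion_seq wE) eqn_mod_dvd ?leq_addr // addKn.
by [].
Qed.

Lemma size_walk_jokers_lt : k <= nr -> e <= s ->
  count covered walk_jokers < 2 ^ (nr + (nr * k).+1 * (2 * k) + s * s).
Proof.
move=> knr es; apply: leq_ltn_trans (count_size _ _) _.
rewrite size_allpairs size_sequences.
have le1 : size (flatten [seq walks (matrix_rel gc) k v | v <- enum V]) <=
    nr * (nr * k).+1 ^ (2 * k).
  rewrite -count_predT count_flatten_map big_enum /=.
  rewrite -[X in _ <= X * _]card_ord -sum_nat_const; apply: leq_sum => v _.
  rewrite count_predT; apply: leq_trans (size_walks_le _ (k := k) _ _) _; first by rewrite k0 /=.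
  by rewrite card_ord leq_pexp2l // leq_pred.
apply: leq_ltn_trans (leq_mul le1 (leqnn _)) _.
have exp_lt a b : a ^ b <= 2 ^ (a * b).
  by rewrite expnM; apply: leq_exp2rw; apply: ltnW; exact: ltn_expl.
rewrite (expnD 2 (nr + _)) (expnD 2 nr) -!mulnA.
have le2 : (nr * k).+1 ^ (2 * k) * s ^ e <= 2 ^ ((nr * k).+1 * (2 * k)) * 2 ^ (s * s).
  apply: leq_mul; first exact: exp_lt.
  by apply: leq_trans (exp_lt _ _) _; rewrite leq_exp2l // leq_mul2l es orbT.
apply: leq_ltn_trans (leq_mul (leqnn _) le2) _.
by rewrite ltn_mul2r ltn_expl // muln_gt0 !expn_gt0.
Qed.

(** A neighbour and a joker account for one colour each, whatever the table [h] is; hence a positive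
    count is conclusive for every member of the family. *)
Lemma covered_card x : x \in walk_jokers -> covered x ->
  s <= #|[set b : 'I_nb | [exists r in x.1, nth false (nth [::] gv r) b]]| + e.
Proof.
case/allpairsP => -[S J] /= [_ hJ ->] /allP cov.
set N := [set b | _].
move: hJ; rewrite mem_sequences => /andP[/eqP <- _].
rewrite -(size_iota 0 s).
have -> : #|N| = size [seq nth 0 h (val b) | b <- enum N] by rewrite size_map cardE.
rewrite -size_cat; apply: uniq_leq_size; first exact: iota_uniq.
move=> i /cov /orP[/= /existsP[r /andP[rS /hasP[b]]]|iJ]; last by rewrite mem_cat iJ orbT.
rewrite mem_iota add0n => bn /andP[cv /eqP <-]; rewrite mem_cat; apply/orP; left.
apply/mapP; exists (Ordinal bn) => //; rewrite mem_enum inE.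
by apply/existsP; exists r; rewrite rS.
Qed.

Lemma exists_covered (S : {set V}) v (T : seq nat) :
  symmetric (matrix_rel gc (nr := nr)) ->
  v \in S -> connected_in (matrix_rel gc) S -> #|S| <= k ->
  uniq T -> size T + e = s -> {in T &, injective (nth 0 h)} ->
  (forall b, b \in T -> nth 0 h b < s) ->
  (forall b, b \in T -> b < nb /\ exists2 r : V, r \in S & nth false (nth [::] gv r) b) ->
  0 < count covered walk_jokers.
Proof.
move=> sym vS cS Sk uT sT injT h_lt covT.
(* The jokers take the colours that [T] leaves out; as [h] is injective on [T], these are exactly
   [e] many. *)
pose J := [seq i <- iota 0 s | i \notin [seq nth 0 h b | b <- T]].
have sJ : size J = e.
  have /perm_size : perm_eq [seq nth 0 h b | b <- T]
      [seq i <- iota 0 s | i \in [seq nth 0 h b | b <- T]].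
    apply: uniq_perm; rewrite ?map_inj_in_uniq ?filter_uniq ?iota_uniq //.
    move=> i; rewrite mem_filter mem_iota andb_idr //.
    by case/mapP => b bT ->; rewrite h_lt.
  rewrite size_map size_filter /J size_filter => e1.
  have := count_predC (fun i => i \in [seq nth 0 h b | b <- T]) (iota 0 s).
  rewrite size_iota -e1 => e2.
  apply/eqP; rewrite -(eqn_add2l (size T)) sT -[X in _ == X]e2; apply/eqP; congr (_ + _).
rewrite -has_count; apply/hasP; exists (S, J).
  apply/allpairsP; exists (S, J); split=> //=.
    by apply/flatten_mapP; exists v; rewrite ?mem_enum // walks_complete.
  rewrite mem_sequences sJ eqxx /=; apply/allP => a.
  by rewrite mem_filter mem_iota => /and3P[].
apply/allP => i i_s; rewrite /seen /= mem_filter i_s andbT.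
case: (boolP (i \in _)) => [/mapP[b bT ->]|]; rewrite ?orbT // orbF.
have [bn [r rS cv]] := covT b bT.
apply/existsP; exists r; rewrite rS; apply/hasP; exists b; first by rewrite mem_iota.
by rewrite cv eqxx.
Qed.

End Coverage.

(** * The algorithm and its running time *)

Lemma polytime_expn X (eX : encodable X) (f : X -> nat) n :
  polytime f -> polytime (fun x => f x ^ n).
Proof.
move=> pf; elim: n => [|n IH].
  by apply: (polytime_ext (f := fun=> 1)) => [x|]; [rewrite expn0 | solve_polytime].
apply: (polytime_ext (f := fun x => f x * f x ^ n)); last solve_polytime.
by move=> x; rewrite expnS.
Qed.

Lemma sz_nat_seq_le p (l : seq nat) : all (fun a => a <= p) l ->
  sz l <= size l * (2 * p + 2) + 1.
Proof.
elim: l => [|a l IH] /= => [_|/andP[ap /IH]]; first by rewrite sz_nil.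
by rewrite sz_cons sz_nat mulSn; lia.
Qed.

Lemma polytime_closed_nbhd_sum X (eX : encodable X) (nr p v : X -> nat)
    (gc : X -> seq bitseq) (row : X -> seq nat) :
  polytime nr -> polytime p -> polytime gc -> polytime row -> polytime v ->
  polytime (fun x => closed_nbhd_sum (nr x) (gc x) (p x) (row x) (v x)).
Proof. by move=> pnr pp pgc prow pv; rewrite /closed_nbhd_sum; solve_polytime. Qed.

Lemma polytime_residue_rows X (eX : encodable X) (nr p k : X -> nat)
    (gc : X -> seq bitseq) (al : X -> bitseq) :
  polytime nr -> polytime p -> polytime k -> polytime gc -> polytime al ->
  polytime (fun x => residue_rows (nr x) (gc x) (al x) (p x) (k x)).
Proof.
move=> pnr pp pk pgc pal.
pose R (x : X) := nr x * (2 * p x + 2) + 2.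
have row_le x st : sz (residue_row (nr x) (gc x) (al x) (p x) st) < R x.
  rewrite /R addn2 ltnS -[X in X * _](size_iota 0) -(size_map (fun v : nat =>
     nth 0 (residue_row (nr x) (gc x) (al x) (p x) st) v)).
  apply: leq_trans (sz_nat_seq_le (p := p x) _) _; last first.
    by rewrite !size_map addn1.
  by apply/allP => _ /mapP[v _ ->]; case: ifP => _; rewrite -ltnS ltn_mod.
apply: (polytime_iter (P := fun x s j => sz s + j * R x <= k x * R x + 1)
  (b := fun x => k x * R x + 1)).
- solve_polytime.
- solve_polytime.
- apply: polytime_cons; last solve_polytime.
  rewrite /residue_row.
  apply: polytime_map; first solve_polytime.
  apply: polytime_if; [solve_polytime | solve_polytime |].
  apply: polytime_sum_modn; [solve_polytime | | solve_polytime].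
  apply: polytime_muln; first solve_polytime.
  by apply: polytime_closed_nbhd_sum; solve_polytime.
- by rewrite /R; solve_polyb.
- by move=> x; rewrite sz_nil addnC.
- move=> x s j; rewrite sz_cons mulSn; have := row_le x s.
  by move: (R x) (k x * _) (j * _) => r u v; lia.
- by move=> x s j; apply: leq_trans; rewrite leq_addr.
Qed.

Lemma polytime_walk_count X (eX : encodable X) (nr p k : X -> nat)
    (gc : X -> seq bitseq) (al : X -> bitseq) :
  polytime nr -> polytime p -> polytime k -> polytime gc -> polytime al ->
  polytime (fun x => walk_count (nr x) (gc x) (al x) (p x) (k x)).
Proof.
move=> pnr pp pk pgc pal; rewrite /walk_count.
apply: polytime_sum_modn; [solve_polytime | | solve_polytime].
apply: polytime_nth; last solve_polytime.
apply: polytime_nth; last solve_polytime.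
by apply: polytime_residue_rows; solve_polytime.
Qed.

Definition ceil_log (n : nat) : nat :=
  (iter n (fun s => if s.1 < n then (s.1 + s.1, s.2.+1) else s) (1, 0)).2.

(** The lower bound lets the numbers below [n] fit into that many bits; the upper bound keeps every
    exponential in this logarithm polynomial in [n]. *)
Lemma ceil_logP n : n <= 2 ^ ceil_log n <= (2 * n).+1.
Proof.
rewrite /ceil_log; set f := fun s => _.
have inv k : let s := iter k f (1, 0) in
    [/\ s.1 = 2 ^ s.2, s.1 <= (2 * n).+1 & (n <= s.1) || (s.2 == k)].
  elim: k => [|k]; first by split=> //; rewrite eqxx orbT.
  rewrite iterS; move: (iter k f _) => [a b] /= [h1 h2 h3].
  rewrite /f /=; case: ltnP => h /=; last by rewrite h.
  split; [by rewrite expnS mul2n -addnn h1 | by lia |].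
  by move: h3; rewrite leqNgt h /= => /eqP ->; rewrite eqxx orbT.
have [h1 h2 h3] := inv n; rewrite -h1 h2 andbT.
by case/orP: h3 => // /eqP e; rewrite h1 e ltnW // ltn_expl.
Qed.

Lemma polytime_ceil_log X (eX : encodable X) (n : X -> nat) :
  polytime n -> polytime (fun x => ceil_log (n x)).
Proof.
move=> pn; rewrite /ceil_log; apply: polytime_snd.
apply: (polytime_iter (P := fun x s j => s.1 <= (2 * n x).+1 /\ s.2 + j <= n x)
  (b := fun x => 6 * n x + 6)).
- solve_polytime.
- solve_polytime.
- solve_polytime.
- solve_polyb.
- by [].
- by move=> x [a b] j /= []; case: ifP => /=; lia.
- by move=> x [a b] j /= []; rewrite sz_pair !sz_nat; lia.
Qed.

(** The final [unit] makes the encoding of a tuple agree with that of a list of its components, as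
    required by [pcrbds_enc]. *)
Definition instance : Type :=
  nat * (nat * (seq bitseq * (seq bitseq * (bitseq * (bitseq * unit))))).

Section Algorithm.

Variables (l c : nat) (F : seq table).

Implicit Type x : instance.

Definition num_R x : nat := x.1.
Definition num_B x : nat := x.2.1.
Definition conn_mx x : seq bitseq := x.2.2.1.
Definition cov_mx x : seq bitseq := x.2.2.2.1.
(* Truncation keeps the unary representations polynomial. *)
Definition size_bound x : nat := minn (num_R x) (bits_value x.2.2.2.2.1).
(** The cap is one more than the size of B, so that a target beyond all of B remains out of
    reach. *)
Definition goal x : nat := minn (num_B x).+1 (bits_value x.2.2.2.2.2.1).
(** The divisor is [l], written as a successor to match [polytime_divn]; the final successor rounds
    up. *)
Definition num_blocks x : nat := ((goal x + ceil_log (num_B x)) %/ l.-1.+1).+1.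
Definition num_colours x : nat := c * num_blocks x.
Definition num_jokers x : nat := num_colours x - goal x.
(** Tables are indexed by elements of B at the top of the recursion and by residues below it. *)
Definition table_size x : nat := num_B x + moduli (num_blocks x * l).
(** Twice the exponent in [size_walk_jokers_lt], as [exp2_le_common_multiple] demands. *)
Definition num_moduli x : nat :=
  2 * (num_R x + (num_R x * size_bound x).+1 * (2 * size_bound x)
       + num_colours x * num_colours x).

(** Goal 0 is met by the empty set, which is not the leaf set of any branching walk and is therefore
    treated apart. *)
Definition decide x : bool :=
  (goal x == 0) ||
  has (fun h => has (fun p =>
      parity_sum (num_R x) (num_B x) (conn_mx x) (cov_mx x) (size_bound x)
        (num_colours x) (num_jokers x) h p 0
      != parity_sum (num_R x) (num_B x) (conn_mx x) (cov_mx x) (size_bound x)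
        (num_colours x) (num_jokers x) h p 1) (iota 0 (num_moduli x)))
    (hash_family l c (table_size x) F (num_blocks x)).

End Algorithm.

Lemma polytime_moduli X (eX : encodable X) (f : X -> nat) :
  polytime f -> polytime (fun x => moduli (f x)).
Proof. move=> pf; rewrite /moduli; apply: polytime_muln; first solve_polytime.
by apply: polytime_succ; apply: polytime_expn. Qed.

Ltac pt_parameters :=
  lazymatch goal with
  | |- polytime (fun x => @?f x ^ ?n) => apply (polytime_expn (f := f))
  | |- polytime (fun x => moduli (@?f x)) => apply (polytime_moduli (f := f))
  | |- polytime (fun x => minn (@?n x) (bits_value (@?s x))) =>
      apply (polytime_minn_bits (n := n) (s := s))
  | |- polytime (fun x => ceil_log (@?n x)) => apply (polytime_ceil_log (n := n))
  end.
Ltac pt_user ::=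
  first [pt_parameters | pt_lists | pt_division | pt_product | pt_sum | pt_basic].

Lemma polytime_num_R : polytime num_R. Proof. by rewrite /num_R; solve_polytime. Qed.
Lemma polytime_num_B : polytime num_B. Proof. by rewrite /num_B; solve_polytime. Qed.
Lemma polytime_conn_mx : polytime conn_mx. Proof. by rewrite /conn_mx; solve_polytime. Qed.
Lemma polytime_cov_mx : polytime cov_mx. Proof. by rewrite /cov_mx; solve_polytime. Qed.

Lemma polytime_size_bound : polytime size_bound.
Proof. by have ? := polytime_num_R; rewrite /size_bound; solve_polytime. Qed.

Lemma polytime_goal : polytime goal.
Proof. by have ? := polytime_num_B; rewrite /goal; solve_polytime. Qed.

Lemma polytime_num_blocks l : polytime (num_blocks l).
Proof.
by have ? := polytime_num_B; have ? := polytime_goal; rewrite /num_blocks; solve_polytime.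
Qed.

Lemma polytime_num_colours l c : polytime (num_colours l c).
Proof. by have ? := polytime_num_blocks l; rewrite /num_colours; solve_polytime. Qed.

Lemma polytime_num_jokers l c : polytime (num_jokers l c).
Proof.
by have ? := polytime_num_colours l c; have ? := polytime_goal; rewrite /num_jokers; solve_polytime.
Qed.

Lemma polytime_table_size l : polytime (table_size l).
Proof.
have ? := polytime_num_blocks l; have ? := polytime_num_B.
by rewrite /table_size; solve_polytime.
Qed.

Lemma polytime_num_moduli l c : polytime (num_moduli l c).
Proof.
have ? := polytime_num_colours l c; have ? := polytime_num_R.
by have ? := polytime_size_bound; rewrite /num_moduli; solve_polytime.
Qed.

Lemma polytime_combine X (eX : encodable X) l c (n q i : X -> nat) (fg : X -> table * table) :
  polytime n -> polytime q -> polytime i -> polytime fg ->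
  polytime (fun x => combine l c (n x) (q x) (i x) (fg x)).
Proof.
move=> pn pq pi pfg; rewrite /combine.
by solve_polytime.
Qed.

(** The time depends on the index alone, unlike in [polytime_nth]; it is applied to the list of
    families, whose size must not enter. *)
Lemma timed_nth A (eA : encodable A) (a0 : A) :
  timed (fun z : seq A * nat => nth a0 z.1 z.2) (fun z => z.2).
Proof.
pose hd (z : seq A * nat) :=
  if foldl (fun s (_ : unit) => behead s) z.1 (nseq z.2 tt) is a :: _ then a else a0.
apply: (timed_ext (f := hd)).
  move=> [s n]; congr encode; rewrite /hd /=.
  by elim: n s => [|n IH] [|a s] //=; rewrite IH ?nth_nil.
apply: timed_le (timed_case (f := fun z => z.2.1) (g := fun=> a0)
  (timed_foldl (P := fun _ _ _ => True) (f := fun _ s (_ : unit) => behead s)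
    (b := fun=> 0) (tf := fun=> 0) (tl := fun=> 0) (ti := fun=> 0) _ _ _ _ _)
  (tf := fun=> 0) (tg := fun=> 0) _ _) _.
- by apply: (timed_expr (e := ETl (EVar 0))) => s z /= ->; rewrite encode_nseq.
- by apply: (timed_expr (e := EHd (EVar 0))) => s z /= ->.
- apply: (timed_expr (e := ETl (EHd (ETl (EVar 0))))) => s z /= ->.
  by case: z => x [[|a t] u].
- by [].
- by [].
- by apply: (timed_expr (e := EHd (ETl (EVar 0)))) => s z /= ->.
- exact: timed_const.
- by move=> [s n] /=; rewrite size_nseq; case: (foldl _ _ _); lia.
Qed.

Lemma timed_prodmap_max A B C X (eA : encodable A) (eB : encodable B)
    (eC : encodable C) (eX : encodable X) (l1 : X -> seq A) (l2 : X -> seq B)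
    (f : X -> A -> B -> C) t1 t2 t :
  timed l1 t1 -> timed l2 t2 ->
  timed (fun z : X * (A * B) => f z.1 z.2.1 z.2.2) t ->
  timed (fun x => prodmap (f x) (l1 x) (l2 x))
    (fun x => t1 x + t2 x + size (l1 x) * (size (l2 x) *
       (\max_(a <- l1 x) \max_(b <- l2 x) t (x, (a, b))).+1).+1).
Proof.
move=> T1 T2 T; apply: timed_prodmap => //; [exact: T|] => x a b ha hb /=.
apply: leq_trans (@In_bigmax _ (fun a => \max_(b <- l2 x) t (x, (a, b))) _ _ ha).
exact: (@In_bigmax _ (fun b => t (x, (a, b)))).
Qed.

Lemma In_mem (T : eqType) (x : T) s : List.In x s -> x \in s.
Proof. by elim: s => //= y s IH [->|/IH h]; rewrite inE ?eqxx // h orbT. Qed.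

(** The relation [f = O*(E)], for an [E] that may be exponential. *)
Definition bounded_by A {eA : encodable A} (E f : A -> nat) : Prop :=
  exists d, forall a, f a <= E a * (sz a).+1 ^ d.

Section BoundedBy.

Context {A : Type} {eA : encodable A}.
Implicit Types E f g : A -> nat.

Lemma bounded_by_le E f g : bounded_by E g -> (forall a, f a <= g a) -> bounded_by E f.
Proof. by move=> [d H] le; exists d => a; apply: leq_trans (le a) (H a). Qed.

Lemma bounded_by_mul E1 E2 f g : bounded_by E1 f -> bounded_by E2 g ->
  bounded_by (fun a => E1 a * E2 a) (fun a => f a * g a).
Proof.
by move=> [d H] [e K]; exists (d + e) => a; rewrite expnD mulnACA leq_mul.
Qed.

Lemma bounded_by_weaken E1 E2 f : bounded_by E1 f -> (forall a, E1 a <= E2 a) ->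
  bounded_by E2 f.
Proof. by move=> [d H] le; exists d => a; apply: leq_trans (H a) _; rewrite leq_mul. Qed.

Lemma bounded_by_polyb E f : (forall a, 0 < E a) -> polyb f -> bounded_by E f.
Proof. by move=> E0 [d H]; exists d => a; apply: leq_trans (H a) _; rewrite leq_pmull. Qed.

Lemma bounded_by_add E f g : bounded_by E f -> bounded_by E g ->
  bounded_by E (fun a => f a + g a).
Proof.
move=> [d H] [e K].
have [r L] : polyb (fun a : A => (sz a).+1 ^ d + (sz a).+1 ^ e).
  by apply: polyb_add; [exists d | exists e].
exists r => a; apply: leq_trans (leq_add (H a) (K a)) _.
by rewrite -mulnDr leq_mul.
Qed.

Lemma bounded_by_poly E f g : polyb g -> bounded_by E f ->
  bounded_by E (fun a => g a * f a).
Proof.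
move=> pg pf; apply: bounded_by_weaken (bounded_by_mul (E1 := fun=> 1) _ pf) _.
  exact: bounded_by_polyb.
by move=> a; rewrite mul1n.
Qed.

End BoundedBy.

(** [family_step] with the length of [st] read off the loop counter as [i.+1], so that the
    parameters are computed without touching the huge list. *)
Definition family_step_at (l c n i : nat) (st : seq (seq table)) : seq table :=
  prodmap (combine l c n i.+2) (iota 0 (moduli (i.+2 * l) * (moduli (i.+2 * l)).+1))
    (prodmap pair (nth [::] st (i.+1 - i.+3 %/ 2)) (nth [::] st (i.+1 - i.+2 %/ 2))).

Lemma families_foldl l c n F k : families l c n F k =
  foldl (fun st i => family_step_at l c n i st :: st) [:: family1 l n F] (iota 0 k).
Proof.
elim: k => // k IH.
have -> : iota 0 k.+1 = rcons (iota 0 k) k by rewrite -addn1 iotaD cats1.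
rewrite foldl_rcons -IH /=; congr (_ :: _); rewrite /family_step /family_step_at.
by rewrite size_families.
Qed.

Section FamilyTime.

Variables (l c Z : nat) (F : seq table).
Hypotheses (c0 : 0 < c) (Z0 : 0 < Z) (F_lt : forall f x, f \in F -> nth 0 f x < c).
Hypothesis family_le : forall n q, 0 < q -> size (hash_family l c n F q) <= Z ^ q.

Lemma hash_family_sz n q h : 0 < q -> h \in hash_family l c n F q ->
  sz h <= n * (2 * (c * q) + 2) + 1.
Proof.
move=> q0 hF; have sh : size h = n.
  case: q q0 hF => [|[|q]] // _.
    rewrite /hash_family /= mem_prodmap => /allpairsP[[m f] [_ _ ->]].
    by rewrite size_map size_iota.
  rewrite familyS // mem_prodmap => /allpairsP[[m f] [_ _ ->]].
  by rewrite size_map size_iota.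
rewrite -sh; apply: sz_nat_seq_le; apply/(all_nthP 0) => i _.
by apply: ltnW; apply: family_lt hF.
Qed.

Lemma timed_family_step : exists2 t,
  timed (fun z : instance * (seq (seq table) * nat) =>
    family_step_at l c (table_size l z.1) z.2.2 z.2.1) t &
  exists2 b : instance -> nat, bounded_by (fun x => Z ^ num_blocks l x) b &
    forall x i, i.+1 < num_blocks l x ->
      t (x, (families l c (table_size l x) F i, i)) <= b x.
Proof.
have pts := polytime_table_size l; have pnb := polytime_num_blocks l.
have [d1 T1] : exists d, timed (fun z : instance * (seq (seq table) * nat) =>
    iota 0 (moduli (z.2.2.+2 * l) * (moduli (z.2.2.+2 * l)).+1))
    (fun z => (sz z.2.2).+1 ^ d).
  have [d T] : exists d, timed (fun i : nat =>
      iota 0 (moduli (i.+2 * l) * (moduli (i.+2 * l)).+1)) (fun i => (sz i).+1 ^ d).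
    by apply: polytime_timed; solve_polytime.
  exists d; apply: timed_le (timed_comp (f := fun z : instance * (seq (seq table) * nat) => z.2.2)
    (tf := fun=> 0) _ T) _ => //.
  by apply: (timed_expr (e := ETl (ETl (EVar 0)))) => s z /= ->.
have TH (g : nat -> nat) : polytime g -> exists d,
    timed (fun z : instance * (seq (seq table) * nat) => nth [::] z.2.1 (g z.2.2))
      (fun z => (sz z.2.2).+1 ^ d).
  move=> pg; have [d T] := polytime_timed pg; have [e ge] := polytime_polyb pg.
  have [r re] : polyb (fun i : nat => (sz i).+1 ^ d + (sz i).+1 ^ e).
    by apply: polyb_add; [exists d | exists e].
  exists r.
  have Tz : timed (fun z : instance * (seq (seq table) * nat) => (z.2.1, g z.2.2))
      (fun z => 0 + (0 + (sz z.2.2).+1 ^ d)).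
    apply: timed_pair; first by apply: (timed_expr (e := EHd (ETl (EVar 0)))) => s z /= ->.
    apply: timed_comp T.
    by apply: (timed_expr (e := ETl (ETl (EVar 0)))) => s z /= ->.
  apply: timed_le (timed_comp Tz (timed_nth _ ([::] : seq table))) _ => z /=.
  by apply: leq_trans (re z.2.2); rewrite !add0n leq_add2l.
have [d2 T2] := TH (fun i => i.+1 - i.+3 %/ 2) ltac:(solve_polytime).
have [d3 T3] := TH (fun i => i.+1 - i.+2 %/ 2) ltac:(solve_polytime).
have Tpair : timed (fun z : (instance * (seq (seq table) * nat)) * (table * table) =>
    (z.2.1, z.2.2)) (fun=> 0).
  by apply: (timed_expr (e := ETl (EVar 0))) => s z /= ->.
have Tp := timed_prodmap_max (f := fun _ => pair) T2 T3 Tpair.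
(* The list of families is dropped from the context before [combine] is run, so that the polynomial
   bound refers to small data only. *)
have [d4 T4] : exists d, timed (fun z : (instance * (seq (seq table) * nat)) * (nat * (table * table)) =>
    combine l c (table_size l z.1.1) z.1.2.2.+2 z.2.1 z.2.2)
    (fun z => (sz (z.1.1, (z.1.2.2, z.2))).+1 ^ d).
  have [d T] : exists d, timed (fun z : instance * (nat * (nat * (table * table))) =>
      combine l c (table_size l z.1) z.2.1.+2 z.2.2.1 z.2.2.2) (fun z => (sz z).+1 ^ d).
    by apply: polytime_timed; apply: polytime_combine; solve_polytime.
  exists d; apply: timed_le (timed_comp (f := fun z : (instance * (seq (seq table) * nat)) *
    (nat * (table * table)) => (z.1.1, (z.1.2.2, z.2))) (tf := fun=> 0) _ T) _ => //.
  apply: (timed_expr (e := ENode (EHd (EHd (EVar 0)))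
    (ENode (ETl (ETl (EHd (EVar 0)))) (ETl (EVar 0))))) => s z /= ->.
  by [].
have T := timed_prodmap_max T1 Tp
  (f := fun z => combine l c (table_size l z.1) z.2.2.+2) T4.
eexists; first exact: T.
pose q x := num_blocks l x.
pose L x := moduli (q x * l) * (moduli (q x * l)).+1.
pose (w := fun x : instance =>
  sz x + 2 * q x + 2 * L x + 2 * (table_size l x * (2 * (c * q x) + 2) + 1) + 20).
have pw : polyb w by rewrite /w /L /q; solve_polyb.
pose b (x : instance) := w x ^ d1 + (w x ^ d2 + w x ^ d3 + Z ^ q x * 2) + (Z ^ q x * (w x ^ d4 + 1) + L x).
exists b.
  have E0 x : 0 < Z ^ q x by rewrite expn_gt0 Z0.
  have pwd d : bounded_by (fun x => Z ^ q x) (fun x => w x ^ d).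
    by apply: bounded_by_polyb => //; apply: polyb_exp.
  have bE (g : instance -> nat) : polyb g ->
      bounded_by (fun x => Z ^ q x) (fun x => Z ^ q x * g x).
    by move=> [d H]; exists d => x; rewrite leq_mul2l H orbT.
  rewrite /b; apply: bounded_by_add; first apply: bounded_by_add => //.
    apply: bounded_by_add; first exact: bounded_by_add.
    by apply: bE; solve_polyb.
  apply: bounded_by_add; last by apply: bounded_by_polyb => //; rewrite /L /q; solve_polyb.
  by apply: bE; apply: polyb_add; [exact: polyb_exp | solve_polyb].
move=> x i iq; set n := table_size l x.
have i3 : i.+3 %/ 2 <= i.+1 by lia.
have e1 : nth [::] (families l c n F i) (i.+1 - i.+3 %/ 2) = hash_family l c n F (i.+3 %/ 2).
  by apply: nth_families; lia.
have e2 : nth [::] (families l c n F i) (i.+1 - i.+2 %/ 2) = hash_family l c n F (i.+2 %/ 2).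
  by apply: nth_families; lia.
cbn [fst snd]; rewrite e1 e2 size_prodmap size_iota /b.
set A1 := hash_family _ _ _ _ (i.+3 %/ 2); set A2 := hash_family _ _ _ _ (i.+2 %/ 2).
set Li := moduli _ * _; set e := Z ^ _.
have mono a : a <= q x -> Z ^ a <= e by move=> ?; rewrite leq_pexp2l.
(* The loop runs once for each member of the family for [i.+2] blocks, so the bound on that family
   also bounds the work. *)
have size_A : Li * (size A1 * size A2) <= e.
  rewrite /Li -(size_familyS l c n F (q := i.+1)) //.
  by apply: leq_trans (family_le _ _) (mono _ _).
have Li0 : 0 < Li by rewrite muln_gt0.
have size_A12 : size A1 * size A2 <= e.
  by apply: leq_trans size_A; rewrite leq_pmull.
have size_A1 : size A1 <= e.
  by apply: leq_trans (family_le _ _) (mono _ _); rewrite /q; lia.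
have Li_le : Li <= L x.
  have le : moduli (i.+2 * l) <= moduli (q x * l).
    by rewrite leq_mul2l ltnS; apply: leq_exp2rw; rewrite leq_mul2r iq orbT.
  by rewrite /Li /L leq_mul.
have szi : (sz i).+1 <= w x by rewrite sz_nat /w; move: iq; rewrite /q -/(num_blocks l x); lia.
apply: leq_add; first apply: leq_add; first exact: leq_exp2rw.
  apply: leq_add; first by apply: leq_add; exact: leq_exp2rw.
  rewrite (_ : \max_(a <- A1) _ = 0); last first.
    by apply/eqP; rewrite -leqn0; apply: bigmax_In_le => a _; apply: bigmax_In_le.
  by rewrite muln1 mulnS muln2 -addnn leq_add.
rewrite mulnS addnC; apply: leq_add => //; rewrite mulnA leq_mul // addn1 ltnS.
apply: bigmax_In_le => a /In_mem; rewrite mem_iota add0n => /= a_lt.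
apply: bigmax_In_le => -[f g] /In_mem; rewrite mem_prodmap.
move=> /allpairsP[[f' g'] /= [fA gA [-> ->]]]; apply: leq_exp2rw.
have szf := hash_family_sz (q := i.+3 %/ 2) ltac:(lia) fA.
have szg := hash_family_sz (q := i.+2 %/ 2) ltac:(lia) gA.
have ub a' : a' <= q x -> n * (2 * (c * a') + 2) + 1 <= table_size l x * (2 * (c * q x) + 2) + 1.
  by move=> h; rewrite leq_add2r leq_mul2l leq_add2r leq_mul2l /= leq_mul2l h !orbT.
have szf' : sz f' <= table_size l x * (2 * (c * q x) + 2) + 1.
  by apply: leq_trans szf _; apply: ub; rewrite /q; lia.
have szg' : sz g' <= table_size l x * (2 * (c * q x) + 2) + 1.
  by apply: leq_trans szg _; apply: ub; rewrite /q; lia.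
rewrite !sz_pair !sz_nat /w.
have a_le : a <= L x by apply: leq_trans (ltnW a_lt) Li_le.
have i_le : i <= q x by rewrite /q; lia.
move: szf' szg' a_le i_le.
have arith v1 v2 v3 v4 v5 v6 v7 : v1 <= v4 -> v2 <= v4 -> v6 <= v5 -> v7 <= v3 ->
    (sz x + (v7.*2.+1 + (v6.*2.+1 + (v1 + v2).+1).+1).+1).+1
    < sz x + 2 * v3 + 2 * v5 + 2 * v4 + 20.
  by clear; lia.
exact: arith.
Qed.


Lemma timed_families : exists2 t,
  timed (fun x => families l c (table_size l x) F (num_blocks l x).-1) t &
  bounded_by (fun x => Z ^ num_blocks l x) t.
Proof.
have E0 x : 0 < Z ^ num_blocks l x by rewrite expn_gt0 Z0.
have [t Tt [b bb tb]] := timed_family_step.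
have pts := polytime_table_size l; have pnb := polytime_num_blocks l.
have [d1 T1] : exists d, timed (fun x => iota 0 (num_blocks l x).-1) (fun x => (sz x).+1 ^ d).
  by apply: polytime_timed; solve_polytime.
have [d2 T2] : exists d, timed (fun z : instance * (nat * table) =>
    [seq nth 0 z.2.2 (x %% z.2.1.+1) | x <- iota 0 (table_size l z.1)]) (fun z => (sz z).+1 ^ d).
  by apply: polytime_timed; solve_polytime.
have T3 := timed_prodmap_max (timed_const (A := instance) (iota 0 (moduli l)))
  (timed_const (A := instance) F)
  (f := fun x m f => [seq nth 0 f (y %% m.+1) | y <- iota 0 (table_size l x)]) T2.
have T4 : timed (fun x => [:: family1 l (table_size l x) F]) (fun x : instance =>
    0 + 0 + size (iota 0 (moduli l)) * (size F *
      (\max_(a <- iota 0 (moduli l)) \max_(b <- F) (sz (x, (a, b))).+1 ^ d2).+1).+1 + 0).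
  apply: (timed_ext (f := fun x => (family1 l (table_size l x) F, [::] : seq (seq table)))) => //.
  exact: timed_pair T3 (timed_const _).
have T5 : timed (fun z : instance * (seq (seq table) * nat) =>
    family_step_at l c (table_size l z.1) z.2.2 z.2.1 :: z.2.1) t.
  apply: (timed_ext (f := fun z : instance * (seq (seq table) * nat) =>
    (family_step_at l c (table_size l z.1) z.2.2 z.2.1, z.2.1))) => //.
  apply: timed_le (timed_pair Tt (_ : timed _ (fun=> 0))) _ => [|z].
    by apply: (timed_expr (e := EHd (ETl (EVar 0)))) => s z /= ->.
  by rewrite addn0.
have T6 := timed_foldl (P := fun x st rest => exists j,
    [/\ j <= (num_blocks l x).-1, rest = iota j ((num_blocks l x).-1 - j) &
        st = families l c (table_size l x) F j])
  (b := b) (i := fun x => [:: family1 l (table_size l x) F])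
  (f := fun x st i => family_step_at l c (table_size l x) i st :: st)
  T1 T4 T5 _ _.
eexists; first apply: (timed_ext _ (T6 _ _)).
- by move=> x; rewrite families_foldl.
- by move=> x; exists 0; rewrite subn0.
- move=> x st i rest [j [jq]]; case jE: ((num_blocks l x).-1 - j) => [|m] //= [-> ->] ->.
  have lt : j < (num_blocks l x).-1 by rewrite -subn_gt0 jE.
  split; last by apply: tb; rewrite -ltnS prednK // in lt.
  exists j.+1; split=> //; first by rewrite subnS jE.
  by rewrite !families_foldl -addn1 iotaD foldl_cat.
apply: bounded_by_add.
  apply: bounded_by_polyb => //; apply: polyb_add; first by exists d1.
  pose C := moduli l.*2 + \max_(f <- F) sz f + 3.
  apply: (polyb_le (g := fun x => 0 + 0 +
    moduli l * (size F * ((sz x + (2 * moduli l + (\max_(f <- F) sz f) + 4)) ^ d2 + 1) + 1) + 0)).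
    by solve_polyb.
  move=> x; rewrite size_iota !add0n !addn0 leq_mul2l addn1 ltnS leq_mul2l addn1 ltnS.
  apply/orP; right; apply/orP; right.
  apply: bigmax_In_le => m /In_mem; rewrite mem_iota add0n => /= m_lt.
  apply: bigmax_In_le => f fF; apply: leq_exp2rw.
  have le : sz f <= \max_(f <- F) sz f by apply: (@In_bigmax _ (fun f => sz f)).
  by rewrite !sz_pair sz_nat; lia.
have [d bd] := bb.
apply: (bounded_by_le (g := fun x => (num_blocks l x) * (b x + 1))).
  apply: bounded_by_poly; first solve_polyb.
  by apply: bounded_by_add => //; apply: bounded_by_polyb; solve_polyb.
by move=> x; rewrite size_iota addn1 leq_mul2r leq_pred orbT.
Qed.

End FamilyTime.

Lemma timed_bitseqs (s : instance -> nat) : polytime s -> exists2 t,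
  timed (fun x => bitseqs (s x)) t & bounded_by (fun x => 2 ^ s x) t.
Proof.
move=> ps; have [d1 T1] := polytime_timed (polytime_nseq ps).
have T2 : timed (fun z : instance * (seq bitseq * unit) => z.2.1) (fun=> 0).
  by apply: (timed_expr (e := EHd (ETl (EVar 0)))) => st z /= ->.
have Tcons : timed (fun z : (instance * (seq bitseq * unit)) * (bool * bitseq) =>
    z.2.1 :: z.2.2) (fun=> 0).
  by apply: (timed_expr (e := ETl (EVar 0))) => st z /= ->.
have T3 := timed_prodmap_max (f := fun _ b Y => b :: Y)
  (timed_const (A := instance * (seq bitseq * unit)) [:: false; true]) T2 Tcons.
have T4 := timed_foldl (P := fun x st rest => exists j, [/\ j + size rest = s x & st = bitseqs j])
  (b := fun x => 2 ^ s x * 4) (i := fun=> [:: [::]])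
  (f := fun _ st (_ : unit) => prodmap cons [:: false; true] st)
  T1 (timed_const [:: [::]]) T3 _ _.
eexists; first apply: (timed_ext _ (T4 _ _)).
- move=> x; congr encode; elim: (s x) => // n IH.
  have -> : nseq n.+1 tt = rcons (nseq n tt) tt by elim: (n) => //= m {1}->.
  by rewrite foldl_rcons IH.
- by move=> x; exists 0; rewrite size_nseq.
- move=> x st u rest [j [js ->]]; split.
    by exists j.+1; split=> //; rewrite -js /=; lia.
  have m0 : \max_(a <- [:: false; true]) \max_(b <- bitseqs j) 0 = 0.
    by apply/eqP; rewrite -leqn0; apply: bigmax_In_le => a _; apply: bigmax_In_le.
  cbn [fst snd]; rewrite m0 size_bitseqs muln1 !add0n.
  have : 2 ^ j <= 2 ^ s x by rewrite leq_exp2l // -js leq_addr.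
  have : 0 < 2 ^ j by rewrite expn_gt0.
  by rewrite /=; lia.
have E0 x : 0 < 2 ^ s x by rewrite expn_gt0.
apply: bounded_by_add; first by apply: bounded_by_polyb => //; apply: polyb_add; [exists d1 | solve_polyb].
apply: (bounded_by_le (g := fun x => s x * (2 ^ s x * 4 + 1))).
  apply: bounded_by_poly; first solve_polyb.
  apply: bounded_by_add; last by apply: bounded_by_polyb; solve_polyb.
  by exists 2 => x; rewrite leq_mul2l -[4]/(2 ^ 2) leq_exp2rw ?orbT // ltnS sz_gt0.
by move=> x; rewrite size_nseq addn1.
Qed.

Lemma timed_has_max A X (eA : encodable A) (eX : encodable X)
    (l : X -> seq A) (f : X -> A -> bool) tl t :
  timed l tl -> timed (fun z : X * A => f z.1 z.2) t ->
  timed (fun x => has (f x) (l x))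
    (fun x => tl x + size (l x) * (\max_(a <- l x) t (x, a)).+1).
Proof.
move=> Tl T; apply: timed_has => //; first exact: T.
by move=> x a ha; apply: (@In_bigmax _ (fun a => t (x, a))).
Qed.

Section DecideTime.

Variables (l c Z : nat) (F : seq table).
Hypotheses (c0 : 0 < c) (Z0 : 0 < Z) (F_lt : forall f x, f \in F -> nth 0 f x < c).
Hypothesis family_le : forall n q, 0 < q -> size (hash_family l c n F q) <= Z ^ q.

Definition parity_term (x : instance) (h : table) (p r : nat) (Y : bitseq) : nat :=
  if count id Y %% 2 == r then
    (walk_count (num_R x) (conn_mx x)
      [seq all (fun b => nth false (nth [::] (cov_mx x) v) b ==> ~~ nth false Y (nth 0 h b))
          (iota 0 (num_B x)) | v <- iota 0 (num_R x)] p (size_bound x)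
     * count negb Y ^ num_jokers l c x) %% p.+1
  else 0.

Lemma polytime_parity_term r :
  polytime (fun z : (instance * (table * nat)) * bitseq =>
    parity_term z.1.1 z.1.2.1 z.1.2.2 r z.2).
Proof.
have ? := polytime_num_R; have ? := polytime_num_B; have ? := polytime_conn_mx.
have ? := polytime_cov_mx; have ? := polytime_size_bound.
have ? := polytime_num_jokers l c.
rewrite /parity_term; apply: polytime_if; [solve_polytime | | solve_polytime].
apply: polytime_expn_modn; [|solve_polytime|solve_polytime|solve_polytime].
by apply: polytime_walk_count; solve_polytime.
Qed.

Notation context := (instance * (seq table * seq bitseq))%type.

(** The list of colour sets is an argument, so that it is generated once and shared by all tables
    and moduli. *)
Definition parity_sum_on (x : instance) (Ys : seq bitseq) (h : table) (p r : nat) : nat :=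
  (\sum_(Y <- Ys) parity_term x h p r Y) %% p.+1.

Lemma timed_parity_sum r : exists d,
  timed (fun z : (context * table) * nat => parity_sum_on z.1.1.1 z.1.1.2.2 z.1.2 z.2 r)
    (fun z => (sz (z.1.1.1, (z.1.2, z.2))).+1 ^ d + size z.1.1.2.2 *
      ((sz (z.1.1.1, (z.1.2, z.2)) + \max_(Y <- z.1.1.2.2) sz Y + 3) ^ d).+1).
Proof.
have T1 : timed (fun z : (context * table) * nat => z.1.1.2.2) (fun=> 0).
  by apply: (timed_expr (e := ETl (ETl (EHd (EHd (EVar 0)))))) => s z /= ->.
have T2 : timed (fun z : (context * table) * nat => (z.1.1.1, (z.1.2, z.2))) (fun=> 0).
  by apply: (timed_expr (e := ENode (EHd (EHd (EHd (EVar 0))))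
     (ENode (ETl (EHd (EVar 0))) (ETl (EVar 0))))) => s z /= ->.
have T3 : polytime (fun z : (instance * (table * nat)) * (nat * bitseq) =>
    (z.2.1 + parity_term z.1.1 z.1.2.1 z.1.2.2 r z.2.2) %% z.1.2.2.+1).
  apply: polytime_modn; last solve_polytime.
  apply: polytime_addn; first solve_polytime.
  apply: (polytime_comp (f := fun z : (instance * (table * nat)) * (nat * bitseq) =>
    (z.1, z.2.2)) _ (polytime_parity_term r)); solve_polytime.
have [||||d T] := timed_foldl_polytime
  (P := fun (y : instance * (table * nat)) s => s <= y.2.2) (b := fun y => 2 * y.2.2 + 1)
  (i := fun=> 0) (f := fun y s Y => (s + parity_term y.1 y.2.1 y.2.2 r Y) %% y.2.2.+1)
  T1 T2 (polytime_const 0) T3.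
- by solve_polyb.
- by [].
- by move=> y s a _; rewrite -ltnS ltn_mod.
- by move=> y s; rewrite sz_nat; lia.
exists d.
have {}T := T (fun z => \max_(Y <- z.1.1.2.2) sz Y) (fun z Y => @In_bigmax _ (fun Y => sz Y) _ _).
apply: timed_le (timed_ext _ T) _ => // z.
congr encode; rewrite /parity_sum_on foldl_modn //.
Qed.


Definition search (z : context) : bool :=
  has (fun h => has (fun p =>
      parity_sum_on z.1 z.2.2 h p 0 != parity_sum_on z.1 z.2.2 h p 1)
    (iota 0 (num_moduli l c z.1))) z.2.1.

Lemma timed_search : exists2 t, timed search t &
  bounded_by (fun x => Z ^ num_blocks l x * 2 ^ num_colours l c x)
    (fun x => t (x, (hash_family l c (table_size l x) F (num_blocks l x),
                     bitseqs (num_colours l c x)))).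
Proof.
have pts := polytime_table_size l; have pnb := polytime_num_blocks l.
have pnm := polytime_num_moduli l c; have pnc := polytime_num_colours l c.
have [d0 T0] := timed_parity_sum 0; have [d1 T1] := timed_parity_sum 1.
have [d2 T2] : exists d, timed (fun z : nat * nat => z.1 != z.2) (fun z => (sz z).+1 ^ d).
  by apply: polytime_timed; solve_polytime.
have T3 := timed_comp (timed_pair T0 T1) T2.
have [d4 T4] : exists d, timed (fun z : context * table => iota 0 (num_moduli l c z.1.1))
    (fun z => (sz z.1.1).+1 ^ d).
  have [d T] := polytime_timed (polytime_iota pnm); exists d.
  apply: timed_le (timed_comp (f := fun z : context * table => z.1.1) (tf := fun=> 0) _ T) _ => //.
  by apply: (timed_expr (e := EHd (EHd (EVar 0)))) => s z /= ->.
have T5 := timed_has_max T4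
  (f := fun z p => parity_sum_on z.1.1 z.1.2.2 z.2 p 0 != parity_sum_on z.1.1 z.1.2.2 z.2 p 1)
  T3.
have T6 : timed (fun z : context => z.2.1) (fun=> 0).
  by apply: (timed_expr (e := EHd (ETl (EVar 0)))) => s z /= ->.
have T7 := timed_has_max T6 (f := fun z h => has (fun p =>
  parity_sum_on z.1 z.2.2 h p 0 != parity_sum_on z.1 z.2.2 h p 1)
    (iota 0 (num_moduli l c z.1))) T5.
eexists; first exact: T7.
pose (B := fun x => table_size l x * (2 * (c * num_blocks l x) + 2) + 1).
pose (w := fun x : instance => sz x + B x + 2 * num_moduli l c x + 4 * num_colours l c x + 20).
have pw : polyb w by rewrite /w /B; solve_polyb.
pose (E := fun x => 2 ^ num_colours l c x).
have E0 x : 0 < E x by rewrite expn_gt0.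
pose (tp := fun d x => w x ^ d + E x * ((2 * w x) ^ d + 1)).
pose (t5 := fun x => w x ^ d4 + num_moduli l c x *
  (tp d0 x + tp d1 x + (4 * num_moduli l c x + 20) ^ d2 + 1)).
have bE (g : instance -> nat) : polyb g -> bounded_by E (fun x => E x * g x).
  by move=> [d H]; exists d => x; rewrite leq_mul2l H orbT.
have btp d : bounded_by E (tp d).
  apply: bounded_by_add; first by apply: bounded_by_polyb => //; apply: polyb_exp.
  by apply: bE; apply: polyb_add; [apply: polyb_exp; apply: polyb_mul => //; solve_polyb | solve_polyb].
have bt5 : bounded_by E t5.
  apply: bounded_by_add; first by apply: bounded_by_polyb => //; apply: polyb_exp.
  apply: bounded_by_poly; first solve_polyb.
  apply: bounded_by_add; last by apply: bounded_by_polyb => //; solve_polyb.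
  apply: bounded_by_add; first exact: bounded_by_add.
  by apply: bounded_by_polyb => //; solve_polyb.
apply: bounded_by_le (_ : bounded_by _ (fun x => Z ^ num_blocks l x * (t5 x + 1))) _.
  apply: bounded_by_mul; first by exists 0 => x; rewrite muln1.
  by apply: bounded_by_add => //; apply: bounded_by_polyb => //; solve_polyb.
move=> x; cbn [fst snd]; rewrite add0n.
apply: leq_mul; first exact: family_le.
rewrite addn1 ltnS; apply: bigmax_In_le => h /In_mem hF.
have sh : sz h <= B x by exact: hash_family_sz hF.
have sx : sz x <= w x by rewrite /w -!addnA leq_addr.
rewrite /t5; apply: leq_add.
  by apply: leq_exp2rw; rewrite /w addnS ltnS -!addnA leq_addr.
rewrite size_iota leq_mul2l addn1 ltnS; apply/orP; right.
apply: bigmax_In_le => p /In_mem; rewrite mem_iota add0n => /= p_lt.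
have szx : sz (x, (h, p)) < w x.
  have arith a b m v u : b <= u -> p < m ->
      (a + (b + p.*2.+1).+1).+1 < a + u + 2 * m + 4 * v + 20 by clear; lia.
  by rewrite !sz_pair sz_nat; apply: arith.
have Y_le : \max_(Y <- bitseqs (num_colours l c x)) sz Y <= 4 * num_colours l c x + 1.
  apply: bigmax_In_le => Y /In_mem; rewrite mem_bitseqs => /eqP <-.
  have sz_bits (s : seq bool) : sz s <= 4 * size s + 1.
    by elim: s => // b s IH; move: IH (sz_bool b); rewrite sz_cons /=; clear; lia.
  exact: sz_bits.
have tp_le d : (sz (x, (h, p))).+1 ^ d + size (bitseqs (num_colours l c x)) *
    ((sz (x, (h, p)) + \max_(Y <- bitseqs (num_colours l c x)) sz Y + 3) ^ d).+1 <= tp d x.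
  apply: leq_add; first exact: leq_exp2rw.
  rewrite size_bitseqs leq_mul2l addn1 ltnS; apply/orP; right; apply: leq_exp2rw.
  have arith a b m v u : a < b -> m <= 4 * v + 1 -> u + 4 * v + 20 <= b -> a + m + 3 <= 2 * b.
    by clear; lia.
  apply: (arith _ _ _ (num_colours l c x) 0 szx Y_le).
  by rewrite add0n /w -addnA leq_addl.
apply: leq_add; first apply: leq_add; [exact: tp_le | exact: tp_le |].
apply: leq_exp2rw; rewrite sz_pair !sz_nat.
have p_le r : parity_sum_on x (bitseqs (num_colours l c x)) h p r <= p.
  by rewrite -ltnS ltn_mod.
have arith a b m : a <= p -> b <= p -> p < m -> (a.*2.+1 + b.*2.+1).+1 < 4 * m + 20.
  by clear; lia.
exact: arith.
Qed.

Lemma timed_decide : exists2 t, timed (decide l c F) t &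
  bounded_by (fun x => Z ^ num_blocks l x * 2 ^ num_colours l c x) t.
Proof.
have [t1 T1 b1] := timed_search.
have [t2 T2 b2] := timed_families c0 Z0 F_lt family_le.
have [t3 T3 b3] := timed_bitseqs (polytime_num_colours l c).
have pg := polytime_goal.
have [d4 T4] : exists d, timed (fun x => goal x == 0) (fun x => (sz x).+1 ^ d).
  by apply: polytime_timed; solve_polytime.
have E0 x : 0 < Z ^ num_blocks l x by rewrite expn_gt0 Z0.
have E0' x : 0 < 2 ^ num_colours l c x by rewrite expn_gt0.
have T5 : timed (fun x => hash_family l c (table_size l x) F (num_blocks l x)) (fun x => t2 x + 0).
  apply: timed_le (timed_comp T2 (timed_comp (f := fun s : seq (seq table) => (s, 0))
    (tf := fun=> 0) _ (timed_nth _ ([::] : seq table)))) _ => [|x]; last by [].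
  by apply: (timed_expr (e := ENode (EVar 0) ELeaf)) => s z /= ->.
have Tid : timed (fun x : instance => x) (fun=> 0).
  by apply: (timed_expr (e := EVar 0)) => s z /= ->.
have T6 := timed_comp (timed_pair Tid (timed_pair T5 T3)) T1.
have T7 := timed_if T4 (timed_const true) T6.
eexists; first exact: timed_ext T7.
apply: (bounded_by_le (g := fun x => (sz x).+1 ^ d4 + (t2 x + t3 x +
  t1 (x, (hash_family l c (table_size l x) F (num_blocks l x),
          bitseqs (num_colours l c x)))))); last first.
  by move=> x; rewrite leq_add2l add0n addn0; case: ifP.
have E0E x : 0 < Z ^ num_blocks l x * 2 ^ num_colours l c x by rewrite muln_gt0 E0 E0'.
apply: bounded_by_add; first by apply: bounded_by_polyb => //; exists d4.
apply: bounded_by_add => //; apply: bounded_by_add.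
  by apply: bounded_by_weaken b2 _ => x; rewrite leq_pmulr.
by apply: bounded_by_weaken b3 _ => x; rewrite leq_pmull.
Qed.

End DecideTime.

(** * Correctness *)

Definition matrix_bits m n (a : 'I_m -> 'I_n -> bool) : seq bitseq :=
  [seq [seq a i j | j <- enum 'I_n] | i <- enum 'I_m].

Definition instance_of (I : pcrbds) : instance :=
  (nR I, (nB I, (matrix_bits (@gconn I), (matrix_bits (@gcov I),
    (nat_bits (budget I), (nat_bits (target I), tt)))))).

Lemma encode_instance_of I : encode (instance_of I) = pcrbds_enc I.
Proof.
have unary n : tree_of_seq (fun=> Leaf) (enum 'I_n) = encode n.
  rewrite -[in RHS](size_enum_ord n); elim: (enum _) => // i s IH.
  by rewrite -[RHS]/(Node Leaf (encode (size s))) -IH.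
have tree_map (T U : Type) (f : U -> tree) (g : T -> U) s :
    tree_of_seq f (map g s) = tree_of_seq (fun i => f (g i)) s.
  by elim: s => //= a s ->.
have mx m n (a : 'I_m -> 'I_n -> bool) : tree_of_matrix a = encode (matrix_bits a).
  by rewrite -[RHS]/(tree_of_seq encode _) tree_map.
by rewrite /pcrbds_enc !unary !mx.
Qed.

Lemma nth_matrix_bits m n (a : 'I_m -> 'I_n -> bool) (i : 'I_m) (j : 'I_n) :
  nth false (nth [::] (matrix_bits a) i) j = a i j.
Proof.
by rewrite (nth_map i) ?size_enum_ord // (nth_map j) ?size_enum_ord // !nth_ord_enum.
Qed.

Lemma bits_value_nat_bits n : bits_value (nat_bits n) = n.
Proof.
rewrite /nat_bits -[RHS]bin_of_natK; case: (bin_of_nat n) => //= p.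
elim: p => //= p ->; rewrite /= ?natTrecE; lia.
Qed.

(** There is no branching walk without leaves. This settles the instances with an empty size bound,
    to which [walk_countE] does not apply. *)
Lemma parity_sum0 nr nb gc gv s e h p r : parity_sum nr nb gc gv 0 s e h p r = 0.
Proof.
rewrite /parity_sum big1 ?mod0n // => Y _; case: ifP => // _.
rewrite /walk_count big1 ?mod0n ?mul0n ?mod0n // => v _.
by rewrite /= !nth_nil.
Qed.

Section Correctness.

Variables (l c : nat) (F : seq table).
Hypotheses (l0 : 0 < l) (lc : l <= c).
Hypothesis F_lt : forall f x, f \in F -> nth 0 f x < c.
Hypothesis l_big : forall z, l <= z -> 108 * z ^ 3 <= 2 ^ z.
Hypothesis F_inj : forall T, uniq T -> size T <= l -> all (fun x => x < moduli l) T ->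
  exists2 f, f \in F & {in T &, injective (nth 0 f)}.

Lemma goal_le_blocks x : goal x + ceil_log (num_B x) <= num_blocks l x * l.
Proof.
rewrite /num_blocks prednK //; set a := _ + _.
by rewrite mulSn {1}(divn_eq a l) addnC leq_add2r ltnW // ltn_mod.
Qed.

Variable I : pcrbds.
Notation x := (instance_of I).

Lemma goal_le_colours : goal x <= num_colours l c x.
Proof.
apply: leq_trans (leq_addr (ceil_log (num_B x)) _) _.
by apply: leq_trans (goal_le_blocks x) _; rewrite /num_colours mulnC leq_mul.
Qed.

Lemma matrix_rel_gconn : matrix_rel (conn_mx x) =2 @gconn I.
Proof. by move=> u v; rewrite /matrix_rel nth_matrix_bits. Qed.

Lemma connected_inE (S : {set 'I_(nR I)}) :
  connected_in (matrix_rel (conn_mx x)) S = connected_in (@gconn I) S.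
Proof.
apply: eq_forallb => u; congr (_ ==> _); apply: eq_forallb => v; congr (_ ==> _).
by apply: eq_connect => a b; rewrite /induced /= matrix_rel_gconn.
Qed.

Lemma matrix_rel_sym : symmetric (matrix_rel (conn_mx x) (nr := nR I)).
Proof. by move=> u v; rewrite !matrix_rel_gconn gconn_sym. Qed.

Lemma cov_nbhdE (S : {set 'I_(nR I)}) :
  [set b : 'I_(nB I) | [exists r in S, nth false (nth [::] (cov_mx x) r) b]] = cov_nbhd S.
Proof.
apply/setP => b; rewrite !inE; apply: eq_existsb => r.
by rewrite nth_matrix_bits.
Qed.

Lemma goalE : goal x = minn (nB I).+1 (target I).
Proof. by rewrite /goal bits_value_nat_bits. Qed.

Lemma size_boundE : size_bound x = minn (nR I) (budget I).
Proof. by rewrite /size_bound bits_value_nat_bits. Qed.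

Lemma decide_sound : decide l c F x -> pcrbds_yes I.
Proof.
case/orP => [/eqP t0|/hasP[h _ /hasP[p _]]].
  apply/existsP; exists set0; rewrite cards0 /=.
  have -> : target I = 0 by move: t0; rewrite goalE; lia.
  by rewrite andbT; apply/forall_inP => u; rewrite inE.
case: (posnP (size_bound x)) => [->|k0]; first by rewrite !parity_sum0.
rewrite parity_sumP // => ndiv.
have : 0 < count (covered (num_B x) (cov_mx x) (num_colours l c x) h)
    (walk_jokers (num_R x) (conn_mx x) (size_bound x) (num_colours l c x) (num_jokers l c x)).
  by rewrite lt0n; apply: contraNneq ndiv => ->.
rewrite -has_count => /hasP[[S J] SJ cov].
have := covered_card SJ cov; rewrite cov_nbhdE /= => s_le.
have [v hS] : exists v, S \in walks (matrix_rel (conn_mx x)) (size_bound x) v.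
  by case/allpairsP: SJ => -[S' J'] /= [/flatten_mapP[v _ hv] _ [-> _]]; exists v.
have [_ cS nS] := walks_sound matrix_rel_sym hS.
apply/existsP; exists S; rewrite -connected_inE nS /=; apply/andP; split.
  by apply: leq_trans cS _; rewrite size_boundE geq_minr.
have t_le : goal x <= #|cov_nbhd S|.
  by rewrite -(leq_add2r (num_jokers l c x)) {1}/num_jokers subnKC ?goal_le_colours.
(* The capped value [(nB I).+1] exceeds every neighbourhood, so the goal that was reached is the
   target itself. *)
have nb : #|cov_nbhd S| <= nB I by rewrite -[X in _ <= X]card_ord max_card.
move: t_le; rewrite goalE geq_min => /orP[/leq_trans/(_ nb)|//].
by rewrite ltnn.
Qed.

Lemma decide_complete : pcrbds_yes I -> decide l c F x.
Proof.
case/existsP => S /and3P[Sb cS tS]; apply/orP; case: (posnP (goal x)) => [_|t0]; [by left|right].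
have nb : #|cov_nbhd S| <= nB I by rewrite -[X in _ <= X]card_ord max_card.
have tE : goal x = target I by rewrite goalE; apply/minn_idPr/leqW/(leq_trans tS).
have [v vS] : exists v, v \in S.
  have /card_gt0P[b] : 0 < #|cov_nbhd S| by rewrite (leq_trans _ tS) // -tE.
  by rewrite inE => /existsP[v /andP[vS _]]; exists v.
have Sk : #|S| <= size_bound x.
  by rewrite size_boundE leq_min Sb andbT -[X in _ <= X]card_ord max_card.
have k0 : 0 < size_bound x by apply: leq_trans Sk; apply/card_gt0P; exists v.
pose T := take (goal x) [seq val b | b <- enum (cov_nbhd S)].
have uT : uniq T by rewrite take_uniq // map_inj_uniq ?enum_uniq //; exact: val_inj.
have sT : size T = goal x.
  by rewrite size_takel // size_map -cardE tE.
have TP b : b \in T -> exists2 b' : 'I_(nB I), b = b' & b' \in cov_nbhd S.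
  by move/mem_take => /mapP[b']; rewrite mem_enum => hb ->; exists b'.
have T_lt : all (fun b => b < nB I) T by apply/allP => b /TP[b' ->].
have q0 : 0 < num_blocks l x by [].
have blocks := goal_le_blocks x.
have [|||||h hF h_inj] := family_inj (n := table_size l x) (leq_trans l0 lc) F_lt l_big l0 F_inj q0 (T := T).
- by rewrite leq_addl.
- exact: uT.
- by rewrite sT; apply: leq_trans blocks; rewrite leq_addr.
- apply/allP => b /(allP T_lt) b_lt; apply: leq_trans b_lt _.
  have /andP[le _] := ceil_logP (nB I); apply: leq_trans le _.
  by rewrite leq_exp2l //; apply: leq_trans blocks; rewrite leq_addl.
- by apply/allP => b /(allP T_lt) b_lt; apply: leq_trans b_lt (leq_addr _ _).
have h_lt b : nth 0 h b < num_colours l c x.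
  by apply: family_lt hF => //; exact: leq_trans l0 lc.
apply/hasP; exists h => //.
have X0 : 0 < count (covered (num_B x) (cov_mx x) (num_colours l c x) h)
    (walk_jokers (num_R x) (conn_mx x) (size_bound x) (num_colours l c x) (num_jokers l c x)).
  apply: (exists_covered (S := S) (v := v) (T := T)) => //.
  - exact: matrix_rel_sym.
  - by rewrite connected_inE.
  - by rewrite sT /num_jokers subnKC // goal_le_colours.
  - move=> b /TP[b' -> ]; rewrite inE => /existsP[r /andP[rS rb]]; split=> //.
    by exists r => //; rewrite nth_matrix_bits.
have X_lt := @size_walk_jokers_lt (num_R x) (num_B x) (conn_mx x) (cov_mx x) (size_bound x)
  (num_colours l c x) (num_jokers l c x) h k0 ltac:(by rewrite /size_bound geq_minl)
  (leq_subr _ _).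
apply: contraLR X_lt => /hasPn none; rewrite -leqNgt.
apply: exp2_le_common_multiple => // m /andP[m0 mM].
have := none m.-1; rewrite mem_iota add0n prednK //= => /(_ mM).
by rewrite negbK parity_sumP // prednK.
Qed.

Lemma decide_correct : decide l c F x = pcrbds_yes I.
Proof. by apply/idP/idP; [exact: decide_sound | exact: decide_complete]. Qed.

End Correctness.

(** * Numerical estimates for the size of a block *)

Lemma exists_exp_dominates d n : exists2 u, n <= u & u ^ d * 2 ^ u <= 3 ^ u.
Proof.
(* A power of two makes [u ^ d] a power of two as well. With [u = 2 * v] and
   [9 ^ v >= 2 ^ v * 2 ^ u], the claim reduces to [a.+1 * d <= 2 ^ a]. *)
pose a := 2 * (d + n) + 4; exists (2 * 2 ^ a).
  apply: leq_trans (_ : 2 ^ a <= _); last by rewrite leq_pmull.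
  by apply: leq_trans (ltnW (ltn_expl a (isT : 1 < 2))); rewrite /a; lia.
set v := 2 ^ a.
have -> : 3 ^ (2 * v) = 9 ^ v by rewrite expnM.
apply: (@leq_trans (8 ^ v)); last exact: leq_exp2rw.
have -> : 8 ^ v = 2 ^ v * 2 ^ (2 * v) by rewrite (expnM 2 2) -expnMn.
rewrite leq_mul2r; apply/orP; right.
rewrite /v -expnS -expnM leq_exp2l //.
have d_lt : d < 2 ^ d by exact: ltn_expl.
have n_lt : n < 2 ^ n by exact: ltn_expl.
apply: (@leq_trans ((2 ^ d * 2 ^ d) * (2 ^ n * 2 ^ n) * 16)).
  have P1 : 0 < 2 ^ n by lia.
  have h1 : d * d <= 2 ^ d * 2 ^ d by apply: leq_mul; lia.
  have h2 : d <= 2 ^ d * 2 ^ d by apply: leq_trans (ltnW d_lt) _; rewrite leq_pmulr; lia.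
  have h3 : d * n <= 2 ^ d * 2 ^ d * 2 ^ n.
    by apply: leq_mul => //; lia.
  have h4 : 2 ^ d * 2 ^ d <= 2 ^ d * 2 ^ d * (2 ^ n * 2 ^ n) by rewrite leq_pmulr // muln_gt0 P1.
  have h5 : 2 ^ d * 2 ^ d * 2 ^ n <= 2 ^ d * 2 ^ d * (2 ^ n * 2 ^ n).
    by rewrite leq_mul2l leq_pmull ?orbT.
  rewrite /a; move: (2 ^ d * 2 ^ d) (2 ^ d * 2 ^ d * 2 ^ n) (2 ^ d * 2 ^ d * (2 ^ n * 2 ^ n))
    h1 h2 h3 h4 h5 => A B C.
  nia.
rewrite /a -!expnD -[16]/(2 ^ 4) -expnD leq_exp2l //; lia.
Qed.

Lemma cube_le_exp z : 20 <= z -> 108 * z ^ 3 <= 2 ^ z.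
Proof.
move=> /subnKC <-; elim: (z - 20) => [|k IH].
  have e1 : 2 ^ 10 = 1024 by [].
  by rewrite addn0 (expnD 2 10 10) e1 !expnS expn0; lia.
rewrite addnS [2 ^ _]expnS; apply: leq_trans (leq_mul (leqnn 2) IH).
rewrite mulnCA leq_mul2l; apply/orP; right.
by move: (20 + k) (leq_addr k 20) => y y20; rewrite !expnS !expn0; nia.
Qed.

(** The binomial coefficient grows like [(27 / 4) ^ u] up to a polynomial factor. Consecutive ones
    have the ratio [3 (3 u + 2) (3 u + 1) / ((2 u + 2) (2 u + 1))], and the factor [(3 * u).+1]
    makes up for its distance from [27 / 4]. *)
Lemma expn27_le_bin u : 27 ^ u <= 'C(3 * u, u) * 4 ^ u * (3 * u).+1.
Proof.
elim: u => // u IH.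
have step : 'C(3 * u.+1, u.+1) * ((2 * u + 2) * (2 * u + 1)) =
            3 * ((3 * u + 2) * (3 * u + 1)) * 'C(3 * u, u).
  have e1 : u.+1 * 'C(3 * u.+1, u.+1) = (3 * u.+1) * 'C(3 * u + 2, u).
    have -> : 3 * u + 2 = (3 * u.+1).-1 by lia.
    by rewrite -mul_bin_diag.
  have e2 : (2 * u + 2) * 'C(3 * u + 2, u) = (3 * u + 2) * 'C(3 * u + 1, u).
    have := mul_bin_down (3 * u + 2) u.
    have -> : (3 * u + 2).-1 = 3 * u + 1 by lia.
    by have -> : 3 * u + 2 - u = 2 * u + 2 by lia.
  have e3 : (2 * u + 1) * 'C(3 * u + 1, u) = (3 * u + 1) * 'C(3 * u, u).
    have := mul_bin_down (3 * u + 1) u.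
    have -> : (3 * u + 1).-1 = 3 * u by lia.
    by have -> : 3 * u + 1 - u = 2 * u + 1 by lia.
  have e0 : 'C(3 * u.+1, u.+1) = 3 * 'C(3 * u + 2, u) by nia.
  rewrite e0; move: e2 e3; set A := 'C(3 * u + 2, u); set B := 'C(3 * u + 1, u).
  set C := 'C(3 * u, u) => e2 e3.
  have -> : 3 * A * ((2 * u + 2) * (2 * u + 1)) = 3 * (2 * u + 1) * ((2 * u + 2) * A) by ring.
  rewrite e2.
  have -> : 3 * (2 * u + 1) * ((3 * u + 2) * B) = 3 * (3 * u + 2) * ((2 * u + 1) * B) by ring.
  by rewrite e3; ring.
have P0 : 0 < (2 * u + 2) * (2 * u + 1) by rewrite muln_gt0; lia.
rewrite -(leq_pmul2r P0).
have -> : 'C(3 * u.+1, u.+1) * 4 ^ u.+1 * (3 * u.+1).+1 * ((2 * u + 2) * (2 * u + 1)) =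
   ('C(3 * u.+1, u.+1) * ((2 * u + 2) * (2 * u + 1))) * (4 * 4 ^ u * (3 * u.+1).+1).
  by rewrite expnS; ring.
rewrite step expnS.
have -> : 3 * ((3 * u + 2) * (3 * u + 1)) * 'C(3 * u, u) * (4 * 4 ^ u * (3 * u.+1).+1) =
  ('C(3 * u, u) * 4 ^ u * (3 * u).+1) * (12 * (3 * u + 2) * (3 * u + 4)) by ring.
have -> : 27 * 27 ^ u * ((2 * u + 2) * (2 * u + 1)) = 27 ^ u * (27 * ((2 * u + 2) * (2 * u + 1))) by ring.
apply: leq_mul IH _; nia.
Qed.

(** * The exponential base *)

From mathcomp Require Import all_boot all_order all_algebra lra.
From mathcomp Require Import all_classical all_reals all_analysis.
Import Order.TTheory GRing.Theory Num.Theory.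
Import numFieldNormedType.Exports.
Local Open Scope classical_set_scope.
Local Open Scope ring_scope.

(** The quotient [n ^ n / n!] is a single term of the exponential series at [n]. *)
Lemma expn_le_expR_fact (R : realType) n : (n ^ n)%:R <= expR 1 ^+ n * n`!%:R :> R.
Proof.
case: n => [|n]; first by rewrite fact0 expr0 mul1r.
have f0 : 0 < n.+1`!%:R :> R by rewrite ltr0n fact_gt0.
have h : 1 + n.+1%:R ^+ n.+1 / n.+1`!%:R <= expR n.+1%:R :> R by exact: expR_ge1Dxn.
rewrite natrX -ler_pdivrMr // -expRM_natl mulr1; apply: le_trans h.
by rewrite lerDr ler01.
Qed.

(** A random map from [2 u] elements to [3 u] colours is injective with probability at least
    [(3 / e^2) ^ u / (3 u + 1)]. The falling factorial is split into a binomial coefficient, of rate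
    [27 / 4], and [(2 u)!]. *)
Lemma expn_le_ffact (R : realType) u :
  ((3 * u) ^ (2 * u) * 3 ^ u)%:R <=
  (3 * u).+1%:R * expR 1 ^+ (2 * u) * ((3 * u) ^_ (2 * u))%:R :> R.
Proof.
have -> : ((3 * u) ^_ (2 * u) = 'C(3 * u, u) * (2 * u)`!)%N.
  have -> : (2 * u = 3 * u - u)%N by lia.
  by rewrite -bin_ffact bin_sub //; lia.
have e1 : ((3 * u) ^ (2 * u) * 3 ^ u * 4 ^ u = 27 ^ u * (2 * u) ^ (2 * u))%N.
  by rewrite ![(_ ^ (2 * u))%N]expnM -!expnMn; congr (_ ^ u)%N; ring.
have le : ((3 * u) ^ (2 * u) * 3 ^ u <= 'C(3 * u, u) * (3 * u).+1 * (2 * u) ^ (2 * u))%N.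
  rewrite -(leq_pmul2r (m := 4 ^ u)) ?expn_gt0 // e1.
  apply: leq_trans (leq_mul (expn27_le_bin u) (leqnn _)) _.
  by apply/eq_leq; ring.
apply: le_trans (_ : ('C(3 * u, u) * (3 * u).+1 * (2 * u) ^ (2 * u))%:R <= _).
  by rewrite ler_nat.
rewrite !natrM -!mulrA mulrCA; apply: ler_wpM2l => //.
rewrite [leRHS]mulrCA; apply: ler_wpM2l => //.
exact: expn_le_expR_fact.
Qed.

Lemma leq_moduli j : (j <= moduli j)%N.
Proof.
have le : (j <= j ^ 3)%N by rewrite !expnS; case: j => // j; rewrite leq_pmulr // muln_gt0.
by rewrite /moduli mul2n -addnn (leq_trans (leqW le)) // leq_addr.
Qed.

(** All polynomial costs of one block: its moduli, the halvings of the greedy cover, the constant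
    [K] of the recursion, and the loss in the injectivity estimate together with rounding. *)
Lemma overhead_le u : (32 <= u)%N ->
  (moduli (2 * u) * (moduli (2 * u)).+1 * (32 * (9 * (2 * u)) ^ 6) * (2 * (3 * u).+1)
   <= u ^ 23)%N.
Proof.
move=> u32; set D := moduli _; set K := (32 * _ ^ 6)%N.
  have uu : (32 * 32 <= u * u)%N by apply: leq_mul.
  have hu3 : (1 <= u ^ 3)%N by rewrite expn_gt0; lia.
  have D_le : (D <= 17 * u ^ 3)%N.
    by rewrite /D /moduli expnMn -[(2 ^ 3)%N]/8%N; lia.
  have DD : (D * D.+1 <= u ^ 8)%N.
    apply: (@leq_trans ((17 * u ^ 3) * (18 * u ^ 3))); first by apply: leq_mul => //; lia.
    have -> : (u ^ 8 = (u * u) * (u ^ 3 * u ^ 3))%N by ring.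
    have -> : (17 * u ^ 3 * (18 * u ^ 3) = 306 * (u ^ 3 * u ^ 3))%N by ring.
    by rewrite leq_mul2r; apply/orP; right; lia.
  have K_le : (K <= u ^ 13)%N.
    have -> : (u ^ 13 = u * (u * u) ^ 6)%N by ring.
    by rewrite /K; apply: leq_mul => //; apply: leq_exp2rw; nia.
  have L_le : (2 * (3 * u).+1 <= u ^ 2)%N by rewrite expnS expn1; nia.
  have -> : (u ^ 23 = u ^ 8 * u ^ 13 * u ^ 2)%N by rewrite -!expnD.
  exact: leq_mul (leq_mul DD K_le) L_le.
Qed.

(* Blocks of size [2 u] with [3 u] colours: the family has about [(e^2 / 3)^u]
   members and there are [8^u] colour sets, against [(2 e)^(2 u) = (4 e^2)^u]. *)
Lemma exists_parameters (R : realType) : exists l c Z F,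
  [/\ (0 < l <= c)%N, (0 < Z)%N, forall z, (l <= z)%N -> (108 * z ^ 3 <= 2 ^ z)%N &
  [/\ forall f x, f \in F -> (nth 0 f x < c)%N,
      forall T, uniq T -> (size T <= l)%N -> all (fun x => x < moduli l)%N T ->
        exists2 f, f \in F & {in T &, injective (nth 0%N f)},
      forall n q, (0 < q)%N -> (size (hash_family l c n F q) <= Z ^ q)%N &
      (Z * 2 ^ c)%:R <= (2 * expR 1) ^+ l :> R]].
Proof.
(* The degree and the threshold are those of [overhead_le]; the threshold also gives [l >= 20] for
   [cube_le_exp]. *)
have [u u32 u_le] := exists_exp_dominates 23 32.
pose l := (2 * u)%N; pose c := (3 * u)%N; pose D := moduli l.
pose K := (32 * (9 * l) ^ 6)%N; pose N := ((c ^ l) %/ (c ^_ l) + 1)%N.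
have u0 : (0 < u)%N by exact: leq_trans u32.
have l0 : (0 < l)%N by rewrite muln_gt0.
have lc : (l <= c)%N by rewrite leq_mul2r orbT.
have lD : (l <= D)%N by exact: leq_moduli.
have f0 : (0 < c ^_ l)%N by rewrite ffact_gt0.
have N_ge : (c ^ l <= N * c ^_ l)%N.
  by rewrite {1}(divn_eq (c ^ l) (c ^_ l)) /N mulnDl mul1n leq_add2l ltnW // ltn_mod.
have [F [sF F_lt F_inj]] := exists_hash_family (D := D) (n := N) (introT andP (conj l0 lc)) lD N_ge.
pose Z := (moduli l * size F * K)%N.
have K0 : (0 < K)%N by rewrite muln_gt0 expn_gt0 muln_gt0 l0.
have Z0 : (0 < Z)%N by rewrite /Z muln_gt0 K0 andbT sF /N addn1 !muln_gt0.
exists l, c, Z, F; split=> //; first by rewrite l0.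
  by move=> z lz; apply/cube_le_exp/(leq_trans _ lz)/(@leq_trans (2 * 32)); rewrite ?leq_mul.
split=> // [n q q0|].
  apply: leq_trans (size_family_le c n F q0 l0 (erefl K)); apply: leq_pmulr.
  by rewrite muln_gt0 expn_gt0 q0 andbT.
have N_le : (N * c ^_ l <= 2 * c ^ l)%N.
  have le : (c ^_ l <= c ^ l)%N.
    rewrite ffact_prod -[X in (_ <= _ ^ X)%N]card_ord -prod_nat_const.
    by apply: leq_prod => i _; rewrite leq_subr.
  by rewrite /N mulnDl mul1n mul2n -addnn leq_add // leq_trunc_div.
have P_le : (D * D.+1 * K * (2 * (3 * u).+1) <= u ^ 23)%N by exact: overhead_le.
have e0 : 0 < expR 1 :> R by exact: expR_gt0.
have key : N%:R * (3 ^ u)%:R <= (2 * (3 * u).+1)%:R * expR 1 ^+ l :> R.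
  have c0 : 0 < (c ^_ l)%:R :> R by rewrite ltr0n.
  rewrite -(ler_pM2r c0).
  apply: le_trans (_ : 2 * ((c ^ l) * 3 ^ u)%:R <= _).
    by rewrite mulrAC -!natrM ler_nat mulnA leq_mul2r N_le orbT.
  apply: le_trans (ler_wpM2l _ (expn_le_ffact R u)) _ => //.
  by rewrite natrM !mulrA.
have p3 : 0 < (3 ^ u)%:R :> R by rewrite ltr0n expn_gt0.
rewrite -(ler_pM2r p3).
have -> : (Z * 2 ^ c)%:R * (3 ^ u)%:R =
    (D * D.+1 * K)%:R * (8 ^ u)%:R * (N%:R * (3 ^ u)%:R) :> R.
  rewrite /Z sF -/D /c (expnM 2 3 u) -[(2 ^ 3)%N]/8%N !natrM; ring.
apply: le_trans (ler_wpM2l _ key) _; first by rewrite mulr_ge0.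
have -> : (D * D.+1 * K)%:R * (8 ^ u)%:R * ((2 * (3 * u).+1)%:R * expR 1 ^+ l) =
   (D * D.+1 * K * (2 * (3 * u).+1) * 8 ^ u)%:R * expR 1 ^+ l :> R.
  by rewrite !natrM; ring.
rewrite exprMn mulrAC ler_wpM2r ?exprn_ge0 ?(ltW e0) //.
rewrite -natrX -natrM ler_nat.
apply: leq_trans (leq_mul P_le (leqnn _)) _.
(* The slack between [8 ^ u] and [12 ^ u], in the form [u ^ 23 * 2 ^ u <= 3 ^ u], absorbs the
   overhead. *)
have -> : (u ^ 23 * 8 ^ u = u ^ 23 * 2 ^ u * 4 ^ u)%N by rewrite -mulnA -expnMn.
by rewrite /l (expnM 2 2) mulnC leq_mul.
Qed.

Lemma decide_algorithm (R : realType) : exists (p : cmd) (d : nat), coin_free p /\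
  forall (I : pcrbds) (w : seq bool), exists n : nat,
    runs p (pcrbds_enc I) w (tree_of_bool (pcrbds_yes I)) n /\
    n%:R <= (2 * expR 1) ^+ target I * (tree_size (pcrbds_enc I))%:R ^+ d :> R.
Proof.
have [l [c [Z [F [/andP[l0 lc] Z0 l_big [F_lt F_inj fam_le Z_le]]]]]] := exists_parameters R.
have c0 : (0 < c)%N by exact: leq_trans lc.
have [t [p [v [K [free_p run_p]]]] [d t_le]] := timed_decide c0 Z0 F_lt fam_le.
have a1 : 1 <= 2 * expR 1 :> R.
  have : 1 <= expR 1 :> R by rewrite ltW // expR_gt1 ltr01.
  by lra.
set a := 2 * expR 1 in Z_le a1 *.
have a0 : 0 <= a by exact: le_trans a1.
have [b a_le] : exists b : nat, a <= 2 ^+ b.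
  exists (Num.truncn a).+1; apply: le_trans (ltW (truncnS_gt a)) _.
  by rewrite -natrX ler_nat ltnW // ltn_expl.
(* The summands pay, in this order, for the constant factor of the program, for [2 e] to the power
   of the logarithm of B, for rounding up to whole blocks, and for [S.+1 ^ d <= S ^ (2 * d)]. *)
exists p, (2 * K + b + b * l + 2 * d)%N; split=> // I w.
pose x := instance_of I.
have [s' [n [ex out _ n_le]]] := run_p x (update (fun=> Leaf) 0 (pcrbds_enc I)) w
  (esym (encode_instance_of I)).
exists n; split.
  by exists s', w; rewrite out (decide_correct l0 lc F_lt l_big F_inj).
have -> : tree_size (pcrbds_enc I) = sz x by rewrite /sz encode_instance_of.
set S := sz x; set q := num_blocks l x.
have nB_S : ((2 * nB I).+1 < S)%N by rewrite /S !sz_pair !sz_nat; clear; lia.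
have S2 : (1 < S)%N by exact: leq_trans nB_S.
have E_le : ((Z * 2 ^ c) ^ q)%:R <= a ^+ target I * S%:R ^+ (b + b * l) :> R.
  rewrite natrX; apply: le_trans (_ : (a ^+ l) ^+ q <= _).
    by apply: lerXn2r => //; rewrite nnegrE ?ler0n ?exprn_ge0.
  rewrite -exprM.
  have lq : (l * q <= target I + ceil_log (nB I) + l)%N.
    rewrite /q /num_blocks prednK // mulnC mulSn addnC leq_add2r.
    apply: leq_trans (leq_trunc_div _ _) _.
    by rewrite leq_add2r goalE geq_minr.
  apply: le_trans (ler_weXn2l a1 lq) _.
  rewrite -addnA exprD ler_wpM2l ?exprn_ge0 // exprD [leRHS]exprD.
  have pow j y : (2 ^ j <= y)%N -> a ^+ j <= y%:R ^+ b :> R.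
    move=> jy; apply: le_trans (_ : (2 ^+ b) ^+ j <= _).
      by apply: lerXn2r; rewrite ?nnegrE ?exprn_ge0.
    rewrite exprAC; apply: lerXn2r; rewrite ?nnegrE ?exprn_ge0 //.
    by rewrite -natrX ler_nat.
  apply: ler_pM; rewrite ?exprn_ge0 //.
    by apply: pow; have /andP[_] := ceil_logP (nB I); move/leq_trans; apply; exact: ltnW.
  apply: le_trans (_ : (2 ^+ b) ^+ l <= _).
    by apply: lerXn2r; rewrite ?nnegrE ?exprn_ge0.
  rewrite -exprM; apply: lerXn2r; rewrite ?nnegrE //.
  by rewrite ler_nat.
have n_le' : (n <= S ^ (2 * K) * ((Z * 2 ^ c) ^ q) * S ^ (2 * d))%N.
  set E := ((Z * 2 ^ c) ^ q)%N.
  have E0 : (0 < E)%N by rewrite expn_gt0 muln_gt0 Z0 expn_gt0.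
  have tx : (t x <= E * S.+1 ^ d)%N.
    apply: leq_trans (t_le x) _.
    by rewrite /E expnMn -expnM.
  apply: leq_trans n_le _.
  have h1 : ((t x).+1 <= 2 * (E * S.+1 ^ d))%N.
    have : (0 < E * S.+1 ^ d)%N by rewrite muln_gt0 E0 expn_gt0.
    by lia.
  apply: leq_trans (leq_mul (leqnn K) h1) _.
  rewrite mulnA [(K * 2)%N]mulnC -[leqRHS]mulnA; apply: leq_mul.
    exact/ltnW/ltn_expl.
  rewrite leq_mul2l expnM; apply/orP; right; apply: leq_exp2rw.
  by rewrite expnS expn1; clear -S2; nia.
move: ((Z * 2 ^ c) ^ q)%N E_le n_le' => E E_le n_le'.
apply: le_trans (_ : (S ^ (2 * K) * E * S ^ (2 * d))%:R <= _); first by rewrite ler_nat.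
rewrite !natrM !natrX.
apply: le_trans (_ : S%:R ^+ (2 * K) * (a ^+ target I * S%:R ^+ (b + b * l)) * S%:R ^+ (2 * d) <= _).
  by rewrite ler_wpM2r ?exprn_ge0 // ler_wpM2l ?exprn_ge0.
by rewrite le_eqVlt; apply/orP; left; apply/eqP; rewrite !exprD; ring.
Qed.

Theorem theorem4p1 (R : realType) :
  (exists g : nat -> R,
     g =o_\oo (fun t : nat => t%:R : R) /\
     deterministic_Ostar pcrbds_enc target pcrbds_yes
       (fun t : nat => (2 * expR 1) `^ (t%:R + g t))) /\
  randomized_Ostar pcrbds_enc target pcrbds_yes
    (fun t : nat => (2 * expR 1) ^+ t) (1 - 1 / expR 1 : R).
Proof.
have [p [d [free_p run_p]]] := decide_algorithm R.
split.
  exists (fun=> 0); split.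
    apply/eqoP => _ /posnumP[e]; near=> t.
    by rewrite normr0 mulr_ge0.
  exists p, d; split=> // I; have [n [run n_le]] := run_p I [::].
  by exists n; split=> //; rewrite addr0 powR_mulrn.
exists p, d => I; exists 0%N; split.
  move=> w; have [n [run n_le]] := run_p I w.
  by exists (tree_of_bool (pcrbds_yes I)), n.
rewrite (_ : [set w | _]%SET = [set: 0.-tuple bool]%SET); last first.
  apply/setP => w; rewrite !inE; apply/asboolP.
  by have [n [run _]] := run_p I w; exists n.
rewrite cardsT card_tuple expr0 divr1 expn0.
by rewrite lerBlDr lerDl divr_ge0 ?expR_ge0.
Unshelve. all: by end_near.
Qed.
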